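(* Let $\Omega\subset\mathbb{R}^n$ be a bounded domain, let $f:\partial\Omega\to\mathbb{R}$ be Lipschitz continuous, let $g:\Omega\to[0,\infty)$ be bounded and measurable, and set $D=\{x\in\Omega: g(x)>0\}$. Assume that $g_*(x)>0$ for all $x\in\operatorname{int}D$, where $g_*(x)=\liminf_{y\to x}g(y)$. For $p>\max\{2,n\}$ let $u_p$ be the unique weak solution of $\Delta_pu_p=g$ in $\Omega$, $u_p=f$ on $\partial\Omega$. If $u_\infty$ is a uniform limit in $\overline\Omega$ of a subsequence of $(u_p)$ as $p\to\infty$, then $u_\infty$ is a viscosity solution of $$\min\{\Delta_\infty u,\ |Du|-\chi_D\}=0\ \text{ in }\Omega,\qquad u=f\ \text{ on }\partial\Omega.$$
   Context: $\Delta_p u=\operatorname{div}(|Du|^{p-2}Du)$. The weak solution $u_p$ is the unique $u\in W^{1,p}(\Omega)\cap C(\overline\Omega)$ with $u=f$ on $\partial\Omega$ and $-\int_\Omega|Du|^{p-2}Du\cdot D\varphi\,dx=\int_\Omega g\varphi\,dx$ for all $\varphi\in C_0^\infty(\Omega)$. The semicontinuous envelope $g_*$ is understood as the lower semicontinuous envelope of $g$, so $g_*\le g$. $\Delta_\infty u(x)=\sum_{i,j=1}^n u_{ij}(x)u_i(x)u_j(x)$ is the infinity Laplacian, $\chi_E$ is the characteristic function of a set $E$, and $\operatorname{int}D$, $\overline D$ are the topological interior and closure of $D$. The condition $u=f$ on $\partial\Omega$ means $\lim_{x\to z}u(x)=f(z)$ for all $z\in\partial\Omega$. An upper semicontinuous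 $u:\Omega\to\mathbb{R}$ is a viscosity subsolution of $\min\{\Delta_\infty u,|Du|-\chi_D\}=0$ in $\Omega$ if, whenever $x\in\Omega$ and $\varphi\in C^2(\Omega)$ are such that $u-\varphi$ has a strict local maximum at $x$, then $\min\{\Delta_\infty\varphi(x),|D\varphi(x)|-\chi_{\operatorname{int}D}(x)\}\ge 0$. A lower semicontinuous $v:\Omega\to\mathbb{R}$ is a viscosity supersolution if, whenever $x\in\Omega$ and $\phi\in C^2(\Omega)$ are such that $v-\phi$ has a strict local minimum at $x$, then $\min\{\Delta_\infty\phi(x),|D\phi(x)|-\chi_{\overline D}(x)\}\le 0$. A continuous function is a viscosity solution if it is both. *)

(* Defs.v *)
From HB Require Import structures.
From mathcomp Require Import all_boot all_order all_algebra.
From mathcomp Require Import all_classical all_reals all_analysis.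

Set Implicit Arguments.
Unset Strict Implicit.
Unset Printing Implicit Defensive.

Import Order.TTheory GRing.Theory Num.Theory.
Import numFieldNormedType.Exports.

Local Open Scope classical_set_scope.
Local Open Scope ring_scope.

(* Lebesgue measure on R^n: the completion (Caratheodory extension) of the
   n-fold product of the one-dimensional Lebesgue measure. *)

Definition rV_display : measure_display.
Proof. exact: default_measure_display. Qed.

Section rV_borel.
Context {R : realType} {n : nat}.

Definition rV_coord (i : 'I_n) (x : 'rV[R]_n) : measurableTypeR R := x ord0 i.

Let rV_set0 : g_sigma_preimage rV_coord set0.
Proof. exact: sigma_algebra0. Qed.

Let rV_setC A : g_sigma_preimage rV_coord A -> g_sigma_preimage rV_coord (~` A).
Proof. exact: sigma_algebraC. Qed.

Let rV_bigcup (F : _^nat) : (forall i, g_sigma_preimage rV_coord (F i)) ->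
  g_sigma_preimage rV_coord (\bigcup_i (F i)).
Proof. exact: sigma_algebra_bigcup. Qed.

HB.instance Definition _ := @isMeasurable.Build rV_display 'rV[R]_n
  (g_sigma_preimage rV_coord) rV_set0 rV_setC rV_bigcup.

Lemma measurable_rV_coord (i : 'I_n) : measurable_fun setT (rV_coord i).
Proof.
move=> _ Y mY; rewrite setTI; apply: sub_sigma_algebra => /=.
rewrite -bigcup_seq/=; exists i => /=; first by rewrite mem_index_enum.
by exists Y => //; rewrite setTI.
Qed.

Lemma measurable_fun_rV d (T : measurableType d) (f : T -> 'rV[R]_n) :
  (forall i, measurable_fun setT (rV_coord i \o f)) -> measurable_fun setT f.
Proof.
move=> mf _ A mA; rewrite setTI.
have sub : g_sigma_preimage (fun i => rV_coord i \o f) `<=` measurable.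
  apply: smallest_sub; first exact: sigma_algebra_measurable.
  move=> B; rewrite -bigcup_seq/= => -[i _ [C mC <-]]; exact: mf.
by apply: sub; rewrite g_sigma_preimage_comp; exists A => //; rewrite setTI.
Qed.

End rV_borel.

Section lebesgue_rV.
Context {R : realType}.

Definition rV_cons n (p : measurableTypeR R * 'rV[R]_n) : 'rV[R]_n.+1 :=
  row_mx (p.1 : R)%:M p.2.

Definition rV_uncons n (x : 'rV[R]_n.+1) : measurableTypeR R * 'rV[R]_n :=
  (x ord0 ord0, \row_i x ord0 (lift ord0 i)).

Lemma rV_consE n p (i : 'I_n.+1) : @rV_cons n p ord0 i =
  if unlift ord0 i is Some j then p.2 ord0 j else p.1.
Proof.
case: (unliftP ord0 i) => [j|] ->.
  have -> : lift ord0 j = rshift 1 j :> 'I_(1 + n) by apply/ord_inj.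
  exact: row_mxEr.
have -> : ord0 = lshift n (ord0 : 'I_1) :> 'I_(1 + n) by apply/ord_inj.
by apply: etrans (row_mxEl _ _ _ _) _; rewrite mxE.
Qed.

Lemma rV_consK n : cancel (@rV_cons n) (@rV_uncons n).
Proof.
move=> [a x]; rewrite /rV_uncons rV_consE unlift_none/=; congr pair.
by apply/rowP => i; rewrite mxE rV_consE liftK.
Qed.

Lemma measurable_rV_cons n : measurable_fun setT (@rV_cons n).
Proof.
apply: measurable_fun_rV => i; rewrite (_ : _ \o _ = fun p =>
  if unlift ord0 i is Some j then rV_coord j p.2 else p.1); last first.
  by apply/funext => p /=; rewrite /rV_coord rV_consE.
case: (unlift ord0 i) => [j|]; last exact: measurable_fst.
exact: (measurableT_comp (measurable_rV_coord j) measurable_snd).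
Qed.

Lemma measurable_rV_uncons n : measurable_fun setT (@rV_uncons n).
Proof.
apply/measurable_fun_pairP; split; first exact: measurable_rV_coord.
apply: measurable_fun_rV => i.
rewrite (_ : _ \o _ = rV_coord (lift ord0 i)); first exact: measurable_rV_coord.
by apply/funext => x /=; rewrite /rV_coord mxE.
Qed.

Section borel_lebesgue_succ.
Local Open Scope ereal_scope.
Context n (mu : {sigma_finite_measure set 'rV[R]_n -> \bar R}).

Definition borel_lebesgue_succ : set 'rV[R]_n.+1 -> \bar R :=
  pushforward (@lebesgue_measure R \x mu) (@rV_cons n).

Let mrV_cons A : measurable A -> measurable (@rV_cons n @^-1` A).
Proof. by move=> mA; rewrite -[X in measurable X]setTI; exact: measurable_rV_cons. Qed.

Let succ0 : borel_lebesgue_succ set0 = 0.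
Proof. by rewrite /borel_lebesgue_succ /pushforward preimage_set0 measure0. Qed.

Let succ_ge0 A : 0 <= borel_lebesgue_succ A.
Proof. by rewrite /borel_lebesgue_succ /pushforward; exact: measure_ge0. Qed.

Let succ_sigma_additive : semi_sigma_additive borel_lebesgue_succ.
Proof.
move=> F mF tF mUF; rewrite /borel_lebesgue_succ /pushforward preimage_bigcup.
apply: measure_semi_sigma_additive => [k||]; first exact: mrV_cons.
- apply/trivIsetP => /= i j _ _ ij; rewrite -preimage_setI.
  by move/trivIsetP : tF => /(_ _ _ _ _ ij) ->//; rewrite preimage_set0.
- by rewrite -preimage_bigcup; exact: mrV_cons.
Qed.

HB.instance Definition _ := isMeasure.Build _ _ _ borel_lebesgue_succ
  succ0 succ_ge0 succ_sigma_additive.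

Let succ_sigma_finite : sigma_finite setT borel_lebesgue_succ.
Proof.
have /sigma_finiteP[F [TF ndF Foo]] := sigma_finiteT (@lebesgue_measure R).
have /sigma_finiteP[G [TG ndG Goo]] := sigma_finiteT mu.
exists (fun k => @rV_uncons n @^-1` (F k `*` G k)).
  rewrite -preimage_bigcup (_ : \bigcup_k _ = setT) ?preimage_setT//.
  apply/seteqP; split => // -[x y] _.
  have [k _ Fkx] : (\bigcup_k F k) x by rewrite -TF.
  have [l _ Gly] : (\bigcup_k G k) y by rewrite -TG.
  exists (maxn k l) => //; split.
  - by move: x Fkx; exact/subsetPset/ndF/leq_maxl.
  - by move: y Gly; exact/subsetPset/ndG/leq_maxr.
move=> k; have [mFk Fkoo] := Foo k; have [mGk Gkoo] := Goo k.
have mFG : measurable (F k `*` G k) by exact: measurableX.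
split; first by rewrite -[X in measurable X]setTI; exact: measurable_rV_uncons.
rewrite /borel_lebesgue_succ /pushforward -comp_preimage.
rewrite (_ : @rV_uncons n \o _ = id); last by apply/funext => x; exact: rV_consK.
by rewrite preimage_id product_measure1E// lte_mul_pinfty// ge0_fin_numE.
Qed.

HB.instance Definition _ := Measure_isSigmaFinite.Build _ _ _
  borel_lebesgue_succ succ_sigma_finite.

End borel_lebesgue_succ.

(* R^0 is a point, of measure 1. *)
Fixpoint borel_lebesgue n : {sigma_finite_measure set 'rV[R]_n -> \bar R} :=
  if n is m.+1 then borel_lebesgue_succ (borel_lebesgue m)
  else \d_(0 : 'rV[R]_0).

End lebesgue_rV.

Definition lebesgue_rVType (R : realType) (n : nat) :=
  caratheodory_type ((@borel_lebesgue R n)^*)%mu.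

Definition lebesgue_rV (R : realType) (n : nat) :
  {measure set (lebesgue_rVType R n) -> \bar R} :=
  @completed_measure_extension _ _ _ (@borel_lebesgue R n).

Section calculus.
Context {R : realType} {n : nat}.
Local Notation E := 'rV[R]_n.
Implicit Types (phi u v f g : E -> R) (A D Omega : set E).

Definition partial (i : 'I_n) phi : E -> R := 'D_(delta_mx ord0 i) phi.

Definition gradient phi (x : E) : E := \row_i partial i phi x.

Definition dotmul (x y : E) : R := \sum_(i < n) x ord0 i * y ord0 i.

(* The norm `|x| provided by the library on 'rV[R]_n is the sup norm. *)
Definition enorm (x : E) : R := Num.sqrt (dotmul x x).

Definition infinity_laplacian phi (x : E) : R :=
  \sum_(i < n) \sum_(j < n)
    partial j (partial i phi) x * partial i phi x * partial j phi x.

(* Class C^k on an open set A, through iterated partial derivatives. *)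
Fixpoint Ck (k : nat) A phi : Prop :=
  (forall x, A x -> {for x, continuous phi}) /\
  if k is k'.+1 then
    forall i : 'I_n, (forall x, A x -> derivable phi x (delta_mx ord0 i)) /\
                     Ck k' A (partial i phi)
  else True.

Definition boundary A : set E := closure A `\` A°.

Definition domain Omega := [/\ open Omega, connected Omega & Omega !=set0].

Definition lipschitz_on_set A f := exists L : R,
  forall x y, A x -> A y -> `|f x - f y| <= L * enorm (x - y).

(* Elements of C_0^oo(Omega), extended by 0 outside Omega. *)
Definition test_function Omega phi :=
  [/\ forall k, Ck k setT phi,
      compact (closure [set x | phi x != 0]) &
      closure [set x | phi x != 0] `<=` Omega].

End calculus.

Section sobolev.
Context {R : realType} {n : nat}.
Local Notation E := 'rV[R]_n.
Local Notation mu := (lebesgue_rV R n).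
Implicit Types (phi u f g : E -> R) (Omega : set E) (p : R).

Definition in_Lp Omega p u :=
  (u \_ Omega : lebesgue_rVType R n -> R) \in Lfun mu p%:E.

Definition weak_gradient Omega u (Du : E -> E) :=
  forall phi, test_function Omega phi -> forall i : 'I_n,
    (\int[mu]_(x in Omega) (u x * partial i phi x)) =
    - (\int[mu]_(x in Omega) (Du x ord0 i * phi x)).

(* u is in W^{1,p}(Omega), with a version Du of its weak gradient. *)
Definition sobolev1 Omega p u (Du : E -> E) :=
  [/\ in_Lp Omega p u, forall i : 'I_n, in_Lp Omega p (fun x => Du x ord0 i)
    & weak_gradient Omega u Du].

Definition boundary_value Omega f u :=
  forall z, boundary Omega z -> u x @[x --> within Omega (nbhs z)] --> f z.

Definition weak_solution Omega p f g u :=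
  [/\ {within closure Omega, continuous u}, boundary_value Omega f u &
      exists2 Du : E -> E, sobolev1 Omega p u Du &
        forall phi, test_function Omega phi ->
          - (\int[mu]_(x in Omega)
              (enorm (Du x) `^ (p - 2) * dotmul (Du x) (gradient phi x))) =
          \int[mu]_(x in Omega) (g x * phi x)].

(* The liminf as y --> x in Omega, the value y = x being allowed. *)
Definition lsc_envelope Omega g (x : E) : \bar R :=
  limf_einf (EFin \o g) (within Omega (nbhs x)).

End sobolev.

Section viscosity.
Context {R : realType} {n : nat}.
Local Notation E := 'rV[R]_n.
Implicit Types (phi u v f : E -> R) (D Omega : set E).

Definition usc_on Omega u := forall x, Omega x ->
  forall a, u x < a -> \forall y \near within Omega (nbhs x), u y < a.

Definition lsc_on Omega u := forall x, Omega x ->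
  forall a, a < u x -> \forall y \near within Omega (nbhs x), a < u y.

Definition strict_local_max Omega u (x : E) :=
  \forall y \near within Omega (nbhs x), y != x -> u y < u x.

Definition strict_local_min Omega u (x : E) :=
  \forall y \near within Omega (nbhs x), y != x -> u x < u y.

Definition viscosity_subsolution Omega D u :=
  usc_on Omega u /\
  forall x phi, Omega x -> Ck 2 Omega phi ->
    strict_local_max Omega (u \- phi) x ->
    Num.min (infinity_laplacian phi x)
            (enorm (gradient phi x) - \1_(D°) x) >= 0.

Definition viscosity_supersolution Omega D v :=
  lsc_on Omega v /\
  forall x phi, Omega x -> Ck 2 Omega phi ->
    strict_local_min Omega (v \- phi) x ->
    Num.min (infinity_laplacian phi x)
            (enorm (gradient phi x) - \1_(closure D) x) <= 0.

Definition viscosity_solution Omega D u :=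
  [/\ {within Omega, continuous u}, viscosity_subsolution Omega D u &
      viscosity_supersolution Omega D u].

End viscosity.

(* Main.v *)
(* Suppose that [u_oo - phi] has a strict local maximum at [x0] and that [phi] violates
   the viscosity inequality there.  Since
     Delta_p phi = |D phi|^(p-4) ((p-2) Delta_oo phi + |D phi|^2 Delta phi),
   for all large [p] there is [m > 0] with [Delta_p phi <= g - m] near [x0]: the term
   with [p - 2] dominates if [Delta_oo phi(x0) < 0], and the whole expression tends to
   0 if [|D phi(x0)| < 1], where [g] is bounded below by lower semicontinuity.  By
   uniform convergence [u_p - phi] is smaller on an annulus around [x0] than at [x0],
   which contradicts the comparison principle.  Minima are treated in the same way,
   the sign being a parameter.

   For the comparison principle put [w = (u_p - phi - c)_+].  The admissible test
   functions being smooth, [w] itself is replaced by [eta(w * rho_e - delta)] with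
   [eta] smooth and flat at 0.  By monotonicity of [v |-> |v|^(p-2) v] the resulting
   error is at most a multiple of [\int |F| |z * rho_e - z|], where [z] is the weak
   gradient of [w] in L^p and [|F|] is bounded by the power [p - 1] of an L^p function;
   it tends to 0 with [e]. *)
From HB Require Import structures.
Require Import Defs.
From mathcomp Require Import all_boot all_order all_algebra.
From mathcomp Require Import all_classical all_reals all_analysis.
From mathcomp Require Import measurable_realfun.
From mathcomp Require Import lra ring.

Set Implicit Arguments.
Unset Strict Implicit.
Unset Printing Implicit Defensive.

Import Order.TTheory GRing.Theory Num.Theory.
Import numFieldNormedType.Exports.

Local Open Scope classical_set_scope.
Local Open Scope ring_scope.

(** * Lebesgue measure on R^n *)

(** Two obstacles shape the proof. First, the equation for [u_p] may be tested only with smooth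
    functions of compact support, so a positive part cannot be inserted. The way out is to work on
    the open set where [w > 0]: there [w] is affine in [u_p] and [phi], so its weak gradient against
    test functions supported in that set is known without a chain rule, and continuity of [w] puts
    the support of [eta(w * rho_e - delta)] inside it. Second, [m] may decay like [b^(q-1)] with
    [q = (p - 2) / 2], so no margin uniform in [p] is available. The comparison is made for one
    fixed [p], with [e] chosen after it, and any positive [m] suffices; only the neighbourhood of
    [x0] must be independent of [p].

    The interior and the closure of [D] appear because [g] has to be controlled on a whole
    neighbourhood of [x0]: it is bounded below by a positive constant near a point of the interior,
    and vanishes near a point of [Omega] outside the closure. At a minimum in the closure of [D],
    [|D phi| > 1] makes [Delta_p phi] exceed the upper bound of [g]. *)

Section measure_rV.
Context {R : realType} {n : nat}.
Local Notation E := 'rV[R]_n.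
Local Notation mu := (lebesgue_rV R n).
Local Notation muB := (@borel_lebesgue R n).

(** The norm of row vectors is the sup norm, so balls are open cubes: products of intervals, hence
    measurable and of explicit volume. *)
Lemma rV_ballE (c x : E) (r : R) :
  0 < r -> ball c r x <-> forall i, `|c ord0 i - x ord0 i| < r.
Proof.
move=> r0; split => [[_ h] i|h]; first exact: h.
by split => // i j; rewrite ord1; exact: h.
Qed.

Lemma measurable_rV_coord_preimage (i : 'I_n) (A : set R) :
  measurable (A : set (measurableTypeR R)) -> measurable [set x : E | A (x ord0 i)].
Proof.
by move=> mA; rewrite -[X in measurable X]setTI; exact: (measurable_rV_coord (R := R) i).
Qed.

Lemma measurable_rV_ball (c : E) (r : R) : measurable (ball c r).
Proof.
have [r0|r0] := ltP 0 r; last first.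
  rewrite (_ : ball c r = set0); first exact: measurable0.
  by apply/seteqP; split => // x [/lt_le_trans/(_ r0)]; rewrite ltxx.
rewrite (_ : ball c r = \bigcap_(i in [set: 'I_n])
   [set x : E | ball (c ord0 i) r (x ord0 i)]); last first.
  apply/seteqP; split => x.
    by move=> /(rV_ballE _ _ r0) h i _; exact: h.
  by move=> h; apply/(rV_ballE _ _ r0) => i; exact: h.
apply: fin_bigcap_measurable => // i _.
apply: (@measurable_rV_coord_preimage i (ball (c ord0 i) r)).
exact: measurable_ball.
Qed.

(** Measurability is generated by the coordinates, so an open set is exhausted by countably many
    cubes: those with rational centre and radius [1/(k+1)] that it contains. *)
Lemma open_measurable_rV (A : set E) : open A -> measurable A.
Proof.
move=> oA.
pose q (c : 'rV[rat]_n) : E := map_mx ratr c.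
pose J := [set p : 'rV[rat]_n * nat | ball (q p.1) p.2.+1%:R^-1 `<=` A].
rewrite (_ : A = \bigcup_(p in J) ball (q p.1) p.2.+1%:R^-1).
  rewrite bigcup_mkcond; apply: countable_bigcupT_measurable => // p.
  by case: ifP => _ //; exact: measurable_rV_ball.
apply/seteqP; split => [x Ax|x [p Jp]]; last exact: Jp.
have /nbhs_ballP[e /= e0 eA] : nbhs x A by move: oA; rewrite openE; exact.
(* A cube of radius below [e / 2] that contains [x] lies in the cube of radius [e] about [x]. *)
have [k ke] : exists k : nat, k.+1%:R^-1 < e / 2.
  have := @near_infty_natSinv_lt R (PosNum (divr_gt0 e0 (ltr0Sn _ 1))).
  by move=> [k _ /(_ k (leqnn _)) ?]; exists k.
have qex i : exists r : rat, ratr r \in `](x ord0 i - k.+1%:R^-1), (x ord0 i)[.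
  by apply: rat_in_itvoo; rewrite ltrBlDr ltrDl invr_gt0 ltr0Sn.
pose c : 'rV[rat]_n := \row_i (xchoose (qex i)).
have cx i : `|q c ord0 i - x ord0 i| < k.+1%:R^-1.
  have aux (a b d : R) : b - d < a < b -> `|a - b| < d.
    by move=> /andP[? ?]; rewrite ltr_norml; apply/andP; split; lra.
  by rewrite !mxE; apply: aux; have := xchooseP (qex i); rewrite in_itv.
have k0 : 0 < k.+1%:R^-1 :> R by rewrite invr_gt0.
exists (c, k); last exact/(rV_ballE _ _ k0).
move=> y /= /(rV_ballE _ _ k0) h; apply: eA; apply/(rV_ballE _ _ e0) => i.
have aux (a b d f : R) : `|a - b| < f -> `|a - d| < f -> f < e / 2 -> `|b - d| < e.
  by rewrite !ltr_norml => /andP[? ?] /andP[? ?] ?; apply/andP; split; lra.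
exact: aux (cx i) (h i) ke.
Qed.

Lemma sub_cara_rV (A : set E) : measurable A -> measurable (A : set (lebesgue_rVType R n)).
Proof. by move=> mA; apply: caratheodory_measurable_mu_ext. Qed.

Lemma lebesgue_rVE (A : set E) : measurable A -> mu A = muB A.
Proof.
by move=> mA; exact: (measurable_mu_extE muB).
Qed.

Lemma measurable_id_rV : measurable_fun setT (id : lebesgue_rVType R n -> E).
Proof. by move=> _ Y mY; rewrite setTI; exact: sub_cara_rV. Qed.

Lemma lebesgue_rV_sigma_finite : sigma_finite setT mu.
Proof. apply: completed_measure_extension_sigma_finite; exact: sigma_finiteT. Qed.

(** [lebesgue_rV] is typed as a mere measure; Tonelli's theorem in [kernel_error] asks for the
    sigma-finite structure. *)
Definition lebesgue_rV_sf : {sigma_finite_measure set (lebesgue_rVType R n) -> \bar R} :=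
  HB.pack_for {sigma_finite_measure set (lebesgue_rVType R n) -> \bar R} (Measure.sort mu)
    (Measure.class mu) (Measure_isSigmaFinite.Build _ _ _ mu lebesgue_rV_sigma_finite).

Lemma open_continuous_borel_measurable (A : set E) (f : E -> R) : open A ->
  (forall x, A x -> {for x, continuous f}) ->
  measurable_fun A f.
Proof.
move=> oA cf.
apply: (measurability _ (RGenOpens.measurableE R)).
move=> _ [_ [a [b ->]] <-]; apply: open_measurable_rV.
rewrite openE => x [Ax Bx]; apply: filterI; first exact: open_nbhs_nbhs.
by apply: (cf _ Ax); apply: open_nbhs_nbhs; split => //; exact: interval_open.
Qed.

Lemma open_continuous_measurable (A : set E) (f : E -> R) : open A ->
  (forall x, A x -> {for x, continuous f}) ->
  measurable_fun (A : set (lebesgue_rVType R n)) (f : lebesgue_rVType R n -> R).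
Proof.
move=> oA cf _ Y mY; apply: sub_cara_rV.
by apply: open_continuous_borel_measurable => //; exact: open_measurable_rV.
Qed.

Lemma borel_measurable_cara d (T : measurableType d) (f : E -> T) :
  measurable_fun setT f ->
  measurable_fun setT (f : lebesgue_rVType R n -> T).
Proof. by move=> mf; exact: (measurableT_comp mf measurable_id_rV). Qed.
End measure_rV.

(** * Translation invariance and the volume of cubes *)

Section translation.
Context {R : realType}.

Lemma lebesgue_measure_translation (h : R) (A : set R) :
  measurable (A : set (measurableTypeR R)) ->
  pushforward (@lebesgue_measure R) (fun x : measurableTypeR R => (x + h : measurableTypeR R)) A
  = lebesgue_measure A.
Proof.
move=> mA.
have mh : measurable_fun setT (fun x : measurableTypeR R => x + h : measurableTypeR R).
  by apply: measurable_funD; [exact: measurable_id|exact: measurable_cst].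
pose m : {measure set (measurableTypeR R) -> \bar R} :=
  pushforward (@lebesgue_measure R) (fun x : measurableTypeR R => x + h : measurableTypeR R).
suff e : @lebesgue_measure R A = m mh A by exact: esym e.
apply: (@lebesgue_measure_unique R (m mh)) => // X [[a b]] _ <-.
rewrite /m/= /pushforward.
rewrite (_ : _ @^-1` _ = `]a - h, b - h]%classic); last first.
  by apply/seteqP; split => x /=; rewrite !in_itv/= ltrBlDr lerBrDr.
by rewrite !lebesgue_measure_itv/= !lte_fin ltrD2r -!EFinB opprB addrA subrK.
Qed.

Lemma ge0_integral_translation1 (h : R) (f : measurableTypeR R -> \bar R) :
  measurable_fun setT f -> (forall x, 0 <= f x)%E ->
  (\int[@lebesgue_measure R]_x f (x + h)%R = \int[@lebesgue_measure R]_x f x)%E.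
Proof.
move=> mf f0.
have mh : measurable_fun setT (fun x : measurableTypeR R => x + h : measurableTypeR R).
  by apply: measurable_funD; [exact: measurable_id|exact: measurable_cst].
transitivity (\int[pushforward (@lebesgue_measure R)
    (fun x : measurableTypeR R => (x + h)%R : measurableTypeR R)]_x f x)%E.
  by rewrite ge0_integral_pushforward.
apply: eq_measure_integral => /= A mA _; exact: lebesgue_measure_translation.
Qed.

(** A cube is the product of an interval of length [2 r] and a cube of one dimension less. In
    dimension 0 the Dirac mass gives the empty product. *)
Lemma borel_lebesgue_ball n (c : 'rV[R]_n) (r : R) : 0 < r ->
  borel_lebesgue n (ball c r) = ((r *+ 2) ^+ n)%:E.
Proof.
move=> r0; elim: n c => [c|n IH c] /=.
  by rewrite diracE expr0 mem_set //; apply/(rV_ballE _ _ r0) => -[].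
rewrite /borel_lebesgue_succ /pushforward.
rewrite (_ : _ @^-1` _ = ball (rV_uncons c).1 r `*` ball (rV_uncons c).2 r).
  rewrite product_measure1E//; [|exact: measurable_ball|exact: measurable_rV_ball].
  rewrite IH exprS EFinM; congr (_ * _)%E.
  by apply: lebesgue_measure_ball; exact: ltW.
apply/seteqP; split => [[a x]|[a x] []] /=.
  move=> /(rV_ballE _ _ r0) h; split.
    by have := h ord0; rewrite rV_consE unlift_none.
  apply/(rV_ballE _ _ r0) => i.
  by have := h (lift ord0 i); rewrite rV_consE liftK mxE.
move=> h /(rV_ballE _ _ r0) h'; apply/(rV_ballE _ _ r0) => i.
rewrite rV_consE; case: unliftP => [j|] ->//=.
by have := h' j; rewrite mxE.
Qed.

Lemma borel_measurable_translation n (h : 'rV[R]_n) :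
  measurable_fun setT (fun x : 'rV[R]_n => x + h).
Proof.
apply: measurable_fun_rV => i.
rewrite (_ : _ \o _ = fun x => rV_coord i x + h ord0 i :> R).
  by apply: measurable_funD => //; exact: measurable_rV_coord.
by apply/funext => x /=; rewrite /rV_coord mxE.
Qed.

(** The product measure integrates the measures of sections. The section at [a] of the translated
    set is a translate of the section at [a + h ord0 ord0], so the induction hypothesis and the
    one-dimensional case combine. *)
Lemma borel_lebesgue_translation n (h : 'rV[R]_n) (A : set 'rV[R]_n) :
  measurable A -> borel_lebesgue n ((fun x => x + h) @^-1` A) = borel_lebesgue n A.
Proof.
elim: n h A => [h A mA|n IH h A mA].
  congr (borel_lebesgue 0 _); apply/seteqP.
  by split => x /=; rewrite (_ : x + h = x)//; apply/rowP => -[].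
rewrite /= /borel_lebesgue_succ /pushforward /product_measure1.
set B := @rV_cons _ _ @^-1` A.
have mB : measurable B.
  by rewrite -[X in measurable X]setTI; exact: measurable_rV_cons.
transitivity (\int[@lebesgue_measure R]_x
    (borel_lebesgue n \o xsection B) (x + h ord0 ord0)%R)%E; last first.
  by rewrite ge0_integral_translation1//; exact: measurable_fun_xsection.
apply: eq_integral => a _ /=.
rewrite -[RHS](IH (rV_uncons h).2); last exact: measurable_xsection.
congr (borel_lebesgue n _); apply/seteqP.
have e x : rV_cons (a, x) + h = rV_cons (a + h ord0 ord0, x + (rV_uncons h).2).
  apply/rowP => i; rewrite mxE !rV_consE; case: unliftP => [j|] ->//=.
  by rewrite !mxE.
by split => x /=; rewrite /xsection/= !in_setE /B/= e.
Qed.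

(** [f] is Borel: both integrals are pushed forward from the completed to the Borel sigma-algebra,
    where the two image measures agree on every set. *)
Lemma ge0_integral_translation n (h : 'rV[R]_n) (f : 'rV[R]_n -> \bar R) :
  measurable_fun setT f -> (forall x, 0 <= f x)%E ->
  (\int[lebesgue_rV R n]_x f (x + h)%R = \int[lebesgue_rV R n]_x f x)%E.
Proof.
move=> mf f0.
have mh := borel_measurable_cara (borel_measurable_translation h).
pose B : measurableType rV_display := 'rV[R]_n.
transitivity (\int[@pushforward _ _ _ B _ (lebesgue_rV R n) (fun x => x + h)%R]_x f x)%E.
  by rewrite ge0_integral_pushforward.
have mi : @measurable_fun _ _ _ B setT (id : lebesgue_rVType R n -> B).
  exact: measurable_id_rV.
transitivity (\int[@pushforward _ _ _ B _ (lebesgue_rV R n) id]_x f x)%E; last first.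
  by rewrite ge0_integral_pushforward.
apply: (@eq_measure_integral _ B) => A mA _; rewrite /pushforward.
have mhA : measurable ((fun x : 'rV[R]_n => x + h) @^-1` A).
  by rewrite -[X in measurable X]setTI; exact: borel_measurable_translation.
apply: etrans (lebesgue_rVE mhA) _; rewrite borel_lebesgue_translation//.
exact: esym (lebesgue_rVE mA).
Qed.

Lemma integral_translation n (h : 'rV[R]_n) (f : 'rV[R]_n -> R) :
  measurable_fun setT f ->
  \int[lebesgue_rV R n]_x f (x + h) = \int[lebesgue_rV R n]_x f x.
Proof.
move=> mf; rewrite /Rintegral; congr fine.
have mF : measurable_fun setT (EFin \o f) by exact/measurable_EFinP.
rewrite integralE [RHS]integralE; congr (_ - _)%E.
- have H := ge0_integral_translation h (measurable_funepos mF) (funepos_ge0 _).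
  transitivity (\int[lebesgue_rV R n]_x ((EFin \o f : 'rV[R]_n -> \bar R)^\+ (x + h)%R))%E.
    by apply: eq_integral => x _; rewrite !funeposE.
  by rewrite H; apply: eq_integral => x _; rewrite !funeposE.
- have H := ge0_integral_translation h (measurable_funeneg mF) (funeneg_ge0 _).
  transitivity (\int[lebesgue_rV R n]_x ((EFin \o f : 'rV[R]_n -> \bar R)^\- (x + h)%R))%E.
    by apply: eq_integral => x _; rewrite !funenegE.
  by rewrite H; apply: eq_integral => x _; rewrite !funenegE.
Qed.

Lemma lebesgue_rV_ball n (c : 'rV[R]_n) (r : R) : 0 < r ->
  lebesgue_rV R n (ball c r) = ((r *+ 2) ^+ n)%:E.
Proof.
move=> r0; rewrite -(borel_lebesgue_ball c r0).
exact: (lebesgue_rVE (measurable_rV_ball c r)).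
Qed.
End translation.

(** * Functions of class C^k *)

Section calculus_rV.
Context {R : realType} {n : nat}.
Local Notation E := 'rV[R]_n.
Local Notation e_ i := (delta_mx ord0 i : E).
Implicit Types (f g : E -> R) (x v : E) (A B : set E).

(** Reduces directional derivatives to one real variable, where the chain rule and the mean value
    theorem live. *)
Lemma is_derive_line f x v (t d : R) :
  is_derive (t *: v + x) v f d <-> is_derive t (1 : R) (fun s => f (s *: v + x)) d.
Proof.
have e : (fun h : R => h^-1 *: ((f \o shift (t *: v + x)) (h *: v) - f (t *: v + x))) =
    (fun h : R => h^-1 *: (((fun s => f (s *: v + x)) \o shift t) (h *: (1 : R)) - f (t *: v + x))).
  by apply/funext => h /=; rewrite addrA -scalerDl [h *: 1]mulr1.
by split => -[]; rewrite /derivable /derive => a b; split;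
  rewrite /derivable /derive; move: a b; rewrite e.
Qed.

Lemma is_derive_comp (h : R -> R) f x v (dh df : R) :
  is_derive (f x) 1 h dh -> is_derive x v f df -> is_derive x v (h \o f) (dh * df).
Proof.
move=> hh hf; have x0 : x = 0 *: v + x by rewrite scale0r add0r.
rewrite x0 in hf hh *; apply/is_derive_line.
exact: (@is_derive1_comp _ h (fun s => f (s *: v + x))) hh (iffLR (is_derive_line _ _ _ _ _) hf).
Qed.

Lemma Ck_cont k A f x : Ck k A f -> A x -> {for x, continuous f}.
Proof. by case: k => [|k] [h _]; exact: h. Qed.

Lemma Ck_partial k A f i : Ck k.+1 A f -> Ck k A (partial i f).
Proof. by move=> [_ h]; exact: (h i).2. Qed.

Lemma Ck_is_derive k A f i x : Ck k.+1 A f -> A x -> is_derive x (e_ i) f (partial i f x).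
Proof. by move=> [_ h] Ax; apply: derivableP; exact: (h i).1. Qed.

Lemma Ck_leS k A f : Ck k.+1 A f -> Ck k A f.
Proof.
elim: k f => [f [cf _]|k IH f [cf h]]; first by split.
split=> // i; split; first exact: (h i).1.
by apply: IH; exact: (h i).2.
Qed.

Lemma Ck_sub k A B f : A `<=` B -> Ck k B f -> Ck k A f.
Proof.
move=> AB; elim: k f => [f [cf _]|k IH f [cf h]].
  by split=> // x /AB; exact: cf.
split; first by move=> x /AB; exact: cf.
move=> i; split; first by move=> x /AB; exact: (h i).1.
by apply: IH; exact: (h i).2.
Qed.

Lemma Ck_setU k A B f : Ck k A f -> Ck k B f -> Ck k (A `|` B) f.
Proof.
elim: k f => [f [cA _] [cB _]|k IH f [cA hA] [cB hB]].
  by split=> // x [/cA|/cB].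
split; first by move=> x [/cA|/cB].
move=> i; split; first by move=> x [/(hA i).1|/(hB i).1].
by apply: IH; [exact: (hA i).2|exact: (hB i).2].
Qed.

Lemma near_open_eq A f g x : open A -> {in A, f =1 g} -> A x -> \near x, f x = g x.
Proof.
move=> oA fg Ax; have : \forall y \near x, A y by apply: open_nbhs_nbhs.
by apply: filterS => y Ay; apply: fg; rewrite inE.
Qed.

Lemma continuous_near_eq f g x : {for x, continuous f} -> (\near x, f x = g x) ->
  {for x, continuous g}.
Proof.
move=> cf H; have gx : f x = g x by exact: nbhs_singleton H.
move=> P; rewrite -gx => /cf fP.
change (nbhs x (g @^-1` P)).
by near=> y; rewrite /= -(near H y)//; near: y.
Unshelve. all: by end_near. Qed.

(** [Ck] is phrased with [partial i f], whereas a computed derivative [df i] agrees with it only on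
    [A]; since [A] is open, agreement on [A] passes to all further derivatives. Most closure rules
    below go through this criterion. *)
Lemma Ck_succ k A f (df : 'I_n -> E -> R) : open A ->
  (forall x, A x -> {for x, continuous f}) ->
  (forall i x, A x -> is_derive x (e_ i) f (df i x)) ->
  (forall i, Ck k A (df i)) -> Ck k.+1 A f.
Proof.
move=> oA cf hf hdf; split=> // i; split; first by move=> x Ax; case: (hf i x Ax).
have {}hf x : A x -> df i x = partial i f x by move=> Ax; case: (hf i x Ax).
have : Ck k A (df i) by exact: hdf.
have {hdf} : {in A, df i =1 partial i f} by move=> x; rewrite inE => /hf.
move: (partial i f) (df i) => {hf}g {df}h.
elim: k g h => [|k IH] g h hg.
  move=> [ch _]; split => // x Ax.
  exact: continuous_near_eq (ch x Ax) (near_open_eq oA hg Ax).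
move=> [ch dh]; have H x : A x -> \near x, h x = g x by exact: near_open_eq.
split; first by move=> x Ax; exact: continuous_near_eq (ch x Ax) (H x Ax).
have D j x : A x -> is_derive x (e_ j) g (partial j h x).
  move=> Ax; apply: (near_eq_is_derive (H x Ax)).
  by apply: derivableP; exact: (dh j).1.
move=> j; split; first by move=> x Ax; case: (D j x Ax).
apply: (IH _ (partial j h)); last exact: (dh j).2.
by move=> x; rewrite inE => Ax; case: (D j x Ax) => _ <-.
Qed.

Lemma Ck_eq k A f g : open A -> {in A, f =1 g} -> Ck k A f -> Ck k A g.
Proof.
move=> oA fg hf; have H x : A x -> \near x, f x = g x by exact: near_open_eq.
have cg x : A x -> {for x, continuous g}.
  by move=> Ax; exact: continuous_near_eq (Ck_cont hf Ax) (H x Ax).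
case: k hf => [_|k hf]; first by split.
apply: (Ck_succ (df := fun i => partial i f)) => // i.
  by move=> x Ax; apply: near_eq_is_derive (H x Ax) _; exact: Ck_is_derive hf Ax.
exact: Ck_partial.
Qed.

Lemma Ck_cst k A (c : R) : open A -> Ck k A (cst c).
Proof.
move=> oA; have cc x : A x -> {for x, continuous (cst c : E -> R)}.
  by move=> _; exact: cst_continuous.
elim: k c cc => [|k IH] c cc; first by split.
apply: (Ck_succ (df := fun _ => cst 0)) => // i.
by apply: IH => x _; exact: cst_continuous.
Qed.

Lemma Ck_coord k A (i : 'I_n) : open A -> Ck k A (fun x : E => x ord0 i).
Proof.
move=> oA; have cc x : A x -> {for x, continuous (fun x : E => x ord0 i)}.
  by move=> _; exact: coord_continuous.
case: k => [|k]; first by split.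
apply: (Ck_succ (df := fun j => cst ((e_ j) ord0 i))) => // [j x Ax|j].
  rewrite -[x]add0r -(scale0r (e_ j)); apply/is_derive_line.
  rewrite (_ : (fun s => _) = (fun s : R => s * (e_ j) ord0 i + x ord0 i)); last first.
    by apply/funext => s; rewrite !mxE.
  by apply: is_derive_eq; rewrite scaler0 add0r addr0 [LHS]mulr1.
exact: Ck_cst.
Qed.

Lemma Ck_add k A f g : open A -> Ck k A f -> Ck k A g -> Ck k A (f + g).
Proof.
move=> oA; elim: k f g => [|k IH] f g hf hg.
  by split => // x Ax; exact: (continuousD (Ck_cont hf Ax) (Ck_cont hg Ax)).
apply: (Ck_succ (df := fun i => partial i f + partial i g)) => //.
- by move=> x Ax; exact: (continuousD (Ck_cont hf Ax) (Ck_cont hg Ax)).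
- by move=> i x Ax; apply: is_deriveD; [exact: Ck_is_derive hf Ax|exact: Ck_is_derive hg Ax].
- by move=> i; apply: IH; exact: Ck_partial.
Qed.

Lemma Ck_mul k A f g : open A -> Ck k A f -> Ck k A g -> Ck k A (f * g).
Proof.
move=> oA; elim: k f g => [|k IH] f g hf hg.
  by split => // x Ax; exact: (continuousM (Ck_cont hf Ax) (Ck_cont hg Ax)).
apply: (Ck_succ (df := fun i => f * partial i g + g * partial i f)) => //.
- by move=> x Ax; exact: (continuousM (Ck_cont hf Ax) (Ck_cont hg Ax)).
- by move=> i x Ax; apply: is_deriveM; [exact: Ck_is_derive hf Ax|exact: Ck_is_derive hg Ax].
- move=> i; apply: Ck_add => //; apply: IH; do ?[exact: Ck_partial|exact: Ck_leS].
Qed.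

Lemma Ck_opp k A f : open A -> Ck k A f -> Ck k A (- f).
Proof.
move=> oA hf; apply: (@Ck_eq _ _ (cst (-1) * f)) => //.
  by move=> x _; rewrite /GRing.mul/= mulN1r.
by apply: Ck_mul => //; exact: Ck_cst.
Qed.

Lemma Ck_sum k A (I : Type) (r : seq I) (F : I -> E -> R) : open A ->
  (forall i, Ck k A (F i)) -> Ck k A (fun x => \sum_(i <- r) F i x).
Proof.
move=> oA hF; elim: r => [|i r IH].
  by apply: (Ck_eq oA _ (Ck_cst k 0 oA)) => x _; rewrite big_nil.
by apply: (Ck_eq oA _ (Ck_add oA (hF i) IH)) => x _; rewrite big_cons.
Qed.

(** The derivative is an existential witness, so that the explicit formulas for [flat_exp] and
    [pos_pow] can be supplied directly. *)
Fixpoint Ck1 (k : nat) (h : R -> R) : Prop :=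
  continuous h /\
  if k is k'.+1 then exists2 dh : R -> R,
    forall t, is_derive t (1 : R) h (dh t) & Ck1 k' dh
  else True.

Lemma Ck_comp k A (h : R -> R) f : open A -> Ck1 k h -> Ck k A f -> Ck k A (h \o f).
Proof.
move=> oA; elim: k h f => [|k IH] h f hh hf.
  split => // x Ax; apply: continuous_comp; first exact: Ck_cont hf Ax.
  by case: hh => ch _; exact: ch.
have [ch [dh hdh kdh]] := hh.
apply: (Ck_succ (df := fun i => (dh \o f) * partial i f)) => //.
- move=> x Ax; apply: continuous_comp; first exact: Ck_cont hf Ax.
  exact: ch.
- by move=> i x Ax; exact: (is_derive_comp (hdh _) (Ck_is_derive i hf Ax)).
- move=> i; apply: Ck_mul => //; last exact: Ck_partial.
  by apply: IH => //; exact: Ck_leS.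
Qed.

Definition support_closure f := closure [set x | f x != 0].

Lemma support_closureNE f x : ~ support_closure f x -> \near x, f x = 0.
Proof.
move=> h; have oC : open (~` support_closure f) by apply: closed_openC; exact: closed_closure.
have : \forall y \near x, (~` support_closure f) y by apply: open_nbhs_nbhs.
apply: filterS => y hy; apply: contrapT => fy; apply: hy.
by apply: subset_closure; apply/eqP.
Qed.

(** The space is the union of the open sets [A], where both factors are regular, and the complement
    of the support of [g], where the product is 0. *)
Lemma Ck_mul_cutoff k A f g : open A -> Ck k A f -> Ck k setT g ->
  support_closure g `<=` A -> Ck k setT (f * g).
Proof.
move=> oA hf hg gA.
rewrite (_ : setT = A `|` ~` support_closure g); last first.
  apply/seteqP; split => // x _.
  by have [/gA|] := pselect (support_closure g x); [left|right].
apply: Ck_setU; first by apply: Ck_mul => //; exact: Ck_sub hg.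
have oC : open (~` support_closure g) by apply: closed_openC; exact: closed_closure.
apply: (Ck_eq oC _ (Ck_cst k 0 oC)) => x; rewrite inE => hx.
by rewrite /GRing.mul/= (nbhs_singleton (support_closureNE hx)) mulr0.
Qed.

Lemma support_closure_partial f i : support_closure (partial i f) `<=` support_closure f.
Proof.
rewrite {1}/support_closure closureE; apply: smallest_sub; first exact: closed_closure.
move=> x /= fx; apply: contrapT => /support_closureNE h; move/eqP: fx; apply.
have : is_derive x (e_ i) f 0.
  apply: (@near_eq_is_derive _ _ _ (cst 0) f).
  by near=> y; apply/esym; near: y; exact: h.
by case.
Unshelve. all: by end_near. Qed.

Lemma support_closure_mulr f g : support_closure (f * g) `<=` support_closure g.
Proof.
apply: closureS => x; rewrite /GRing.mul/=; apply: contra_neq => ->.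
by rewrite mulr0.
Qed.

(** Compactness gives a common radius for pairs with at least one point in the support; for all
    other pairs both values are 0. *)
Lemma compact_support_uniform f : continuous f -> compact (support_closure f) ->
  forall e, 0 < e -> exists2 r, 0 < r & forall x y, `|x - y| < r -> `|f x - f y| < e.
Proof.
move=> cf /compact_near_coveringP cK e e0.
have : \forall r \near 0^'+, support_closure f `<=`
    [set x | forall y, `|x - y| < r -> `|f x - f y| < e].
  apply: cK => x _.
  have /cvgrPdist_lt/(_ _ (divr_gt0 e0 (ltr0Sn _ 1)))/nbhs_ballP[r /= r0 hr] := cf x.
  exists (ball x (r / 2), [set t : R | t < r / 2]).
    split; first by apply: nbhsx_ballx; rewrite divr_gt0.
    by apply: nbhs_right_lt; rewrite divr_gt0.
  move=> [x' t] /= [xx' tr] y x'y.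
  have h1 : `|f x - f x'| < e / 2.
    by apply: hr; apply: le_ball xx'; lra.
  have h2 : `|f x - f y| < e / 2.
    apply: hr; rewrite [r]splitr; apply: ball_triangle xx' _.
    by rewrite -ball_normE/=; exact: lt_trans x'y tr.
  rewrite (_ : f x' - f y = (f x' - f x) + (f x - f y)); last by ring.
  by apply: le_lt_trans (ler_normD _ _) _; rewrite [ltRHS]splitr ltrD// distrC.
move=> /nbhs_ballP[d /= d0 hd].
have K x y : support_closure f x -> `|x - y| < d / 2 -> `|f x - f y| < e.
  move=> Kx xy; have d20 : 0 < d / 2 by rewrite divr_gt0.
  apply: (hd (d / 2) _ _ x Kx y xy) => //.
  by rewrite /ball/= sub0r normrN gtr0_norm//; lra.
exists (d / 2); first by rewrite divr_gt0.
move=> x y xy; have [Kx|Kx] := pselect (support_closure f x); first exact: K.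
have [Ky|Ky] := pselect (support_closure f y); first by rewrite distrC K// distrC.
by rewrite (nbhs_singleton (support_closureNE Kx)) (nbhs_singleton (support_closureNE Ky)) subrr normr0.
Qed.

Lemma line_norm i (t : R) : `|t *: (e_ i)| = `|t|.
Proof.
rewrite normrZ (_ : `|e_ i| = 1) ?mulr1//.
have rE x : `|x| = \big[Num.max/0]_ij `|x ij.1 ij.2| by rewrite -mx_normrE.
apply/eqP; rewrite eq_le rE; apply/andP; split.
  apply/bigmax_leP; split => // -[a b] _ /=.
  by rewrite !mxE; case: (_ && _); rewrite ?normr1 ?normr0.
by apply/bigmax_geP; right; exists (ord0, i) => //=; rewrite mxE !eqxx normr1.
Qed.

(** By the mean value theorem the difference quotient is a value of [partial i f] at a point close
    to [x], and [partial i f] is uniformly continuous. The uniformity in [x] is what later justifies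
    differentiation under the integral sign. *)
Lemma Ck1_uniform_diff f i : Ck 1 setT f -> compact (support_closure f) ->
  forall e, 0 < e -> exists2 r, 0 < r & forall (t : R) x, `|t| < r ->
    `|f (t *: e_ i + x) - f x - t * partial i f x| <= e * `|t|.
Proof.
move=> hf cK e e0.
have cpf : continuous (partial i f) by move=> x; exact: (Ck_cont (Ck_partial i hf)).
have cKp : compact (support_closure (partial i f)).
  by apply: subclosed_compact cK (@support_closure_partial f i); exact: closed_closure.
have [r r0 hr] := compact_support_uniform cpf cKp e0.
exists r => // t x tr.
pose F s := f (s *: e_ i + x).
have dF s : is_derive s (1 : R) F (partial i f (s *: e_ i + x)).
  by apply/is_derive_line; exact: (Ck_is_derive i hf).
have cF s : {for s, continuous F}.
  by apply: differentiable_continuous; apply/derivable1_diffP; case: (dF s).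
(* One endpoint is 0 and the other is [t]; ordering them as [a <= b] lets one application of the
   mean value theorem serve both signs of [t]. *)
have key a b : a <= b -> `|a| < r -> `|b| < r -> a = 0 \/ b = 0 ->
    `|F b - F a - (b - a) * partial i f x| <= e * `|b - a|.
  move=> ab ar br z.
  have [c cab ->] := @MVT_segment _ F (fun s => partial i f (s *: e_ i + x)) _ _ ab
    (fun s _ => dF s) (continuous_subspaceT cF).
  rewrite [_ * (b - a)]mulrC -mulrBr normrM mulrC ler_wpM2r//.
  apply/ltW/hr; rewrite addrK line_norm.
  move: cab; rewrite in_itv/= => /andP[ac cb].
  move: ar br; rewrite !ltr_norml => /andP[? ?] /andP[? ?].
  by case: z => z; apply/andP; split; lra.
have [t0|t0] := leP 0 t.
  have := key 0 t t0; rewrite normr0 r0 tr => /(_ isT isT (or_introl erefl)).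
  by rewrite /F scale0r add0r subr0.
have := key t 0 (ltW t0); rewrite normr0 r0 tr => /(_ isT isT (or_intror erefl)).
rewrite /F scale0r add0r sub0r.
rewrite (_ : f x - _ - _ = - (f (t *: e_ i + x) - f x - t * partial i f x)); last by ring.
by rewrite !normrN.
Qed.
End calculus_rV.

(** * Integration by parts *)

Section integral_helpers.
Context {R : realType} d (T : measurableType d) (mu : {measure set T -> \bar R}).
Implicit Types f g : T -> R.

Lemma integrable_dominated f g : measurable_fun setT f ->
  mu.-integrable setT (EFin \o g) -> (forall x, `|f x| <= g x) ->
  mu.-integrable setT (EFin \o f).
Proof.
move=> mf ig fg; apply: (le_integrable measurableT _ _ ig).
  exact/measurable_EFinP.
by move=> x _ /=; rewrite lee_fin (le_trans (fg x))// ler_norm.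
Qed.

Lemma Rintegral_dominated f g : measurable_fun setT f ->
  mu.-integrable setT (EFin \o g) -> (forall x, `|f x| <= g x) ->
  `|\int[mu]_x f x| <= \int[mu]_x g x.
Proof.
move=> mf ig fg; have if_ := integrable_dominated mf ig fg.
apply: le_trans (le_normr_Rintegral measurableT if_) _.
apply: le_Rintegral => //.
apply: (integrable_dominated _ ig) => [|x]; last by rewrite normr_id.
exact: measurableT_comp.
Qed.

Lemma integrable_mul_bounded f g (M : R) : mu.-integrable setT (EFin \o f) ->
  measurable_fun setT g -> (forall x, `|g x| <= M) ->
  mu.-integrable setT (EFin \o (fun x => f x * g x)).
Proof.
move=> if_ mg gM; have mf : measurable_fun setT f by case/integrableP : if_ => /measurable_EFinP.
have iM : mu.-integrable setT (EFin \o (fun x => `|f x| * M)).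
  rewrite (_ : _ \o _ = (fun x => M%:E * (abse \o (EFin \o f)) x)%E); last first.
    by apply/funext => x /=; rewrite -EFinM mulrC.
  by apply: integrableZl => //; exact: integrable_abse.
apply: (integrable_dominated _ iM); first exact: measurable_funM.
by move=> x; rewrite normrM ler_wpM2l.
Qed.

Lemma integrable_RD f g : mu.-integrable setT (EFin \o f) ->
  mu.-integrable setT (EFin \o g) ->
  mu.-integrable setT (EFin \o (fun x => f x + g x)).
Proof. by move=> fi gi; have := integrableD measurableT fi gi. Qed.

Lemma integrable_RB f g : mu.-integrable setT (EFin \o f) ->
  mu.-integrable setT (EFin \o g) ->
  mu.-integrable setT (EFin \o (fun x => f x - g x)).
Proof. by move=> fi gi; have := integrableB measurableT fi gi. Qed.

Lemma integrable_RZ f (k : R) : mu.-integrable setT (EFin \o f) ->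
  mu.-integrable setT (EFin \o (fun x => k * f x)).
Proof. by move=> fi; have := integrableZl measurableT k fi. Qed.

Lemma measurable_remainder f g h (t : R) : measurable_fun setT f ->
  measurable_fun setT g -> measurable_fun setT h ->
  measurable_fun setT (fun x => f x - g x - t * h x).
Proof.
move=> mf mg mh; apply: measurable_funB; first exact: measurable_funB.
by apply: measurable_funM => //; exact: measurable_cst.
Qed.

Lemma Rintegral_support (A : set T) f : (forall x, ~ A x -> f x = 0) ->
  \int[mu]_(x in A) f x = \int[mu]_x f x.
Proof.
move=> fA; rewrite Rintegral_mkcond; apply: eq_Rintegral => x _.
by rewrite patchE; case: ifPn => // /negP; rewrite inE => /fA.
Qed.

End integral_helpers.

Section integration_by_parts.
Context {R : realType} {n : nat}.
Local Notation E := 'rV[R]_n.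
Local Notation mu := (lebesgue_rV R n).
Local Notation e_ i := (delta_mx ord0 i : E).
Implicit Types (f g : E -> R).

Lemma continuous_translation f (v : E) : continuous f -> continuous (fun x : E => f (x + v)).
Proof.
move=> cf x; apply: (@continuous_comp _ _ _ (fun x : E => x + v) f); last exact: cf.
by apply: continuousD; [exact: cvg_id|exact: cst_continuous].
Qed.

Lemma continuous_cara_measurable f : continuous f ->
  measurable_fun setT (f : lebesgue_rVType R n -> R).
Proof. by move=> cf; apply: open_continuous_measurable; [exact: openT|move=> x _; exact: cf]. Qed.

Lemma cara_ball (c : E) (r : R) : measurable (ball c r : set (lebesgue_rVType R n)).
Proof. exact: (sub_cara_rV (measurable_rV_ball c r)). Qed.

Lemma lebesgue_rV_ball_fin (c : E) (r : R) : (mu (ball c r) < +oo)%E.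
Proof.
have [r0|r0] := ltP 0 r; first by rewrite lebesgue_rV_ball// ltry.
rewrite (_ : ball c r = set0) ?measure0//.
by apply/seteqP; split => // y [/lt_le_trans/(_ r0)]; rewrite ltxx.
Qed.

Lemma integrable_indic_ball (c : E) (r : R) :
  mu.-integrable setT (EFin \o (\1_(ball c r : set (lebesgue_rVType R n)))).
Proof.
have mb := cara_ball c r; apply/integrableP; split.
  by apply/measurable_EFinP; exact: measurable_indic.
under eq_integral do rewrite /= ger0_norm//.
by rewrite integral_indic// setIT; exact: lebesgue_rV_ball_fin.
Qed.

Lemma integrable_bounded_support f (M r : R) (c : E) :
  measurable_fun setT (f : lebesgue_rVType R n -> R) ->
  (forall x, `|f x| <= M) -> (forall x, ~ ball c r x -> f x = 0) ->
  mu.-integrable setT (EFin \o f).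
Proof.
move=> mf fM fr.
have mb : measurable (ball c r : set (lebesgue_rVType R n)).
  exact: cara_ball.
have ib : mu.-integrable setT (EFin \o (fun x => M * \1_(ball c r : set (lebesgue_rVType R n)) x)).
  rewrite (_ : _ \o _ = (fun x => M%:E * (EFin \o \1_(ball c r : set (lebesgue_rVType R n))) x)%E)//.
  by apply: integrableZl => //; exact: integrable_indic_ball.
apply: (integrable_dominated mf ib) => x.
rewrite indicE; have [xr|xr] := pselect (ball c r x).
  by rewrite mem_set// mulr1.
by rewrite memNset// fr// normr0 mulr0.
Qed.

Lemma compact_support_ball f : compact (support_closure f) ->
  exists2 r, 0 < r & forall x, ~ ball 0 r x -> f x = 0.
Proof.
move=> /compact_bounded[M [Mr hM]]; exists (`|M| + 2); first by rewrite ltr_wpDl.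
move=> x xr; apply: contrapT => fx; apply: xr.
rewrite -ball_normE/= sub0r normrN; apply: (@le_lt_trans _ _ (`|M| + 1)); last by rewrite ltrD2l ltr1n.
apply: (hM (`|M| + 1)); last by apply: subset_closure; exact/eqP.
by rewrite (le_lt_trans (ler_norm _))// ltrDl.
Qed.

Lemma continuous_compact_bounded f : continuous f -> compact (support_closure f) ->
  exists2 M, 0 < M & forall x, `|f x| <= M.
Proof.
move=> cf cK.
have /compact_bounded[M [Mr hM]] := continuous_compact (continuous_subspaceT cf) cK.
exists (`|M| + 1); first by rewrite ltr_wpDl.
move=> x; have [Kx|Kx] := pselect (support_closure f x); last first.
  by rewrite (nbhs_singleton (support_closureNE Kx)) normr0 addr_ge0.
apply: hM; last by exists x.
by rewrite (le_lt_trans (ler_norm _))// ltrDl.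
Qed.

Lemma continuous_compact_integrable_rV f : continuous f -> compact (support_closure f) ->
  mu.-integrable setT (EFin \o f).
Proof.
move=> cf cK; have [M _ hM] := continuous_compact_bounded cf cK.
have [r _ hr] := compact_support_ball cK.
exact: integrable_bounded_support (continuous_cara_measurable cf) hM hr.
Qed.

(** The integral of [f (x + t e_i) - f x] is 0 by translation invariance, and the difference is
    [t * partial i f] up to an error that is uniformly [o(t)] on a fixed cube. *)
Lemma Rintegral_partial_eq0 f i : Ck 1 setT f -> compact (support_closure f) ->
  \int[mu]_x partial i f x = 0.
Proof.
move=> hf cK.
have cf : continuous f by move=> x; exact: (Ck_cont hf).
have cpf : continuous (partial i f) by move=> x; exact: (Ck_cont (Ck_partial i hf)).
have cKp : compact (support_closure (partial i f)).
  by apply: subclosed_compact cK (@support_closure_partial _ _ f i); exact: closed_closure.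
have [r1 r10 hr1] := compact_support_ball cK.
have [r2 r20 hr2] := compact_support_ball cKp.
pose r := r1 + r2; have r0 : 0 < r by rewrite addr_gt0.
have hr x : ~ ball 0 r x -> f x = 0.
  by move=> h; apply: hr1 => h'; apply: h; apply: le_ball h'; rewrite lerDl ltW.
have if_ := continuous_compact_integrable_rV cf cK.
have ip := continuous_compact_integrable_rV cpf cKp.
apply/eqP; rewrite -normr_le0; apply/ler_addgt0Pl => e e0; rewrite addr0.
(* This is the volume of a cube that contains the supports of [f], of [partial i f] and, as
   [t <= 1], of the translate; a uniform accuracy [e / V] integrates to [e]. *)
have V0 : 0 < ((r + 1) *+ 2) ^+ n by rewrite exprn_gt0// pmulrn_lgt0// addr_gt0.
have [s s0 hs] := Ck1_uniform_diff i hf cK (divr_gt0 e0 V0).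
pose t := Num.min (s / 2) 1.
have t0 : 0 < t by rewrite lt_min ltr01 divr_gt0.
have ts : `|t| < s.
  by rewrite gtr0_norm// (@le_lt_trans _ _ (s / 2))// ?ge_min ?lexx//; lra.
have t1 : t <= 1 by rewrite ge_min lexx orbT.
pose rem x := f (x + t *: e_ i) - f x - t * partial i f x.
have mft : measurable_fun setT (fun x : lebesgue_rVType R n => f (x + t *: e_ i)).
  by apply: continuous_cara_measurable; exact: continuous_translation.
have mrem : measurable_fun setT (rem : lebesgue_rVType R n -> R).
  exact: (measurable_remainder t mft (continuous_cara_measurable cf) (continuous_cara_measurable cpf)).
have fN x : ~ ball 0 (r + 1) x -> f x = 0.
  by move=> h; apply: hr => h'; apply: h; apply: le_ball h'; rewrite lerDl.
have fNt x : ~ ball 0 (r + 1) x -> f (x + t *: e_ i) = 0.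
  move=> h; apply: hr => h'; apply: h; rewrite -ball_normE/= sub0r normrN.
  move: h'; rewrite -ball_normE/= sub0r normrN => h'.
  rewrite -(addrK (t *: e_ i) x); apply: le_lt_trans (ler_normB _ _) _.
  by apply: ltr_leD => //; rewrite line_norm gtr0_norm.
have pN x : ~ ball 0 (r + 1) x -> partial i f x = 0.
  move=> h; apply: hr2 => h'; apply: h; apply: le_ball h'.
  by rewrite -addrA addrCA lerDl addr_ge0// ltW.
have mb : measurable (ball (0 : E) (r + 1) : set (lebesgue_rVType R n)).
  exact: cara_ball.
have mubE : mu (ball (0 : E) (r + 1)) = (((r + 1) *+ 2) ^+ n)%:E.
  by apply: lebesgue_rV_ball; rewrite addr_gt0.
pose V := ((r + 1) *+ 2) ^+ n.
pose g x := e / V * t * \1_(ball (0 : E) (r + 1)) x.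
have ig : mu.-integrable setT (EFin \o g).
  apply: (@integrable_bounded_support _ (e / V * t) (r + 1) 0).
  - by apply: measurable_funM => //; exact: measurable_indic.
  - move=> x; rewrite normrM (ger0_norm (_ : 0 <= e / V * t)).
      rewrite ler_piMr//.
        by rewrite mulr_ge0 ?divr_ge0// ltW.
      by rewrite indicE; case: (_ \in _); rewrite ?normr1 ?normr0.
    by rewrite mulr_ge0 ?divr_ge0// ltW.
  - by move=> x hx; rewrite /g indicE memNset// mulr0.
have remg x : `|rem x| <= g x.
  rewrite /g indicE; have [xb|xb] := pselect (ball (0 : E) (r + 1) x).
    by rewrite mem_set// mulr1 /rem [x + _]addrC (le_trans (hs t x ts))// (gtr0_norm t0).
  by rewrite memNset// /rem (fN _ xb) (fNt _ xb) (pN _ xb) !mulr0 !subr0 normr0.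
have irem : mu.-integrable setT (EFin \o rem) := integrable_dominated mrem ig remg.
have ift : mu.-integrable setT (EFin \o (fun x => f (x + t *: e_ i))).
  have [M _ hM] := continuous_compact_bounded cf cK.
  exact: (@integrable_bounded_support _ M (r + 1) 0).
have eq1 : t * \int[mu]_x partial i f x = - \int[mu]_x rem x.
  have -> : \int[mu]_x rem x = \int[mu]_x (f (x + t *: e_ i) - f x) - \int[mu]_x (t * partial i f x).
    by rewrite -RintegralB//; [exact: integrable_RB|exact: integrable_RZ].
  rewrite RintegralB// integral_translation ?subrr ?sub0r ?opprK; last first.
    by apply: open_continuous_borel_measurable; [exact: openT|move=> x _; exact: cf].
  by rewrite RintegralZl.
have : `|\int[mu]_x rem x| <= e / V * t * V.
  apply: le_trans (Rintegral_dominated mrem ig remg) _.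
  rewrite RintegralZl//; last exact: integrable_indic_ball.
  by rewrite /Rintegral integral_indic// setIT mubE.
rewrite -[`|_|]normrN -eq1 normrM (gtr0_norm t0) mulrAC divfK ?gt_eqF//.
by rewrite [e * t]mulrC ler_pM2l.
Qed.

(** [f * g] extends by 0 to a C^1 function with compact support, whose derivative has integral 0. It
    will be applied to functions of [phi], which are regular only in [Omega]. *)
Lemma integration_by_parts (A : set E) f g i : open A -> Ck 1 A f -> Ck 1 setT g ->
  compact (support_closure g) -> support_closure g `<=` A ->
  [/\ mu.-integrable setT (EFin \o (f * partial i g)),
      mu.-integrable setT (EFin \o (partial i f * g)) &
      \int[mu]_x (f x * partial i g x) = - \int[mu]_x (partial i f x * g x)].
Proof.
move=> oA hf hg cK gA.
have hfg : Ck 1 setT (f * g) by exact: Ck_mul_cutoff hf hg gA.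
have cont0 h k : Ck 0 A h -> Ck 0 setT k -> support_closure k `<=` support_closure g ->
    continuous (h * k) /\ compact (support_closure (h * k)).
  move=> hh hk kg; split.
    move=> x; apply: (@Ck_cont _ _ 0 setT) => //.
    by apply: (Ck_mul_cutoff oA hh hk); exact: subset_trans kg gA.
  apply: subclosed_compact cK _; first exact: closed_closure.
  by apply: subset_trans kg; exact: support_closure_mulr.
have [c1 k1] := cont0 f (partial i g) (Ck_leS hf) (Ck_partial i hg)
  (@support_closure_partial _ _ g i).
have [c2 k2] := cont0 (partial i f) g (Ck_partial i hf) (Ck_leS hg) (@subset_refl _ _).
have i1 := continuous_compact_integrable_rV c1 k1.
have i2 := continuous_compact_integrable_rV c2 k2.
split => //; apply/eqP; rewrite -addr_eq0 -RintegralD//.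
have kfg : compact (support_closure (f * g)).
  by apply: subclosed_compact cK _; [exact: closed_closure|exact: support_closure_mulr].
rewrite -(Rintegral_partial_eq0 i hfg kfg); apply/eqP.
apply: eq_Rintegral => x _.
(* On the support of [g] this is the product rule. Elsewhere [f] need not be differentiable, but
   every term carries a factor that vanishes. *)
have [Kx|Kx] := pselect (support_closure g x).
  have Ax := gA _ Kx.
  have := is_deriveM (Ck_is_derive i hf Ax) (Ck_is_derive i hg (I : setT x)).
  by case=> _; rewrite /partial => ->; rewrite [g x *: _]mulrC.
have z h : support_closure h `<=` support_closure g -> h x = 0.
  by move=> hK; apply: nbhs_singleton (support_closureNE _) => /hK.
rewrite (z g)// (z (partial i g)); last exact: support_closure_partial.
rewrite (z (partial i (f * g))) ?mulr0 ?addr0//.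
apply: subset_trans (@support_closure_mulr _ _ f g).
exact: support_closure_partial.
Qed.

End integration_by_parts.

(** * A smooth function flat at the origin *)

Section derive_helpers.
Context {R : realType}.

Lemma is_derive_uniform (V : normedModType R) (f : V -> R) (x v : V) (d : R) :
  (forall e, 0 < e -> exists2 r, 0 < r & forall t : R, `|t| < r ->
     `|f (t *: v + x) - f x - t * d| <= e * `|t|) -> is_derive x v f d.
Proof.
move=> h.
have c : h^-1 *: ((f \o shift x) (h *: v) - f x) @[h --> 0^'] --> d.
  apply/cvgrPdist_le => e e0; have [r r0 hr] := h _ e0.
  near=> t; have t0 : t != 0 by near: t; exact: nbhs_dnbhs_neq.
  have tr : `|t| < r by near: t; exact: dnbhs0_lt.
  have := hr t tr; rewrite -ler_pdivrMr ?normr_gt0//.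
  rewrite -normfV -normrM; apply: le_trans.
  rewrite distrC le_eqVlt; apply/orP; left; apply/eqP; congr `|_|.
  by rewrite mulrBl mulrAC mulfV// mul1r [_ * t^-1]mulrC.
by split; [apply/cvg_ex; exists d|rewrite /derive; exact: cvg_lim].
Unshelve. all: by end_near. Qed.

Lemma is_derive_quadratic (f : R -> R) (C : R) : (forall t, `|f t| <= C * t ^+ 2) ->
  is_derive (0 : R) (1 : R) f 0.
Proof.
move=> h; have f0 : f 0 = 0.
  by apply/eqP; rewrite -normr_le0 (le_trans (h 0))// expr0n/= mulr0.
apply: is_derive_uniform => e e0; exists (e / (`|C| + 1)).
  by rewrite divr_gt0// ltr_wpDl.
move=> t te; rewrite [t *: 1]mulr1 addr0 mulr0 subr0 f0 subr0.
rewrite (le_trans (h t))// -(real_normK (num_real t)) expr2.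
rewrite mulrA ler_wpM2r//.
apply: (@le_trans _ _ ((`|C| + 1) * `|t|)).
  by rewrite ler_wpM2r// (le_trans (ler_norm _))// lerDl.
by rewrite mulrC -ler_pdivlMr ?ltW// ltr_wpDl.
Qed.

Lemma pow_le_expR (s : R) (i : nat) : 0 <= s -> s ^+ i <= i`!%:R * expR s.
Proof.
move=> s0; case: i => [|i].
  by rewrite expr0 fact0 mul1r (le_trans _ (expR_ge1Dx s))// lerDl.
have f0 : (0 : R) < (i.+1)`!%:R by rewrite ltr0n fact_gt0.
rewrite mulrC -ler_pdivrMr//; apply: le_trans (expR_ge1Dxn i s0).
by rewrite lerDr.
Qed.

Lemma horner_le_expR (p : {poly R}) :
  exists2 C, 0 <= C & forall s, 0 <= s -> `|p.[s]| <= C * expR s.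
Proof.
exists (\sum_(i < size p) `|p`_i| * i`!%:R); first by apply: sumr_ge0 => i _; rewrite mulr_ge0.
move=> s s0; rewrite horner_coef; apply: le_trans (ler_norm_sum _ _ _) _.
rewrite mulr_suml; apply: ler_sum => i _; rewrite normrM -mulrA ler_wpM2l//.
by rewrite ger0_norm ?exprn_ge0// pow_le_expR.
Qed.

(* The class [{p(1/t) exp(-1/t)}], extended by 0 to [t <= 0], is stable under
   differentiation. *)
Definition flat_exp (p : {poly R}) (t : R) : R :=
  if 0 < t then p.[t^-1] * expR (- t^-1) else 0.

(** Comparing [X^2 p], and not just [p], with the exponential leaves the factor [t^2], which is what
    differentiability at 0 asks for. *)
Lemma flat_exp_quadratic p : exists2 C, 0 <= C & forall t, `|flat_exp p t| <= C * t ^+ 2.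
Proof.
have [C C0 hC] := horner_le_expR ('X^2 * p); exists C => // t.
rewrite /flat_exp; case: ifPn => [t0|_]; last by rewrite normr0 mulr_ge0// sqr_ge0.
have := hC t^-1; rewrite invr_ge0 ltW// => /(_ isT) H.
move: H; rewrite hornerM hornerXn [in X in X -> _]normrM.
have s0 : 0 <= t^-1 ^+ 2 by rewrite exprn_ge0// invr_ge0 ltW.
rewrite (ger0_norm s0) => H.
rewrite normrM (ger0_norm (expR_ge0 _)) expRN ler_pdivrMr ?expR_gt0//.
by move: H; rewrite exprVn mulrC ler_pdivrMr ?exprn_gt0// mulrAC.
Qed.

(** With [s = 1/t] one has [d/dt = - s^2 d/ds], and the [s]-derivative of [p(s) exp(-s)] is
    [(p' - p)(s) exp(-s)]; hence the polynomial [X^2 (p - p')]. At 0 the quadratic bound gives the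
    derivative 0. *)
Lemma is_derive_flat_exp p t :
  is_derive t (1 : R) (flat_exp p) (flat_exp ('X^2 * (p - p^`())) t).
Proof.
have [t0|t0|->] := ltgtP t 0.
- rewrite /flat_exp lt_gtF//.
  apply: (@near_eq_is_derive _ _ _ (cst 0)).
  near=> s; rewrite lt_gtF//; near: s; exact: lt_nbhsl.
- rewrite {2}/flat_exp t0; apply: (@near_eq_is_derive _ _ _
    (((fun y => p.[y]) \o (fun s => s^-1)) * (expR \o (fun s => - s^-1)))).
    near=> s; rewrite /flat_exp ifT//; near: s; exact: lt_nbhsr.
  have dV : is_derive t (1 : R) (fun s : R => s^-1) (- t ^- 2).
    by have := @is_deriveV _ id t 1 1 (lt0r_neq0 t0) (is_derive_id _ _); rewrite [_ *: 1]mulr1.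
  have d1 := is_derive1_comp (is_derive_poly p t^-1) dV.
  have d2 := @is_derive1_comp _ expR (fun s => - s^-1) t _ _ (is_derive_expR _) (is_deriveN dV).
  apply: (is_derive_eq (is_deriveM d1 d2)).
  rewrite hornerM hornerXn hornerD hornerN /GRing.scale/= -[t ^- 2]exprVn.
  by move: (t^-1) => s; ring.
- rewrite [X in is_derive _ _ _ X](_ : _ = 0); last by rewrite /flat_exp ltxx.
  by have [C _ hC] := flat_exp_quadratic p; exact: is_derive_quadratic hC.
Unshelve. all: by end_near. Qed.

Lemma continuous_is_derive (f df : R -> R) :
  (forall t, is_derive t (1 : R) f (df t)) -> continuous f.
Proof.
move=> h t; apply: differentiable_continuous; apply/derivable1_diffP.
by case: (h t).
Qed.

Lemma Ck1_flat_exp k p : Ck1 k (flat_exp p).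
Proof.
elim: k p => [|k IH] p.
  by split => //; exact: continuous_is_derive (is_derive_flat_exp p).
split; first exact: continuous_is_derive (is_derive_flat_exp p).
by exists (flat_exp ('X^2 * (p - p^`()))); [exact: is_derive_flat_exp|exact: IH].
Qed.

(** The [eta] of the overview, equal to [exp(-1/t)] for [t > 0]; it is also the profile of the
    mollifier [ker]. *)
Definition bump : R -> R := flat_exp 1.
Definition dbump : R -> R := flat_exp 'X^2.

Lemma is_derive_bump t : is_derive t (1 : R) bump (dbump t).
Proof. by have := is_derive_flat_exp 1 t; rewrite derivC subr0 mulr1. Qed.

Lemma bump_ge0 t : 0 <= bump t.
Proof. by rewrite /bump /flat_exp; case: ifP => // _; rewrite hornerC mul1r expR_ge0. Qed.

Lemma bump_gt0 t : 0 < t -> 0 < bump t.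
Proof. by move=> t0; rewrite /bump /flat_exp t0 hornerC mul1r expR_gt0. Qed.

Lemma bump_eq0 t : t <= 0 -> bump t = 0.
Proof. by move=> t0; rewrite /bump /flat_exp ltNge t0. Qed.

Lemma bump_le a b : 0 < a -> a <= b -> bump a <= bump b.
Proof.
move=> a0 ab; have b0 := lt_le_trans a0 ab.
rewrite /bump /flat_exp a0 b0 !hornerC !mul1r ler_expR lerN2.
by rewrite lef_pV2.
Qed.

Lemma dbump_ge0 t : 0 <= dbump t.
Proof.
rewrite /dbump /flat_exp; case: ifP => // t0.
by rewrite hornerXn mulr_ge0 ?expR_ge0// exprn_ge0// invr_ge0 ltW.
Qed.

Lemma dbump_eq0 t : t <= 0 -> dbump t = 0.
Proof. by move=> t0; rewrite /dbump /flat_exp ltNge t0. Qed.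

Lemma dbump_bounded : exists2 C, 0 <= C & forall t, dbump t <= C.
Proof.
have [C C0 hC] := horner_le_expR 'X^2; exists C => // t.
rewrite /dbump /flat_exp; case: ifPn => // t0.
have := hC t^-1; rewrite invr_ge0 ltW// => /(_ isT) /(le_trans (ler_norm _)) h.
by rewrite expRN ler_pdivrMr// expR_gt0.
Qed.
End derive_helpers.

(** * Mollification *)

Section mollifier.
Context {R : realType} {n : nat}.
Local Notation E := 'rV[R]_n.
Local Notation mu := (lebesgue_rV R n).
Local Notation e_ i := (delta_mx ord0 i : E).
Implicit Types (f g w : E -> R) (x y : E).

Lemma closed_norm_le (c : E) (r : R) : closed [set x : E | `|x - c| <= r].
Proof.
rewrite (_ : mkset _ = (fun x : E => `|x - c|) @^-1` [set t | t <= r])//.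
apply: preimage_closed => [x _|]; last exact: closed_le.
apply: (@continuous_comp _ _ _ (fun x : E => x - c) (fun x : E => `|x|)).
  by apply: continuousB; [exact: cvg_id|exact: cst_continuous].
exact: norm_continuous.
Qed.

Lemma compact_norm_le (c : E) (r : R) : compact [set x : E | `|x - c| <= r].
Proof.
apply: bounded_closed_compact; last exact: closed_norm_le.
exists (r + `|c|); split; first exact: num_real.
move=> M hM x /= xr; rewrite (le_trans _ (ltW hM))// -(subrK c x).
by rewrite (le_trans (ler_normD _ _))// lerD2r.
Qed.

Lemma support_closure_le f (c : E) (r : R) :
  (forall x, r < `|x - c| -> f x = 0) -> support_closure f `<=` [set x | `|x - c| <= r].
Proof.
move=> h; rewrite /support_closure closureE; apply: smallest_sub; first exact: closed_norm_le.
move=> x /= fx; rewrite leNgt; apply/negP => /h f0.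
by rewrite f0 eqxx in fx.
Qed.

Lemma compact_support_le f (c : E) (r : R) :
  (forall x, r < `|x - c| -> f x = 0) -> compact (support_closure f).
Proof.
move=> /support_closure_le; apply: subclosed_compact; first exact: closed_closure.
exact: compact_norm_le.
Qed.

Lemma Ck_reflect k f x : Ck k setT f -> Ck k setT (fun y => f (x - y)).
Proof.
have cc g : continuous g -> forall y, setT y -> {for y, continuous (fun y => g (x - y))}.
  move=> cg y _; apply: (@continuous_comp _ _ _ (fun y : E => x - y) g); last exact: cg.
  by apply: continuousB; [exact: cst_continuous|exact: cvg_id].
elim: k f => [|k IH] f hf.
  by split => //; apply: cc => y; exact: (Ck_cont hf).
apply: (Ck_succ (df := fun i y => - partial i f (x - y))); first exact: openT.
- by apply: cc => y; exact: (Ck_cont hf).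
- move=> i y _; rewrite -[y in is_derive y]add0r -(scale0r (e_ i)); apply/is_derive_line.
  rewrite (_ : (fun s => _) = (fun s => f (s *: e_ i + (x - y))) \o -%R); last first.
    by apply/funext => s /=; rewrite scaleNr opprD addrCA addrA.
  have d1 : is_derive (- 0 : R) (1 : R) (fun s => f (s *: e_ i + (x - y))) (partial i f (x - y)).
    apply/is_derive_line; rewrite oppr0 scale0r add0r; exact: Ck_is_derive hf _.
  apply: (is_derive_eq (is_derive1_comp d1 (is_deriveNid _ _))).
  by rewrite mulrN1.
- by move=> i; apply: Ck_opp; [exact: openT|exact/IH/Ck_partial].
Qed.

Lemma partial_reflect f x y i : Ck 1 setT f ->
  partial i (fun y => f (x - y)) y = - partial i f (x - y).
Proof.
move=> hf; suff : is_derive y (e_ i) (fun y => f (x - y)) (- partial i f (x - y)) by case.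
rewrite -[y in is_derive y]add0r -(scale0r (e_ i)); apply/is_derive_line.
rewrite (_ : (fun s => _) = (fun s => f (s *: e_ i + (x - y))) \o -%R); last first.
  by apply/funext => s /=; rewrite scaleNr opprD addrCA addrA.
have d1 : is_derive (- 0 : R) (1 : R) (fun s => f (s *: e_ i + (x - y))) (partial i f (x - y)).
  apply/is_derive_line; rewrite oppr0 scale0r add0r; exact: Ck_is_derive hf _.
apply: (is_derive_eq (is_derive1_comp d1 (is_deriveNid _ _))).
by rewrite mulrN1.
Qed.

(** The smooth factor is the second one and carries the variable [x], so regularity comes from [f]
    while [w] need only be integrable. *)
Definition conv w f x := \int[mu]_y (w y * f (x - y)).

Lemma continuous_reflect f x : continuous f -> continuous (fun y : E => f (x - y)).
Proof.
move=> cf y; apply: (@continuous_comp _ _ _ (fun y : E => x - y) f); last exact: cf.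
by apply: continuousB; [exact: cst_continuous|exact: cvg_id].
Qed.

Lemma conv_integrable w f x : mu.-integrable setT (EFin \o w) ->
  continuous f -> compact (support_closure f) ->
  mu.-integrable setT (EFin \o (fun y => w y * f (x - y))).
Proof.
move=> iw cf cK; have [M _ hM] := continuous_compact_bounded cf cK.
apply: (@integrable_mul_bounded _ _ _ mu w (fun y => f (x - y)) M iw) => [|y]; last exact: hM.
exact: (continuous_cara_measurable (@continuous_reflect f x cf)).
Qed.

Lemma conv_bound w (h : E -> R) (e : R) : 0 <= e -> mu.-integrable setT (EFin \o w) ->
  measurable_fun setT (h : lebesgue_rVType R n -> R) -> (forall y, `|h y| <= e) ->
  `|\int[mu]_y (w y * h y)| <= e * \int[mu]_y `|w y|.
Proof.
move=> e0 iw mh he; have iaw : mu.-integrable setT (EFin \o (fun y => `|w y|)).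
  by have := integrable_abse iw.
have mw : measurable_fun setT (w : lebesgue_rVType R n -> R).
  by case/integrableP : iw => /measurable_EFinP.
rewrite -RintegralZl//; apply: Rintegral_dominated; first exact: measurable_funM.
  exact: integrable_RZ.
by move=> y; rewrite normrM mulrC ler_wpM2r.
Qed.

Lemma conv_continuous w f : mu.-integrable setT (EFin \o w) ->
  continuous f -> compact (support_closure f) -> continuous (conv w f).
Proof.
move=> iw cf cK x; apply/(@cvgrPdist_lt _ _ _ (nbhs x)) => e e0.
pose I := \int[mu]_y `|w y|.
have I0 : 0 <= I by apply: Rintegral_ge0.
(* Dividing by [I + 1] and not by [I] allows [w] to vanish; the same device recurs below. *)
have e1 : 0 < e / (I + 1) by rewrite divr_gt0// ltr_wpDl.
have [r r0 hr] := compact_support_uniform cf cK e1.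
near=> x'; have xx' : `|x - x'| < r.
  by near: x'; apply/nbhs_ballP; exists r => //= z; rewrite -ball_normE.
rewrite /conv -RintegralB//; try exact: conv_integrable.
rewrite (_ : (fun y => _) = (fun y => w y * (f (x - y) - f (x' - y)))); last first.
  by apply/funext => y; rewrite mulrBr.
apply: (@le_lt_trans _ _ (e / (I + 1) * I)).
  apply: (conv_bound (ltW e1) iw).
    apply: measurable_funB; exact: (continuous_cara_measurable (continuous_reflect cf)).
  by move=> y; apply/ltW/hr; rewrite opprB addrA subrK.
by rewrite -mulrA gtr_pMr// mulrC ltr_pdivrMr ?mul1r ?ltrDl// ltr_wpDl.
Unshelve. all: by end_near. Qed.

(** The remainder of the difference quotient of [f] is uniformly small, so integrating it against
    [w] costs only the L^1 norm of [w]. *)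
Lemma conv_is_derive w f i x : mu.-integrable setT (EFin \o w) ->
  Ck 1 setT f -> compact (support_closure f) ->
  is_derive x (e_ i) (conv w f) (conv w (partial i f) x).
Proof.
move=> iw hf cK.
have cf : continuous f by move=> y; exact: (Ck_cont hf).
have cpf : continuous (partial i f) by move=> y; exact: (Ck_cont (Ck_partial i hf)).
have cKp : compact (support_closure (partial i f)).
  by apply: subclosed_compact cK (@support_closure_partial _ _ f i); exact: closed_closure.
pose I := \int[mu]_y `|w y|.
have I0 : 0 <= I by apply: Rintegral_ge0.
apply: is_derive_uniform => e e0.
have e1 : 0 < e / (I + 1) by rewrite divr_gt0// ltr_wpDl.
have [r r0 hr] := Ck1_uniform_diff i hf cK e1; exists r => // t tr.
have i1 z := @conv_integrable w f z iw cf cK.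
have i2 z := @conv_integrable w (partial i f) z iw cpf cKp.
rewrite /conv -RintegralB// -RintegralZl// -RintegralB//; last 2 first.
- exact: integrable_RB.
- exact: integrable_RZ.
rewrite (_ : (fun y => _) = (fun y => w y *
    (f (t *: e_ i + x - y) - f (x - y) - t * partial i f (x - y)))); last first.
  by apply/funext => y; ring.
apply: (@le_trans _ _ (e / (I + 1) * `|t| * I)).
  have et0 : 0 <= e / (I + 1) * `|t| by rewrite mulr_ge0// ltW.
  apply: (conv_bound et0 iw).
    exact: (measurable_remainder t (continuous_cara_measurable (continuous_reflect cf))
      (continuous_cara_measurable (continuous_reflect cf))
      (continuous_cara_measurable (continuous_reflect cpf))).
  by move=> y; have := hr t (x - y) tr; rewrite addrA.
rewrite mulrAC ler_wpM2r//.
by rewrite mulrAC ler_pdivrMr ?ltr_wpDl// ler_pM2l// lerDl.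
Qed.

Lemma conv_Ck k w f : mu.-integrable setT (EFin \o w) ->
  Ck k setT f -> compact (support_closure f) -> Ck k setT (conv w f).
Proof.
move=> iw; elim: k f => [|k IH] f hf cK.
  split => // x _; apply: conv_continuous => // y; exact: (Ck_cont hf).
have hf1 : Ck 1 setT f by case: hf => cf hf; split => // i; split => //; first exact: (hf i).1;
  split => // y _; exact: (Ck_cont (hf i).2).
apply: (Ck_succ (df := fun i => conv w (partial i f))); first exact: openT.
- move=> x _; apply: conv_continuous => // y; exact: (Ck_cont hf).
- by move=> i x _; exact: conv_is_derive.
- move=> i; apply: IH; first exact: Ck_partial.
  by apply: subclosed_compact cK (@support_closure_partial _ _ f i); exact: closed_closure.
Qed.

(** [dotmul x x] is a polynomial, hence smooth, unlike the sup norm. The Euclidean ball of radius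
    [e] lies in the cube of the same radius, which gives the support. *)
Definition ker (e : R) (x : E) : R := bump (e ^+ 2 - dotmul x x).

Lemma Ck_ker k e : Ck k setT (ker e).
Proof.
apply: (@Ck_comp _ _ k setT bump (cst (e ^+ 2) + - (fun x => dotmul x x))).
- exact: openT.
- exact: Ck1_flat_exp.
- apply: Ck_add; [exact: openT|apply: Ck_cst; exact: openT|].
  apply: Ck_opp; first exact: openT.
  apply: (@Ck_sum _ _ _ _ _ _ (fun i x => x ord0 i * x ord0 i)); first exact: openT.
  by move=> i; apply: Ck_mul; [exact: openT|apply: Ck_coord; exact: openT|apply: Ck_coord; exact: openT].
Qed.

Lemma dotmul_ge0 x : 0 <= dotmul x x.
Proof. by apply: sumr_ge0 => i _; rewrite -expr2 sqr_ge0. Qed.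

Lemma coord_dotmul x i : x ord0 i ^+ 2 <= dotmul x x.
Proof.
rewrite /dotmul (bigD1 i)//= -expr2 lerDl; apply: sumr_ge0 => j _.
by rewrite -expr2 sqr_ge0.
Qed.

Lemma ker_support (e : R) x : 0 < e -> ~ ball 0 e x -> ker e x = 0.
Proof.
move=> e0 h; apply: bump_eq0; rewrite leNgt; apply/negP => hx; apply: h.
apply/(rV_ballE _ _ e0) => i; rewrite mxE sub0r normrN.
rewrite -(ltr_pXn2r (n := 2))// ?nnegrE// ?ltW//.
rewrite real_normK ?num_real//; apply: le_lt_trans (coord_dotmul x i) _.
by rewrite -subr_gt0.
Qed.

Lemma ker_ge0 e x : 0 <= ker e x. Proof. exact: bump_ge0. Qed.

Lemma dotmulNN x : dotmul (- x) (- x) = dotmul x x.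
Proof. by apply: eq_bigr => i _; rewrite !mxE mulrNN. Qed.

Lemma kerN e x : ker e (- x) = ker e x.
Proof. by rewrite /ker dotmulNN. Qed.

Lemma continuous_ker e : continuous (ker e).
Proof. by move=> x; exact: (Ck_cont (Ck_ker 0 e)). Qed.

Lemma ker_norm_support (e : R) x : 0 < e -> e < `|x - 0| -> ker e x = 0.
Proof.
move=> e0 ex; apply: ker_support => //; rewrite -ball_normE/= distrC.
by move/(lt_trans ex); rewrite ltxx.
Qed.

Lemma compact_ker (e : R) : 0 < e -> compact (support_closure (ker e)).
Proof. by move=> e0; apply: compact_support_le => x; exact: ker_norm_support. Qed.

Lemma integrable_ker (e : R) : 0 < e -> mu.-integrable setT (EFin \o ker e).
Proof.
move=> e0; apply: continuous_compact_integrable_rV; first exact: continuous_ker.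
exact: compact_ker.
Qed.

Lemma Rintegral_ge_ball f (c : E) (r m : R) : 0 < r -> 0 <= m ->
  mu.-integrable setT (EFin \o f) -> (forall x, 0 <= f x) ->
  (forall x, ball c r x -> m <= f x) -> m * (r *+ 2) ^+ n <= \int[mu]_x f x.
Proof.
move=> r0 m0 if_ f0 fm.
have -> : m * (r *+ 2) ^+ n = \int[mu]_x (m * \1_(ball c r) x).
  rewrite RintegralZl//; last exact: integrable_indic_ball.
  rewrite /Rintegral integral_indic//; last exact: cara_ball.
  by rewrite setIT lebesgue_rV_ball.
apply: le_Rintegral => //; first exact/integrable_RZ/integrable_indic_ball.
move=> x _; rewrite indicE; have [xb|xb] := pselect (ball c r x).
  by rewrite mem_set// mulr1 fm.
by rewrite memNset// mulr0.
Qed.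

Lemma ker_int_gt0 (e : R) : 0 < e -> 0 < \int[mu]_x ker e x.
Proof.
move=> e0; have k0 : 0 < ker e 0.
  apply: bump_gt0; rewrite /dotmul big1 ?subr0 ?exprn_gt0// => i _.
  by rewrite mxE mulr0.
have /cvgrPdist_lt/(_ _ (divr_gt0 k0 (ltr0Sn _ 1)))/nbhs_ballP[r /= r0 hr] := @continuous_ker e 0.
apply: (@lt_le_trans _ _ (ker e 0 / 2 * (r *+ 2) ^+ n)).
  by rewrite mulr_gt0 ?divr_gt0// exprn_gt0// pmulrn_lgt0.
apply: (@Rintegral_ge_ball _ 0) => //; first by rewrite divr_ge0// ltW.
- exact: integrable_ker.
- exact: ker_ge0.
- move=> x /hr; rewrite ltr_norml => /andP[_]; lra.
Qed.

Definition moll (e : R) x := (\int[mu]_y ker e y)^-1 * ker e x.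

Lemma Ck_moll k e : Ck k setT (moll e).
Proof.
apply: (@Ck_mul _ _ _ _ (cst _) (ker e)); [exact: openT|apply: Ck_cst; exact: openT|].
exact: Ck_ker.
Qed.

Lemma continuous_moll e : continuous (moll e).
Proof. by move=> x; exact: (Ck_cont (Ck_moll 0 e)). Qed.

Lemma moll_ge0 (e : R) x : 0 < e -> 0 <= moll e x.
Proof. by move=> e0; rewrite mulr_ge0 ?ker_ge0// invr_ge0 ltW// ker_int_gt0. Qed.

Lemma mollN e x : moll e (- x) = moll e x.
Proof. by rewrite /moll kerN. Qed.

Lemma moll_support (e : R) x : 0 < e -> ~ ball 0 e x -> moll e x = 0.
Proof. by move=> e0 h; rewrite /moll ker_support ?mulr0. Qed.

Lemma moll_norm_support (e : R) x : 0 < e -> e < `|x - 0| -> moll e x = 0.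
Proof. by move=> e0 h; rewrite /moll ker_norm_support ?mulr0. Qed.

Lemma compact_moll (e : R) : 0 < e -> compact (support_closure (moll e)).
Proof. by move=> e0; apply: compact_support_le => x; exact: moll_norm_support. Qed.

(** The mollifier is even, which turns the reflection [x - y] into a translation. *)
Lemma Rintegral_moll (e : R) x : 0 < e -> \int[mu]_y moll e (x - y) = 1.
Proof.
move=> e0; rewrite (_ : (fun y => _) = (fun y => moll e (y + - x))); last first.
  by apply/funext => y; rewrite -mollN opprB.
rewrite integral_translation; last first.
  apply: open_continuous_borel_measurable => [|y _]; [exact: openT|exact: continuous_moll].
rewrite RintegralZl//; last exact: integrable_ker.
by rewrite mulVf// gt_eqF// ker_int_gt0.
Qed.

Lemma integrable_moll_reflect (e : R) x : 0 < e ->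
  mu.-integrable setT (EFin \o (fun y => moll e (x - y))).
Proof.
move=> e0; apply: continuous_compact_integrable_rV.
  exact/continuous_reflect/continuous_moll.
apply: (@compact_support_le _ x e) => y h; apply: moll_norm_support => //.
by rewrite subr0 distrC.
Qed.

Lemma integral_moll (e : R) x : 0 < e -> (\int[mu]_y (moll e (x - y))%:E = 1)%E.
Proof.
move=> e0; rewrite -(Rintegral_moll x e0) /Rintegral fineK//.
exact: (integrable_fin_num measurableT (integrable_moll_reflect x e0)).
Qed.
End mollifier.

(** * Density of continuous functions in L^p *)

Section L1_closure.
Context {R : realType} d (T : measurableType d) (mu : {measure set T -> \bar R}).
Variables (B : set T) (C : set (T -> R)).
Implicit Types (f g c : T -> R).

(** Extended-valued, so that no integrability has to be carried through the approximation
    argument. *)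
Definition L1dist f g : \bar R := (\int[mu]_(x in B) `|f x - g x|%:E)%E.

(** [C] is an abstract vector space of functions containing the constants, and [B] a set of finite
    measure. Below they become the continuous functions and a cube. *)
Definition L1approx f := measurable_fun setT f /\ forall e : R, 0 < e ->
  exists c, C c /\ (L1dist f c < e%:E)%E.

Hypotheses (mB : measurable B) (muB : (mu B < +oo)%E).
Hypothesis C_measurable : forall c, C c -> measurable_fun setT c.
Hypothesis C_add : forall c c', C c -> C c' -> C (fun x => c x + c' x).
Hypothesis C_scale : forall k c, C c -> C (fun x => k * c x).
Hypothesis C_cst : forall k, C (fun=> k).

Lemma measurable_absB f g : measurable_fun setT f -> measurable_fun setT g ->
  measurable_fun B (fun x => `|f x - g x|%:E).
Proof.
move=> mf mg; apply/measurable_EFinP; apply: measurable_funTS.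
by apply: measurableT_comp => //; exact: measurable_funB.
Qed.

Lemma L1dist_le f1 g1 f2 g2 f3 g3 : measurable_fun setT f1 -> measurable_fun setT g1 ->
  measurable_fun setT f2 -> measurable_fun setT g2 ->
  measurable_fun setT f3 -> measurable_fun setT g3 ->
  (forall x, `|f1 x - g1 x| <= `|f2 x - g2 x| + `|f3 x - g3 x|) ->
  (L1dist f1 g1 <= L1dist f2 g2 + L1dist f3 g3)%E.
Proof.
move=> mf1 mg1 mf2 mg2 mf3 mg3 h.
have m1 := measurable_absB mf1 mg1; have m2 := measurable_absB mf2 mg2.
have m3 := measurable_absB mf3 mg3.
have p0 f g x : B x -> (0 <= `|f x - g x|%:E)%E by rewrite lee_fin.
have e : (L1dist f2 g2 + L1dist f3 g3 =
    \int[mu]_(x in B) (`|f2 x - g2 x|%:E + `|f3 x - g3 x|%:E))%E.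
  exact: (esym (ge0_integralD mu mB (p0 f2 g2) m2 (p0 f3 g3) m3)).
rewrite e; apply: (ge0_le_integral mu mB (p0 f1 g1) m1 (emeasurable_funD m2 m3)).
by move=> x _; rewrite -EFinD lee_fin; exact: h.
Qed.

Lemma L1dist_triangle f g h : measurable_fun setT f -> measurable_fun setT g ->
  measurable_fun setT h -> (L1dist f h <= L1dist f g + L1dist g h)%E.
Proof. by move=> mf mg mh; apply: L1dist_le => // x; exact: ler_distD. Qed.

Lemma L1approx_lim f : measurable_fun setT f ->
  (forall e : R, 0 < e -> exists g, L1approx g /\ (L1dist f g < e%:E)%E) -> L1approx f.
Proof.
move=> mf h; split => // e e0.
have [g [[mg hg] fg]] := h _ (divr_gt0 e0 (ltr0Sn _ 1)).
have [c [cc gc]] := hg _ (divr_gt0 e0 (ltr0Sn _ 1)).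
exists c; split => //.
apply: le_lt_trans (L1dist_triangle mf mg (C_measurable cc)) _.
by rewrite [e]splitr EFinD lteD.
Qed.

Lemma L1approx_mem c : C c -> L1approx c.
Proof.
move=> cc; split; first exact: C_measurable.
move=> e e0; exists c; split => //; rewrite /L1dist.
under eq_integral do rewrite subrr normr0.
by rewrite integral0.
Qed.

Lemma integrable_cst_fin (M : R) : mu.-integrable B (fun=> M%:E).
Proof.
apply/integrableP; split; first exact: measurable_cst.
rewrite integral_cst//= lte_mul_pinfty//; exact: muB.
Qed.

Lemma cvge0_lt (u : nat -> \bar R) (e : R) : 0 < e -> u k @[k --> \oo] --> 0%E ->
  exists k, (u k < e%:E)%E.
Proof.
move=> e0 cu; have : nbhs 0%E [set x : \bar R | (x < e%:E)%E].
  by apply: open_nbhs_nbhs; split; [exact: open_ereal_lt_ereal|rewrite /= lte_fin].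
by move=> /cu[k _ /(_ k (leqnn _)) ?]; exists k.
Qed.

Lemma L1approx_cvg (f_ : nat -> T -> R) f (M : R) : measurable_fun setT f ->
  (forall k, L1approx (f_ k)) -> (forall k x, `|f_ k x| <= M) ->
  (forall x, f_ k x @[k --> \oo] --> f x) -> L1approx f.
Proof.
move=> mf hf fM ff; apply: L1approx_lim => // e e0.
have ffE x : (f_ k x)%:E @[k --> \oo] --> (f x)%:E.
  by apply/fine_cvgP; split; [exact: nearW|exact: ff].
have [_ + _] := @dominated_convergence _ _ _ mu B mB (fun k x => (f_ k x)%:E)
   (fun x => (f x)%:E) (fun=> M%:E)
   (fun k => measurable_funTS (iffRL (measurable_EFinP _ _) (hf k).1))
   (measurable_funTS (iffRL (measurable_EFinP _ _) mf))
   (aeW _ (fun x _ => ffE x))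
   (integrable_cst_fin M) (aeW _ (fun x k _ => fM k x)).
move=> /(cvge0_lt e0)[k hk]; exists (f_ k); split => //.
by move: hk; rewrite /L1dist; under eq_integral do rewrite -EFinB /= distrC.
Qed.

Lemma L1approx_add f g : L1approx f -> L1approx g -> L1approx (fun x => f x + g x).
Proof.
move=> [mf hf] [mg hg]; split; first exact: measurable_funD.
move=> e e0; have e2 : 0 < e / 2 by rewrite divr_gt0.
have [c [cc fc]] := hf _ e2; have [c' [cc' gc]] := hg _ e2.
exists (fun x => c x + c' x); split; first exact: C_add.
have mc := C_measurable cc; have mc' := C_measurable cc'.
apply: (@le_lt_trans _ _ (L1dist f c + L1dist g c')%E).
  apply: L1dist_le => //; [exact: measurable_funD|exact: measurable_funD|].
  by move=> x; rewrite opprD addrACA; exact: ler_normD.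
by rewrite [e]splitr EFinD lteD.
Qed.

Lemma L1approx_scale f (k : R) : L1approx f -> L1approx (fun x => k * f x).
Proof.
move=> [mf hf]; split; first exact: measurable_funM.
move=> e e0; have e2 : 0 < e / (`|k| + 1) by rewrite divr_gt0// ltr_wpDl.
have [c [cc fc]] := hf _ e2.
exists (fun x => k * c x); split; first exact: C_scale.
rewrite /L1dist; under eq_integral do rewrite -mulrBr normrM EFinM.
rewrite ge0_integralZl_EFin//; last first.
  exact: measurable_absB mf (C_measurable cc).
apply: (@le_lt_trans _ _ (`|k|%:E * (e / (`|k| + 1))%:E)%E).
  by apply: lee_wpmul2l => //; exact: ltW.
by rewrite -EFinM lte_fin mulrCA gtr_pMr// ltr_pdivrMr ?mul1r ?ltrDl// ltr_wpDl.
Qed.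

Lemma L1approx_sum (I : Type) (s : seq I) (F : I -> T -> R) :
  (forall i, L1approx (F i)) -> L1approx (fun x => \sum_(i <- s) F i x).
Proof.
move=> h; elim: s => [|i s IH].
  by under eq_fun do rewrite big_nil; apply: L1approx_mem; exact: C_cst.
by under eq_fun do rewrite big_cons; exact: L1approx_add.
Qed.

(** The sets with approximable indicator are stable under complements, through [1 - \1_S], and under
    countable disjoint unions, as limits of partial sums bounded by 1; the pi-lambda theorem
    concludes. *)
Lemma L1approx_dynkin (G : set (set T)) : setI_closed G ->
  <<s G >> `<=` measurable -> G `<=` (fun A => L1approx \1_A) ->
  <<s G >> `<=` (fun A => L1approx \1_A).
Proof.
move=> GI Gm GA A.
apply: (@dynkin_induction _ (g_sigma_algebraType G) G (fun A => L1approx \1_A)) => //.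
- by rewrite indicT; apply: L1approx_mem; exact: C_cst.
- move=> S mS hS.
  rewrite (_ : \1_(~` S) = (fun x => 1 + (-1) * \1_S x)).
    apply: L1approx_add; last exact: L1approx_scale.
    by apply: L1approx_mem; exact: C_cst.
  apply/funext => x; rewrite !indicE in_setC; case: (_ \in _) => /=.
    by rewrite mulN1r subrr.
  by rewrite mulr0 addr0.
- move=> F mF tF hF.
  have key N m x : F m x -> \sum_(k < N) (\1_(F k) x : R) = (m < N)%N%:R.
    move=> Fx; elim: N => [|N IH]; first by rewrite big_ord0.
    rewrite big_ord_recr/= IH indicE (ltnS m N) (leq_eqVlt m N); have [mN|mN] := eqVneq m N.
      by rewrite mN ltnn add0r mem_set// -mN.
    rewrite memNset ?addr0// => FN; move/trivIsetP : tF => /(_ _ _ I I mN).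
    by move/seteqP => [+ _] => /(_ x); apply.
  have key0 N x : ~ (\bigcup_k F k) x -> \sum_(k < N) (\1_(F k) x : R) = 0.
    move=> h; apply: big1 => k _; rewrite indicE memNset// => Fx; apply: h.
    by exists k.
  apply: (@L1approx_cvg (fun N x => \sum_(k < N) \1_(F k) x) _ 1).
  + have mU : d.-measurable (\bigcup_k (F k : set T)).
      by apply: bigcupT_measurable => i; exact: (Gm _ (mF i)).
    exact: (@measurable_indic _ T R setT _ mU).
  + by move=> N; apply: L1approx_sum => i; exact: hF.
  + move=> N x; have [[m _ Fx]|h] := pselect ((\bigcup_k F k) x).
      by rewrite (key _ m)//; case: (_ < _)%N; rewrite ?normr1 ?normr0.
    by rewrite key0// normr0.
  + move=> x; rewrite indicE; have [Fx|h] := pselect ((\bigcup_k F k) x); last first.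
      by rewrite memNset//; under eq_fun do rewrite key0//; exact: cvg_cst.
    rewrite mem_set//; case: Fx => m _ Fx; apply/cvgrPdist_lt => e e0.
    by near=> N; rewrite (key _ m)// (_ : (m < N)%N) ?subrr ?normr0//; near: N; exact: nbhs_infty_gt.
Unshelve. all: by end_near. Qed.

(** The passage from Borel to Caratheodory measurable sets: on [B] the indicators of [A] and [D]
    differ only on the part of [D] outside the intersection of [A] and [B], whose measure is the
    excess of the cover. *)
Lemma L1approx_cover (A : set T) : measurable A ->
  (forall e : R, 0 < e -> exists D, [/\ measurable D, L1approx \1_D, A `&` B `<=` D &
    (mu D < mu (A `&` B) + e%:E)%E]) -> L1approx \1_A.
Proof.
move=> mA h; apply: L1approx_lim => [|e e0]; first exact: measurable_indic.
have mAB : measurable (A `&` B) by exact: measurableI.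
have fAB : mu (A `&` B) \is a fin_num.
  rewrite ge0_fin_numE//; apply: le_lt_trans muB; apply: le_measure; rewrite ?inE//.
have [D [mD aD ABD hD]] := h _ e0; exists \1_D; split => //.
have mDA : measurable (D `\` (A `&` B)) by exact: measurableD.
apply: (@le_lt_trans _ _ (mu (D `\` (A `&` B)))).
  apply: (@le_trans _ _ (\int[mu]_(x in B) (\1_(D `\` (A `&` B)) x)%:E)%E); last first.
    by rewrite integral_indic//; apply: le_measure; rewrite ?inE//; exact: measurableI.
  apply: ge0_le_integral => //.
  - by apply: measurable_absB; exact: measurable_indic.
  - by apply/measurable_EFinP; exact: measurable_indic.
  - move=> x Bx; rewrite lee_fin !indicE.
    have [Dx|Dx] := pselect (D x); last first.
      have Ax : ~ A x by move=> Ax; apply: Dx; apply: ABD.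
      by rewrite (memNset Ax) (memNset Dx) subrr normr0.
    have [Ax|Ax] := pselect (A x); first by rewrite (mem_set Ax) (mem_set Dx) subrr normr0.
    have DAx : (D `\` (A `&` B)) x by split => // -[].
    by rewrite (memNset Ax) (mem_set Dx) (mem_set DAx) sub0r normrN normr1.
rewrite measureD//; last by rewrite (lt_le_trans hD)// leey.
rewrite (_ : D `&` (A `&` B) = A `&` B); last by apply/setIidPr.
by rewrite lteBlDr// addeC.
Qed.

Import HBSimple.

Lemma L1approx_integrable f : (forall A, measurable A -> L1approx \1_A) -> measurable_fun setT f -> mu.-integrable B (EFin \o f) ->
  L1approx f.
Proof.
move=> hA mf if_; apply: L1approx_lim => // e e0.
have [s [_ _ cs]] := approximation_sfun_integrable mB if_.
have [k hk] := cvge0_lt e0 cs; exists (s k); split.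
  have -> : (s k : T -> R) = fun x => \sum_(y <- finmap.enum_fset (fset_set (range (s k)))) y * \1_(s k @^-1` [set y]) x.
    by apply/funext => x; rewrite fimfunE fsbig_finite.
  by apply: L1approx_sum => y; apply: L1approx_scale; exact: hA.
exact: hk.
Qed.
End L1_closure.

Lemma continuous_expR_scale {R : realType} (V : topologicalType) (k : R) (c : V -> R) :
  continuous c -> continuous (fun x => expR (k * c x)).
Proof.
move=> cc x; apply: (@continuous_comp _ _ _ (fun x => k * c x) expR).
  exact: (continuousM (@cst_continuous _ _ k x) (cc x)).
exact: continuous_expR.
Qed.

Section density.
Context {R : realType} {n : nat}.
Local Notation E := 'rV[R]_n.
Local Notation T := (lebesgue_rVType R n).
Local Notation mu := (lebesgue_rV R n).
Variable r : R.
Let B : set T := ball (0 : E) r.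
Let C : set (T -> R) := [set c : T -> R | continuous (c : E -> R)].
Implicit Types (f g c : T -> R).

Let mB : measurable B. Proof. exact: cara_ball. Qed.
Let muB : (mu B < +oo)%E. Proof. exact: lebesgue_rV_ball_fin. Qed.
Let Cm c : C c -> measurable_fun setT c. Proof. exact: continuous_cara_measurable. Qed.
Let C_add c c' : C c -> C c' -> C (fun x => c x + c' x).
Proof. by move=> cc cc' x; exact: (continuousD (cc x) (cc' x)). Qed.
Let C_scale k c : C c -> C (fun x => k * c x).
Proof. by move=> cc x; exact: (continuousM (@cst_continuous _ _ k x) (cc x)). Qed.
Let C_cst k : C (fun=> k). Proof. by move=> x; exact: cst_continuous. Qed.

Local Notation approx := (L1approx mu B C).

(* Cozero sets form a pi-system which generates the Borel sets. *)
Definition cozero : set (set E) :=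
  [set A | exists c : E -> R, [/\ continuous c, forall x, 0 <= c x & A = [set x | 0 < c x]]].

Lemma cozero_setI : setI_closed cozero.
Proof.
move=> _ _ [c [cc c0 ->]] [d [cd d0 ->]]; exists (fun x => c x * d x); split.
- by move=> x; apply: continuousM; [exact: cc|exact: cd].
- by move=> x; rewrite mulr_ge0.
- apply/seteqP; split => x /= => [[? ?]|]; first by rewrite mulr_gt0.
  by rewrite mulr_ge0_gt0// => /andP.
Qed.

Lemma measurable_cozero : @measurable _ E = <<s cozero >>.
Proof.
apply/seteqP; split; last first.
  apply: smallest_sub; first exact: sigma_algebra_measurable.
  move=> _ [c [cc _ ->]]; apply: open_measurable_rV.
  by apply: (@open_comp _ _ c [set t | 0 < t]) => [x _|]; [exact: (cc x)|exact: open_gt].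
have mid : measurable_fun setT (id : g_sigma_algebraType cozero -> E).
  apply: measurable_fun_rV => i.
  apply: (measurability _ (RGenOInfty.measurableE R)) => _ [_ [a ->] <-].
  rewrite setTI; apply: sub_sigma_algebra.
  (* The half-space [x_i > a] is a cozero set; such half-spaces generate the Borel sets. *)
  exists (fun x => bump (x ord0 i - a)); split.
  - move=> x; apply: (@continuous_comp _ _ _ (fun x : E => x ord0 i - a) bump).
      by apply: continuousB; [exact: coord_continuous|exact: cst_continuous].
    exact: (continuous_is_derive is_derive_bump).
  - by move=> x; exact: bump_ge0.
  - apply/seteqP; split => x /=; rewrite in_itv/= andbT => ax.
      by apply: bump_gt0; rewrite subr_gt0.
    rewrite ltNge; apply/negP => xa; move: ax; rewrite bump_eq0 ?ltxx//.
    by rewrite subr_le0.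
by move=> A mA; have := mid measurableT A mA; rewrite setTI.
Qed.

(** The continuous functions [1 - exp(- k c)] lie between 0 and 1 and converge pointwise to the
    indicator of the set where [c > 0]. *)
Lemma L1approx_cozero (A : set E) : cozero A -> approx \1_A.
Proof.
move=> cA; have mA : measurable (A : set T).
  by apply: sub_cara_rV; rewrite measurable_cozero; exact: sub_sigma_algebra.
case: cA mA => c [cc c0 ->] mA.
apply: (@L1approx_cvg _ _ _ mu B C mB muB Cm (fun k x => 1 + (-1) * expR (- k%:R * c x)) _ 1).
- exact: measurable_indic.
- move=> k; apply: (L1approx_mem mu B Cm); apply: C_add; first exact: C_cst.
  by apply: C_scale; exact: continuous_expR_scale.
- move=> k x; rewrite mulN1r ger0_norm; first by rewrite lerBlDr lerDl expR_ge0.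
  by rewrite subr_ge0 -expR0 ler_expR mulNr oppr_le0 mulr_ge0.
- move=> x; rewrite indicE; have [cx|cx] := pselect (0 < c x); last first.
    rewrite memNset//; have -> : c x = 0 by apply/eqP; rewrite eq_le c0 andbT leNgt; exact/negP.
    under eq_fun do rewrite mulr0 expR0 mulr1 subrr.
    exact: cvg_cst.
  rewrite mem_set//; apply/cvgrPdist_lt => e e0.
  near=> k; rewrite mulN1r opprB addrCA subrr addr0.
  rewrite ger0_norm ?expR_ge0// mulNr expRN invf_plt ?posrE ?expR_gt0//.
  apply: lt_le_trans (expR_ge1Dx _).
  rewrite ltr_wpDl// -ltr_pdivrMr//; near: k; exact: nbhs_infty_gtr.
Unshelve. all: by end_near. Qed.

Lemma L1approx_borel (A : set E) : measurable A -> approx \1_A.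
Proof.
rewrite measurable_cozero => mA.
apply: (L1approx_dynkin mB muB Cm C_add C_scale C_cst cozero_setI) mA.
- by move=> D; rewrite -measurable_cozero; exact: sub_cara_rV.
- by move=> D; exact: L1approx_cozero.
Qed.

Lemma L1approx_cara (A : set T) : measurable A -> approx \1_A.
Proof.
move=> mA; apply: (L1approx_cover mB muB Cm) => // e e0.
have mAB : measurable (A `&` B) by exact: measurableI.
have fin : ((@borel_lebesgue R n)^*%mu (A `&` B)) \is a fin_num.
  have := measure_ge0 mu (A `&` B) => /ge0_fin_numE ->.
  by apply: le_lt_trans muB; apply: le_measure; rewrite ?inE//; exact: subIsetr.
(* The completed measure is an outer measure, hence an infimum over countable covers by Borel
   sets. *)
have [_ [F [mF ABF] <-] hF] := lb_ereal_inf_adherent e0 fin.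
have mFc k : measurable (F k : set T) by exact: sub_cara_rV.
have mU : measurable (\bigcup_k F k : set E) by exact: bigcupT_measurable.
have mUc : measurable (\bigcup_k F k : set T) by exact: sub_cara_rV.
exists (\bigcup_k F k); split => //; first exact: L1approx_borel.
apply: le_lt_trans hF.
apply: le_trans (measure_sigma_subadditive mu mFc mUc (@subset_refl _ _)) _.
rewrite le_eqVlt; apply/orP; left; apply/eqP; apply: eq_eseriesr => k _.
exact: (lebesgue_rVE (mF k)).
Qed.

Lemma L1approx_integrable_rV f : measurable_fun setT f ->
  mu.-integrable B (EFin \o f) -> approx f.
Proof.
exact: (L1approx_integrable mB Cm C_add C_scale C_cst L1approx_cara).
Qed.
End density.

(** * Truncation and inequalities for powers *)

Section truncation.
Context {R : realType}.

Definition clip (k t : R) : R := Num.max (- k) (Num.min k t).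

Lemma clip_bounded k t : 0 <= k -> `|clip k t| <= k.
Proof.
move=> k0; rewrite ler_norml /clip le_max lexx /= ge_max ge_min lexx /= andbT.
by rewrite (le_trans _ k0)// oppr_le0.
Qed.

Lemma clip_id k t : `|t| <= k -> clip k t = t.
Proof.
rewrite ler_norml => /andP[h1 h2]; rewrite /clip min_r// max_r//.
Qed.

Lemma clipE k t : 0 <= k ->
  clip k t = if k <= t then k else if - k <= t then t else - k.
Proof.
move=> k0; rewrite /clip; have [kt|tk] := leP k t; first by rewrite max_r//; lra.
by have [|] := leP (- k) t.
Qed.

Lemma clip_contract k a b : 0 <= k -> `|clip k a - clip k b| <= `|a - b|.
Proof.
move=> k0; wlog ab : a b / b <= a => [h|].
  have [ba|/ltW ba] := leP b a; first exact: h.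
  by rewrite distrC [leRHS]distrC; exact: h.
rewrite [leRHS]ger0_norm ?subr_ge0// !clipE//.
have [ka|ka] := leP k a; have [kb|kb] := leP k b;
  have [ka'|ka'] := leP (- k) a; have [kb'|kb'] := leP (- k) b;
  rewrite ler_norml; apply/andP; split; lra.
Qed.

Lemma clip_sub k t : 0 <= k -> `|t - clip k t| <= `|t|.
Proof.
move=> k0; rewrite clipE//; have [?|?] := leP k t; first by rewrite !ger0_norm; lra.
have [?|?] := leP (- k) t; first by rewrite subrr normr0.
by rewrite !ler0_norm; lra.
Qed.

Lemma continuous_clip (V : topologicalType) k (c : V -> R) : continuous c ->
  continuous (fun x => clip k (c x)).
Proof.
move=> cc x.
have h1 : {for x, continuous (fun x => Num.min k (c x))}.
  by apply: (@continuous_min _ _ (cst k) c); [exact: cst_continuous|exact: cc].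
by apply: (@continuous_max _ _ (cst (- k)) _ x); [exact: cst_continuous|exact: h1].
Qed.

(** If [b] is the larger number, then [a + b <= 2 b]; the constant is of no importance. *)
Lemma powRD_le (p a b : R) : 0 <= p -> 0 <= a -> 0 <= b ->
  (a + b) `^ p <= 2 `^ p * (a `^ p + b `^ p).
Proof.
move=> p0; wlog ab : a b / a <= b => [h a0 b0|a0 b0].
  have [ab|ba] := leP a b; first exact: h.
  by rewrite addrC [a `^ p + _]addrC; apply: h => //; exact: ltW.
apply: (@le_trans _ _ ((2 * b) `^ p)).
  by apply: ge0_ler_powR => //; rewrite ?nnegrE ?addr_ge0 ?mulr_ge0//; lra.
by rewrite powRM// ler_wpM2l ?powR_ge0// lerDr powR_ge0.
Qed.

(* Young's inequality up to the value of the constant: compare t with tau s. *)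
Lemma powR_young (p s t tau : R) : 1 < p -> 0 <= s -> 0 <= t -> 0 < tau ->
  s `^ (p - 1) * t <= tau * s `^ p + (tau^-1) `^ (p - 1) * t `^ p.
Proof.
move=> p1 s0 t0 tau0; have p0 : 0 < p by lra.
have [ts|st] := leP t (tau * s).
  apply: (@le_trans _ _ (tau * s `^ p)); last by rewrite lerDl mulr_ge0// powR_ge0.
  rewrite -(mulr_powRB1 s0 p0) mulrA [_ * s `^ _]mulrC.
  by rewrite ler_wpM2l// powR_ge0.
apply: (@le_trans _ _ ((tau^-1) `^ (p - 1) * t `^ p)); last first.
  by rewrite lerDr mulr_ge0// ?powR_ge0// ltW.
rewrite -(mulr_powRB1 t0 p0) [t * _]mulrC mulrA ler_wpM2r//.
rewrite -powRM//; last by rewrite invr_ge0 ltW.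
apply: ge0_ler_powR; rewrite ?nnegrE ?mulr_ge0 ?invr_ge0 ?(ltW tau0)//; first lra.
by rewrite mulrC ler_pdivlMr// mulrC ltW.
Qed.
End truncation.

Section abstract_Lp.
Context {R : realType} d (T : measurableType d) (mu : {measure set T -> \bar R}).
Implicit Types (z f g : T -> R).

Lemma measurable_clip k z : measurable_fun setT z -> measurable_fun setT (fun x => clip k (z x)).
Proof.
move=> mz; apply: measurable_maxr; first exact: measurable_cst.
by apply: measurable_minr => //; exact: measurable_cst.
Qed.

Lemma measurable_powR_fun (p : R) z : measurable_fun setT z ->
  measurable_fun setT (fun x => z x `^ p).
Proof. by move=> mz; exact: (measurableT_comp (measurable_powR p) mz). Qed.

Lemma measurable_dist_powR (p : R) z f : measurable_fun setT z -> measurable_fun setT f ->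
  measurable_fun setT (fun x => `|z x - f x| `^ p).
Proof.
move=> mz mf; apply: measurable_powR_fun.
by apply: measurableT_comp => //; exact: measurable_funB.
Qed.

(** Dominated convergence: the difference is bounded by [|z|] and, at each point, is 0 as soon as
    [k] exceeds [|z x|]. *)
Lemma Lp_truncation (p e : R) z : 0 < p -> 0 < e -> measurable_fun setT z ->
  mu.-integrable setT (EFin \o (fun x => `|z x| `^ p)) ->
  exists2 k : R, 0 <= k & (\int[mu]_x (`|z x - clip k (z x)| `^ p)%:E < e%:E)%E.
Proof.
move=> p0 e0 mz iz.
have c0 x : (`|z x - clip k%:R (z x)| `^ p)%:E @[k --> \oo] --> 0%E.
  apply/fine_cvgP; split; first exact: nearW.
  apply/cvgrPdist_lt => a a0; near=> k => /=.
  rewrite clip_id ?subrr ?normr0 ?powR0 ?gt_eqF// ?subrr ?normr0//.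
  by near: k; exact: nbhs_infty_ger.
have dom k x : (`|(`|z x - clip k%:R (z x)| `^ p)%:E| <= (`|z x| `^ p)%:E)%E.
  rewrite /= lee_fin ger0_norm ?powR_ge0//.
  by apply: ge0_ler_powR; rewrite ?nnegrE// ?(ltW p0)//; exact: clip_sub.
have [_ + _] := @dominated_convergence _ _ _ mu setT measurableT
   (fun k x => (`|z x - clip k%:R (z x)| `^ p)%:E) (cst 0%E) _
   (fun k => iffRL (measurable_EFinP _ _) (measurable_dist_powR p mz (measurable_clip k%:R mz)))
   (measurable_cst _) (aeW _ (fun x _ => c0 x)) iz (aeW _ (fun x k _ => dom k x)).
move=> /(cvge0_lt e0)[k hk]; exists k%:R => //; apply: le_lt_trans hk.
rewrite le_eqVlt; apply/orP; left; apply/eqP; apply: eq_integral => x _.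
by rewrite /cst sube0 gee0_abs// lee_fin powR_ge0.
Unshelve. all: by end_near. Qed.
Lemma Lp_split (p : R) z z' f : 0 < p -> measurable_fun setT z ->
  measurable_fun setT z' -> measurable_fun setT f ->
  (\int[mu]_x (`|z x - f x| `^ p)%:E <= (2 `^ p)%:E * \int[mu]_x (`|z x - z' x| `^ p)%:E +
    (2 `^ p)%:E * \int[mu]_x (`|z' x - f x| `^ p)%:E)%E.
Proof.
move=> p0 mz mz' mf.
have m1 := measurable_dist_powR p mz mz'; have m2 := measurable_dist_powR p mz' mf.
have m3 := measurable_dist_powR p mz mf.
apply: (@le_trans _ _ (\int[mu]_x ((2 `^ p)%:E * (`|z x - z' x| `^ p)%:E +
    (2 `^ p)%:E * (`|z' x - f x| `^ p)%:E))%E).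
  apply: ge0_le_integral => //.
  - exact/measurable_EFinP.
  - by apply: emeasurable_funD; apply: measurable_funeM; exact/measurable_EFinP.
  - move=> x _; rewrite -!EFinM -EFinD lee_fin -mulrDr.
    apply: le_trans (powRD_le (ltW p0) (normr_ge0 _) (normr_ge0 _)).
    by apply: ge0_ler_powR; rewrite ?nnegrE ?addr_ge0 ?(ltW p0)//; exact: ler_distD.
have pos (g : T -> R) x : setT x -> (0 <= (2 `^ p)%:E * (`|g x| `^ p)%:E)%E.
  by move=> _; rewrite -EFinM lee_fin mulr_ge0// powR_ge0.
have mm (g : T -> R) : measurable_fun setT (fun x => `|g x| `^ p) ->
    measurable_fun setT (fun x => (2 `^ p)%:E * (`|g x| `^ p)%:E)%E.
  by move=> mg; apply: measurable_funeM; exact/measurable_EFinP.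
rewrite (ge0_integralD mu measurableT (pos (fun x => z x - z' x)) (mm _ m1)
  (pos (fun x => z' x - f x)) (mm _ m2)).
have pos' (g : T -> R) x : setT x -> (0 <= (`|g x| `^ p)%:E)%E by rewrite lee_fin powR_ge0.
by rewrite !ge0_integralZl_EFin ?powR_ge0//; exact/measurable_EFinP.
Qed.

(** A function [h] bounded by [K] satisfies [|h|^p <= K^(p-1) |h|]. In the application [f] is [g]
    clipped and cut off, which on [B] only brings it closer to [z]. *)
Lemma Lp_le_L1 (B : set T) (p K : R) z f g : measurable B -> 1 < p -> 0 <= K ->
  measurable_fun setT z -> measurable_fun setT f -> measurable_fun setT g ->
  (forall x, `|z x - f x| <= K) -> (forall x, B x -> `|z x - f x| <= `|z x - g x|) ->
  (forall x, ~ B x -> z x - f x = 0) ->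
  (\int[mu]_x (`|z x - f x| `^ p)%:E <= (K `^ (p - 1))%:E * L1dist mu B z g)%E.
Proof.
move=> mB p1 K0 mz mf mg h1 h2 h3; have p0 : 0 < p by lra.
rewrite /L1dist -ge0_integralZl_EFin ?powR_ge0//; last exact: measurable_absB.
rewrite [leRHS]integral_mkcond; apply: ge0_le_integral => //.
- by apply/measurable_EFinP; exact: measurable_dist_powR.
- apply/(measurable_restrictT _ mB); apply: measurable_funeM; exact: measurable_absB.
- move=> x _; rewrite patchE; case: ifPn => [|/negP]; rewrite in_setE => xB.
    rewrite -EFinM lee_fin -(mulr_powRB1 (normr_ge0 _) p0) mulrC.
    apply: ler_pM => //; last exact: h2.
    by apply: ge0_ler_powR; rewrite ?nnegrE//; lra.
  by rewrite h3// normr0 powR0 ?gt_eqF.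
Qed.
End abstract_Lp.

Section Lp_density.
Context {R : realType} {n : nat}.
Local Notation E := 'rV[R]_n.
Local Notation T := (lebesgue_rVType R n).
Local Notation mu := (lebesgue_rV R n).

Lemma continuous_norm_sub (V : topologicalType) (a : R) (c : V -> R) : continuous c ->
  continuous (fun x => a - c x).
Proof. by move=> cc x; exact: (continuousB (@cst_continuous _ _ a x) (cc x)). Qed.

Lemma continuous_cutoff (r : R) :
  continuous (fun x : E => clip 1 (Num.max 0 (r + 1 - `|x|))).
Proof.
apply: continuous_clip => x.
apply: (@continuous_max _ _ (cst 0) (fun x : E => r + 1 - `|x|)).
  exact: cst_continuous.
by apply: continuous_norm_sub; exact: norm_continuous.
Qed.

Lemma cutoff_eq1 (r : R) (x : E) : ball 0 r x -> clip 1 (Num.max 0 (r + 1 - `|x|)) = 1.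
Proof.
rewrite -ball_normE/= sub0r normrN => xr.
by rewrite clipE// ifT// le_max; apply/orP; right; lra.
Qed.

Lemma cutoff_eq0 (r : R) (x : E) : r + 1 <= `|x| -> clip 1 (Num.max 0 (r + 1 - `|x|)) = 0.
Proof. by move=> xr; rewrite max_l ?subr_le0// clip_id// normr0. Qed.

Lemma cutoff_bound (r : R) (x : E) : `|clip 1 (Num.max 0 (r + 1 - `|x|))| <= 1.
Proof. exact: clip_bounded. Qed.

(** [z] is truncated at a height [k] and approximated in L^1 on a larger cube by a continuous [c0].
    Clipping [c0] at [k] and multiplying by a cutoff do not increase the distance to the truncation,
    because that is bounded by [k] and vanishes wherever the cutoff is below 1. *)
Lemma Lp_dense (p r e : R) (z : T -> R) : 1 < p -> 0 < e -> measurable_fun setT z ->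
  mu.-integrable setT (EFin \o (fun x => `|z x| `^ p)) ->
  (forall x : E, ~ ball 0 r x -> z x = 0) ->
  exists c : E -> R, [/\ continuous c, compact (support_closure c) &
    (\int[mu]_x (`|z x - c x| `^ p)%:E < e%:E)%E].
Proof.
move=> p1 e0 mz iz zr; have p0 : 0 < p by lra.
have P0 : 0 < 2 `^ p :> R by rewrite powR_gt0.
have e1 : 0 < e / 2 / 2 `^ p by rewrite !divr_gt0.
have [k k0 hk] := Lp_truncation p0 e1 mz iz.
pose z' x := clip k (z x).
have mz' : measurable_fun setT z' by exact: measurable_clip.
have K0 : 0 <= (2 * k) `^ (p - 1) by exact: powR_ge0.
(* [2 k] bounds the error after clipping, so [(2 k)^(p-1)] converts the L^1 error into an L^p error;
   [2^p] is the constant of [Lp_split]. *)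
have e2 : 0 < e / 2 / 2 `^ p / ((2 * k) `^ (p - 1) + 1) by rewrite !divr_gt0// ltr_wpDl.
pose B : set T := ball (0 : E) (r + 1).
have iz' : mu.-integrable B (EFin \o z').
  apply: (integrableS measurableT) => //; first exact: cara_ball.
  apply: (@integrable_bounded_support _ _ z' k r 0) => // x.
    exact: clip_bounded.
  by move=> /zr zx; rewrite /z' zx clip_id// normr0.
have [_ /(_ _ e2)[c0 [cc0 hc0]]] := L1approx_integrable_rV mz' iz'.
pose chi (x : E) := clip 1 (Num.max 0 (r + 1 - `|x|)).
pose c (x : E) := clip k (c0 x) * chi x.
have cc : continuous c.
  move=> x; have h1 := @continuous_clip _ _ k c0 cc0 x.
  exact: (continuousM h1 (@continuous_cutoff r x)).
exists c; split => //.
  apply: (@compact_support_le _ _ _ 0 (r + 1)) => x; rewrite subr0 => xr.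
  by rewrite /c /chi cutoff_eq0 ?mulr0// ltW.
have mc := continuous_cara_measurable cc; have mc0 := continuous_cara_measurable cc0.
have Bx (x : E) : ~ B x -> r + 1 <= `|x|.
  by move=> h; rewrite leNgt; apply/negP => xr; apply: h; rewrite /B -ball_normE/= sub0r normrN.
have d1 (x : E) : B x -> `|z' x - c x| <= `|z' x - c0 x|.
  move=> _; have [xr|xr] := pselect (ball 0 r x).
    rewrite /c /chi cutoff_eq1// mulr1 -{1}(@clip_id _ k (z' x)) ?clip_bounded//.
    exact: clip_contract.
  have -> : z' x = 0 by rewrite /z' zr// clip_id// normr0.
  rewrite !sub0r !normrN /c normrM; apply: (@le_trans _ _ `|clip k (c0 x)|).
    by rewrite ler_piMr// cutoff_bound.
  rewrite -{1}(subr0 (clip _ _)) -{1}(@clip_id _ k 0) ?normr0//.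
  by apply: le_trans (clip_contract _ _ k0) _; rewrite subr0.
have d2 (x : E) : ~ B x -> z' x - c x = 0.
  move=> xB; rewrite /c /chi cutoff_eq0 ?mulr0 ?subr0//; last exact: Bx.
  rewrite /z' zr ?clip_id ?normr0// => xr; apply: xB; apply: le_ball xr.
  by rewrite lerDl.
have d3 (x : E) : `|z' x - c x| <= 2 * k.
  apply: le_trans (ler_normB _ _) _; rewrite mulr2n mulrDl mul1r lerD ?clip_bounded//.
  rewrite /c normrM -[leRHS]mulr1 ler_pM// ?clip_bounded// cutoff_bound//.
have mB : measurable B by exact: cara_ball.
apply: le_lt_trans (Lp_split mu p0 mz mz' mc) _.
have E1 : ((2 `^ p)%:E * \int[mu]_x (`|z x - z' x| `^ p)%:E < (e / 2)%:E)%E.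
  by rewrite muleC -lte_pdivlMr.
have k20 : 0 <= 2 * k by rewrite mulr_ge0.
have E2 := Lp_le_L1 mu mB p1 k20 mz' mc mc0 d3 d1 d2.
have E3 : ((2 `^ p)%:E * \int[mu]_x (`|z' x - c x| `^ p)%:E <= (e / 2)%:E)%E.
  rewrite muleC -lee_pdivlMr//; apply: le_trans E2 _.
  apply: (@le_trans _ _ (((2 * k) `^ (p - 1))%:E *
     (e / 2 / 2 `^ p / ((2 * k) `^ (p - 1) + 1))%:E)%E).
    by apply: lee_wpmul2l => //; exact: ltW.
  rewrite -EFinM lee_fin mulrCA ler_piMr//; first by rewrite !divr_ge0// ltW.
  by rewrite ler_pdivrMr ?mul1r ?lerDl// ltr_wpDl.
apply: le_lt_trans (leeD2l _ E3) _.
by rewrite [e in ltRHS]splitr EFinD lteD2rE.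
Qed.
End Lp_density.

(** * Mollification in L^p *)

Section kernel_average.
Context {R : realType} d (T : measurableType d) (mu : {sigma_finite_measure set T -> \bar R}).
Variable k : T -> T -> R.
Hypothesis mk : measurable_fun setT (fun q : T * T => k q.1 q.2).
Hypothesis k0 : forall x y, 0 <= k x y.
Hypothesis k1 : forall x, (\int[mu]_y (k x y)%:E = 1)%E.
Hypothesis k2 : forall y, (\int[mu]_x (k x y)%:E = 1)%E.

Let mk1 x : measurable_fun setT (k x).
Proof. exact: (measurableT_comp mk (pair1_measurable x)). Qed.

Let mk2 y : measurable_fun setT (k ^~ y).
Proof. exact: (measurableT_comp mk (pair2_measurable y)). Qed.

Let ik x : mu.-integrable setT (EFin \o k x).
Proof.
apply/integrableP; split; first exact/measurable_EFinP.
under eq_integral do rewrite /= ger0_norm//.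
by rewrite k1 ltry.
Qed.

(* [A] and [D] split the increment of [z] into a part at [x] and a part at [y], so that
   Tonelli and the two normalizations of [k] remove the kernel. *)
Lemma kernel_error (f z A D : T -> R) : measurable_fun setT f -> measurable_fun setT z ->
  measurable_fun setT A -> measurable_fun setT D ->
  (forall x, 0 <= A x) -> (forall y, 0 <= D y) ->
  (forall x, mu.-integrable setT (EFin \o (fun y => k x y * z y))) ->
  measurable_fun setT (fun x => \int[mu]_y (k x y * z y)) ->
  (forall x y, k x y * (`|f x| * `|z y - z x|) <= k x y * (A x + D y)) ->
  (\int[mu]_x (`|f x| * `|\int[mu]_y (k x y * z y) - z x|)%:E <=
    \int[mu]_x (A x)%:E + \int[mu]_y (D y)%:E)%E.
Proof.
move=> mf mz mA mD A0 D0 ikz mkz h.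
have mkD : measurable_fun setT (fun q : T * T => (k q.1 q.2 * D q.2)%:E).
  apply/measurable_EFinP; apply: measurable_funM => //.
  exact: (measurableT_comp mD measurable_snd).
have kD0 (q : T * T) : (0 <= (k q.1 q.2 * D q.2)%:E)%E by rewrite lee_fin mulr_ge0.
have kD0' x y : setT y -> (0 <= (k x y * D y)%:E)%E by move=> _; rewrite lee_fin mulr_ge0.
have rk1 x : \int[mu]_y k x y = 1 by rewrite /Rintegral k1.
have mF := measurable_fun_fubini_tonelli_F (m2 := mu) _ mkD kD0.
have step1 x : ((`|f x| * `|\int[mu]_y (k x y * z y) - z x|)%:E <=
    (A x)%:E + \int[mu]_y (k x y * D y)%:E)%E.
  have e1 : \int[mu]_y (k x y * z y) - z x = \int[mu]_y (k x y * z y - k x y * z x).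
    rewrite RintegralB//; last first.
      by under eq_fun do rewrite /= mulrC; exact: integrable_RZ.
    by rewrite RintegralZr// rk1 mul1r.
  have ib : mu.-integrable setT (EFin \o (fun y => k x y * z y - k x y * z x)).
    apply: integrable_RB => //.
    by under eq_fun do rewrite /= mulrC; exact: integrable_RZ.
  have mb : measurable_fun setT (fun y => k x y * z y - k x y * z x).
    by case/integrableP : ib => /measurable_EFinP.
  have mab : measurable_fun setT (fun y => `|k x y * z y - k x y * z x|%:E).
    by apply/measurable_EFinP; exact: measurableT_comp.
  rewrite e1 EFinM EFin_normr_Rintegral//.
  apply: (@le_trans _ _ (`|f x|%:E * \int[mu]_y `|k x y * z y - k x y * z x|%:E)%E).
    apply: lee_wpmul2l; first by rewrite lee_fin.
    by apply: le_trans (le_abse_integral mu measurableT _) _ => //; exact/measurable_EFinP.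
  rewrite -ge0_integralZl_EFin//.
  have -> : ((A x)%:E = \int[mu]_y ((A x)%:E * (k x y)%:E))%E.
    by rewrite ge0_integralZl_EFin ?k1 ?mule1// => [y _|]; [rewrite lee_fin|exact/measurable_EFinP].
  have mAk : measurable_fun setT (fun y => (A x)%:E * (k x y)%:E)%E.
    by apply: measurable_funeM; exact/measurable_EFinP.
  have mkDx : measurable_fun setT (fun y => (k x y * D y)%:E).
    by apply/measurable_EFinP; exact: measurable_funM.
  have posA y : setT y -> (0 <= (A x)%:E * (k x y)%:E)%E by rewrite -EFinM lee_fin mulr_ge0.
  rewrite -(ge0_integralD mu measurableT posA mAk (kD0' x) mkDx).
  apply: ge0_le_integral => //.
  - exact: measurable_funeM.
  - exact: emeasurable_funD.
  - move=> y _; rewrite -!EFinM -EFinD lee_fin [A x * _]mulrC -mulrDr.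
    apply: le_trans (h x y).
    by rewrite -mulrBr normrM (ger0_norm (k0 x y)) mulrCA.
have mAE : measurable_fun setT (fun x => (A x)%:E) by exact/measurable_EFinP.
apply: (@le_trans _ _ (\int[mu]_x ((A x)%:E + \int[mu]_y (k x y * D y)%:E))%E).
  apply: ge0_le_integral => //.
  - apply/measurable_EFinP; apply: measurable_funM; first exact: measurableT_comp.
    by apply: measurableT_comp => //; exact: measurable_funB.
  - exact: emeasurable_funD.
have posAx x : setT x -> (0 <= (A x)%:E)%E by rewrite lee_fin.
have posI x : setT x -> (0 <= \int[mu]_y (k x y * D y)%:E)%E.
  by move=> _; apply: integral_ge0 => y; exact: kD0'.
rewrite (ge0_integralD mu measurableT posAx mAE posI mF).
apply: leeD2l; rewrite (fubini_tonelli (m1 := mu) (m2 := mu) _ mkD kD0).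
apply: ge0_le_integral => //.
- by move=> y _; apply: integral_ge0 => x _; exact: kD0'.
- exact: (measurable_fun_fubini_tonelli_G (m1 := mu) _ mkD kD0).
- exact/measurable_EFinP.
- move=> y _ /=; under eq_integral do rewrite mulrC EFinM.
  by rewrite ge0_integralZl_EFin ?k2 ?mule1// => [x _|]; [rewrite lee_fin|exact/measurable_EFinP].
Qed.
End kernel_average.

Section measurable_combinations.
Context {R : realType} d (T : measurableType d).
Variables f g : T -> R.
Hypotheses (mf : measurable_fun setT f) (mg : measurable_fun setT g).

Lemma measurable_scaled (a : R) : measurable_fun setT (fun x => a * f x).
Proof. by apply: measurable_funM => //; exact: measurable_cst. Qed.

Lemma measurable_lincomb (a b : R) : measurable_fun setT (fun x => a * f x + b * g x).
Proof. by apply: measurable_funD; apply: measurable_funM => //; exact: measurable_cst. Qed.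
End measurable_combinations.

Section mollification_Lp.
Context {R : realType} {n : nat}.
Local Notation E := 'rV[R]_n.
Local Notation T := (lebesgue_rVType R n).
Local Notation mu := (lebesgue_rV R n).

Lemma measurable_sub_rV :
  measurable_fun setT (fun q : T * T => (q.1 : E) - (q.2 : E) : E).
Proof.
apply: measurable_fun_rV => i.
have mc : measurable_fun setT (rV_coord i : T -> measurableTypeR R).
  exact: (borel_measurable_cara (measurable_rV_coord i)).
rewrite (_ : _ \o _ = fun q : T * T => (rV_coord i (q.1 : E) : R) - rV_coord i (q.2 : E)); last first.
  by apply/funext => q; rewrite /rV_coord /= !mxE.
by apply: measurable_funB;
  [exact: (measurableT_comp mc measurable_fst)|exact: (measurableT_comp mc measurable_snd)].
Qed.

Lemma measurable_moll_sub (e : R) :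
  measurable_fun setT (fun q : T * T => moll e ((q.1 : E) - (q.2 : E))).
Proof.
have mm : measurable_fun setT (moll e : E -> R).
  by apply: open_continuous_borel_measurable; [exact: openT|move=> x _; exact: continuous_moll].
exact: (measurableT_comp mm measurable_sub_rV).
Qed.

Lemma integral_moll_l (e : R) (y : E) : 0 < e -> (\int[mu]_x (moll e ((x : E) - y))%:E = 1)%E.
Proof.
move=> e0; rewrite -(integral_moll y e0); apply: eq_integral => x _.
by rewrite -mollN opprB.
Qed.

(** [|z|] is at most 1 or at most [|z|^p], and it vanishes outside a cube. *)
Lemma integrable_of_powR (p r : R) (z : T -> R) : 1 < p -> measurable_fun setT z ->
  mu.-integrable setT (EFin \o (fun x => `|z x| `^ p)) ->
  (forall x : E, ~ ball 0 r x -> z x = 0) -> mu.-integrable setT (EFin \o z).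
Proof.
move=> p1 mz iz zr.
apply: (integrable_dominated mz (integrable_RD (integrable_indic_ball (0 : E) r) iz)) => x.
rewrite indicE; have [xr|xr] := pselect (ball (0 : E) r x); last first.
  by rewrite zr// normr0 addr_ge0// powR_ge0.
rewrite mem_set//=; have [h|h] := leP `|z x| 1.
  by rewrite (le_trans h)// lerDl powR_ge0.
apply: (@le_trans _ _ (`|z x| `^ p)); last by rewrite lerDr.
by rewrite le1r_powR// ltW.
Qed.

(** The increment [z y - z x] passes through a continuous approximation [c]: the increment of [c] is
    at most [tau] for small [e], and Young's inequality separates [S^(p-1)] from the values of
    [|z - c|] at [x] and at [y]. The bound of [|f|] by [S^p] handles the term with [tau]. *)
Lemma mollification_error (p r kappa : R) (S f z : T -> R) : 1 < p -> 0 < kappa ->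
  measurable_fun setT S -> measurable_fun setT f -> measurable_fun setT z ->
  (forall x, 0 <= S x) -> mu.-integrable setT (EFin \o (fun x => S x `^ p)) ->
  (forall x, `|f x| <= S x `^ (p - 1)) -> (forall x, `|f x| <= S x `^ p) ->
  mu.-integrable setT (EFin \o (fun x => `|z x| `^ p)) ->
  (forall x : E, ~ ball 0 r x -> z x = 0) ->
  exists2 e0, 0 < e0 & forall e, 0 < e -> e < e0 ->
    (\int[mu]_x (`|f x| * `|conv z (moll e) x - z x|)%:E <= kappa%:E)%E.
Proof.
move=> p1 kap0 mS mf mz S0 iS fS1 fS iz zr; have p0 : 0 < p by lra.
pose I := \int[mu]_x (S x `^ p).
have I0 : 0 <= I by apply: Rintegral_ge0 => x _; exact: powR_ge0.
(* The terms [tau S^p] occur three times and may cost [kappa / 2]; the two terms with [|z - c|^p]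
   may cost [kappa / 4] each. *)
pose tau := kappa / 6 / (I + 1).
have tau0 : 0 < tau by rewrite !divr_gt0// ltr_wpDl.
pose tau' := (tau^-1) `^ (p - 1).
have tau'0 : 0 < tau' by rewrite powR_gt0// invr_gt0.
have dl0 : 0 < kappa / 4 / tau' by rewrite !divr_gt0.
have [c [cc cK hc]] := Lp_dense p1 dl0 mz iz zr.
have [e0 e00 he0] := compact_support_uniform cc cK tau0.
exists e0 => // e e_gt0 ee0.
have mc := continuous_cara_measurable cc.
pose A x := 3 * tau * S x `^ p + tau' * `|z x - c x| `^ p.
pose D y := tau' * `|z y - c y| `^ p.
have msp := measurable_powR_fun p mS.
have mzc := measurable_dist_powR p mz mc.
have mD : measurable_fun setT D := measurable_scaled mzc tau'.
have mA : measurable_fun setT A := measurable_lincomb msp mzc (3 * tau) tau'.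
have D0 y : 0 <= D y by apply: mulr_ge0; [exact: ltW|exact: powR_ge0].
have A0 x : 0 <= A x.
  apply: addr_ge0 (D0 x); apply: mulr_ge0; last exact: powR_ge0.
  by apply: mulr_ge0; [lra|exact: ltW].
have iz1 := integrable_of_powR p1 mz iz zr.
have cmo := @continuous_moll R n e; have Kmo := @compact_moll R n e e_gt0.
have ikz (x : T) : mu.-integrable setT (EFin \o (fun y => moll e ((x : E) - (y : E)) * z y)).
  by under eq_fun do rewrite mulrC; exact: (conv_integrable x iz1 cmo Kmo).
have convE (x : E) : conv z (moll e) x = \int[mu]_y (moll e (x - (y : E)) * z y).
  by apply: eq_Rintegral => y _; rewrite mulrC.
have mconv : measurable_fun setT (fun x : T => \int[mu]_y (moll e ((x : E) - (y : E)) * z y)).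
  under eq_fun do rewrite -convE.
  exact: (continuous_cara_measurable (conv_continuous iz1 cmo Kmo)).
have pw (x y : T) : moll e ((x : E) - (y : E)) * (`|f x| * `|z y - z x|) <=
    moll e ((x : E) - (y : E)) * (A x + D y).
  have [xy|xy] := pselect (ball (0 : E) e ((x : E) - (y : E))); last first.
    by rewrite moll_support// !mul0r.
  apply: ler_wpM2l; first exact: moll_ge0.
  have cxy : `|c y - c x| <= tau.
    apply/ltW/he0; apply: lt_trans ee0.
    by move: xy; rewrite -ball_normE/= sub0r opprB.
  have t1 : `|z y - z x| <= tau + `|z y - c y| + `|z x - c x|.
    rewrite (_ : z y - z x = (c y - c x) + (z y - c y) - (z x - c x)); last by ring.
    apply: le_trans (ler_normB _ _) _; rewrite lerD2r.
    by apply: le_trans (ler_normD _ _) _; rewrite lerD2r.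
  have y1 := powR_young p1 (S0 x) (normr_ge0 (z y - c y)) tau0.
  have y2 := powR_young p1 (S0 x) (normr_ge0 (z x - c x)) tau0.
  apply: (@le_trans _ _ (`|f x| * (tau + `|z y - c y| + `|z x - c x|))).
    exact: ler_wpM2l.
  rewrite !mulrDr.
  have g1 : `|f x| * tau <= tau * S x `^ p by rewrite mulrC ler_wpM2l// ltW.
  have g2 : `|f x| * `|z y - c y| <= S x `^ (p - 1) * `|z y - c y| by exact: ler_wpM2r.
  have g3 : `|f x| * `|z x - c x| <= S x `^ (p - 1) * `|z x - c x| by exact: ler_wpM2r.
  rewrite /A /D -/tau'; move: y1 y2; rewrite -/tau'; lra.
under eq_integral do rewrite convE.
apply: le_trans (@kernel_error _ _ T (@lebesgue_rV_sf R n)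
  (fun x y => moll e ((x : E) - (y : E))) (measurable_moll_sub e)
  (fun x y => moll_ge0 _ e_gt0) (fun x => integral_moll x e_gt0)
  (fun y => integral_moll_l y e_gt0) f z A D mf mz mA mD A0 D0 ikz mconv pw) _.
have eS : (\int[mu]_x (S x `^ p)%:E = I%:E)%E.
  by rewrite /I /Rintegral fineK//; exact: (integrable_fin_num measurableT iS).
have pos1 (x : T) : setT x -> (0 <= (S x `^ p)%:E)%E by rewrite lee_fin powR_ge0.
have pos2 (x : T) : setT x -> (0 <= (`|z x - c x| `^ p)%:E)%E by rewrite lee_fin powR_ge0.
have hD : (\int[mu]_y (D y)%:E <= (kappa / 4)%:E)%E.
  have -> : (\int[mu]_y (D y)%:E = tau'%:E * \int[mu]_x (`|z x - c x| `^ p)%:E)%E.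
    exact: (ge0_integralZl_EFin mu measurableT pos2 (iffRL (measurable_EFinP _ _) mzc) (ltW tau'0)).
  by rewrite muleC -lee_pdivlMr// ltW.
have hA : (\int[mu]_x (A x)%:E <= (kappa / 2 + kappa / 4)%:E)%E.
  have -> : (\int[mu]_x (A x)%:E = (3 * tau)%:E * \int[mu]_x (S x `^ p)%:E + \int[mu]_y (D y)%:E)%E.
    rewrite -(ge0_integralZl_EFin mu measurableT pos1 (iffRL (measurable_EFinP _ _) msp) _); last by rewrite mulr_ge0// ltW.
    have posc (x : T) : setT x -> (0 <= (3 * tau)%:E * (S x `^ p)%:E)%E.
      by move=> _; rewrite -EFinM lee_fin; apply: mulr_ge0; [rewrite mulr_ge0// ltW|exact: powR_ge0].
    have mc3 : measurable_fun setT (fun x : T => (3 * tau)%:E * (S x `^ p)%:E)%E.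
      by apply: measurable_funeM; exact/measurable_EFinP.
    have posD (x : T) : setT x -> (0 <= (D x)%:E)%E by rewrite lee_fin.
    rewrite -(ge0_integralD mu measurableT posc mc3 posD (iffRL (measurable_EFinP _ _) mD)).
    by [].
  rewrite eS -EFinM EFinD; apply: leeD hD; rewrite lee_fin /tau.
  have -> : 3 * (kappa / 6 / (I + 1)) * I = kappa / 2 * (I / (I + 1)) by field; lra.
  by rewrite ler_piMr//; [rewrite divr_ge0// ltW|rewrite ler_pdivrMr ?mul1r ?lerDl// ltr_wpDl].
apply: le_trans (leeD hA hD) _; rewrite -EFinD lee_fin; lra.
Qed.
End mollification_Lp.

(** * Weak maximum principle *)

Section integral_sums.
Context {R : realType} d (T : measurableType d) (mu : {measure set T -> \bar R}).
Context (I : Type) (r : seq I) (f : I -> T -> R).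
Hypothesis if_ : forall i, mu.-integrable setT (EFin \o f i).

Lemma integrable_Rsum : mu.-integrable setT (EFin \o (fun x => \sum_(i <- r) f i x)).
Proof.
elim: r => [|i s IH].
  by under eq_fun do rewrite /= big_nil; exact: integrable0.
under eq_fun do rewrite /= big_cons; exact: integrable_RD.
Qed.
End integral_sums.

Lemma Rintegral_sum (R : realType) d (T : measurableType d) (mu : {measure set T -> \bar R})
    (I : Type) (r : seq I) (f : I -> T -> R) :
  (forall i, mu.-integrable setT (EFin \o f i)) ->
  \int[mu]_x (\sum_(i <- r) f i x) = \sum_(i <- r) \int[mu]_x f i x.
Proof.
move=> if_; elim: r => [|i s IH].
  by under eq_Rintegral do rewrite big_nil; rewrite big_nil Rintegral_cst// mul0r.
under eq_Rintegral do rewrite big_cons.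
by rewrite big_cons RintegralD ?IH//; exact: integrable_Rsum.
Qed.

Lemma measurable_norm_mul_dist (R : realType) d (T : measurableType d) (f g h : T -> R) :
  measurable_fun setT f -> measurable_fun setT g -> measurable_fun setT h ->
  measurable_fun setT (fun x => `|f x| * `|g x - h x|).
Proof.
move=> mf mg mh; apply: measurable_funM; first exact: measurableT_comp.
by apply: measurableT_comp => //; exact: measurable_funB.
Qed.

Lemma integrable_ge0_le (R : realType) d (T : measurableType d) (mu : {measure set T -> \bar R})
    (f : T -> R) (k : R) : measurable_fun setT f -> (forall x, 0 <= f x) ->
  (\int[mu]_x (f x)%:E <= k%:E)%E ->
  mu.-integrable setT (EFin \o f) /\ \int[mu]_x f x <= k.
Proof.
move=> mf f0 fk; have if_ : mu.-integrable setT (EFin \o f).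
  apply/integrableP; split; first exact/measurable_EFinP.
  under eq_integral do rewrite /= ger0_norm//.
  exact: le_lt_trans fk (ltry _).
split => //; rewrite -lee_fin /Rintegral fineK//.
exact: (integrable_fin_num measurableT if_).
Qed.

Section weak_max_principle.
Context {R : realType} {n : nat}.
Local Notation E := 'rV[R]_n.
Local Notation T := (lebesgue_rVType R n).
Local Notation mu := (lebesgue_rV R n).
Implicit Types (w z f : E -> R) (V : set E).

(** If the closed cube of radius [e] about [x] lies in [V], the reflected mollifier is an admissible
    test function; its derivative in [y] changes sign, which cancels the sign in the weak
    gradient. *)
Lemma conv_partial_weak V w z i (e : R) x : 0 < e ->
  mu.-integrable setT (EFin \o w) -> mu.-integrable setT (EFin \o z) ->
  (forall psi, test_function V psi ->
    \int[mu]_y (w y * partial i psi y) = - \int[mu]_y (z y * psi y)) ->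
  (forall y, `|y - x| <= e -> V y) ->
  conv w (partial i (moll e)) x = conv z (moll e) x.
Proof.
move=> e0 iw iz H xV.
have sup y : e < `|y - x| -> moll e (x - y) = 0.
  by move=> h; apply: moll_norm_support => //; rewrite subr0 distrC.
have tf : test_function V (fun y => moll e (x - y)).
  split; first by move=> k; exact/Ck_reflect/Ck_moll.
    exact: (compact_support_le sup).
  exact: (subset_trans (support_closure_le sup)).
have H1 : \int[mu]_y (w y * partial i (fun y => moll e (x - y)) y) =
    - conv w (partial i (moll e)) x.
  rewrite -[RHS]mulN1r -RintegralZl//.
    apply: eq_Rintegral => y _; rewrite partial_reflect; last exact: Ck_moll.
    by rewrite mulrN mulN1r.
  apply: (conv_integrable _ iw).
    by move=> y; exact: (Ck_cont (Ck_partial i (Ck_moll 1 e))).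
  apply: subclosed_compact (compact_moll e0) (@support_closure_partial _ _ _ i).
  exact: closed_closure.
by apply/oppr_inj; rewrite -H1 (H _ tf).
Qed.

Lemma conv_moll_close w (e eta : R) x : 0 < e -> continuous w ->
  mu.-integrable setT (EFin \o w) ->
  (forall y, `|x - y| < e -> `|w x - w y| <= eta) ->
  `|conv w (moll e) x - w x| <= eta.
Proof.
move=> e0 cw iw h.
have im := integrable_moll_reflect x e0.
have ic : mu.-integrable setT (EFin \o (fun y => w y * moll e (x - y))).
  by apply: (conv_integrable _ iw); [exact: continuous_moll|exact: compact_moll].
have e1 : conv w (moll e) x - w x =
    \int[mu]_y (w y * moll e (x - y) - w x * moll e (x - y)).
  rewrite RintegralB//; last exact: integrable_RZ.
  by rewrite RintegralZl// Rintegral_moll// mulr1.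
have e2 : eta = \int[mu]_y (eta * moll e (x - y)).
  by rewrite RintegralZl// Rintegral_moll// mulr1.
rewrite e1 [leRHS]e2; apply: Rintegral_dominated.
- have := integrable_RB ic (integrable_RZ (w x) im).
  by case/integrableP => /measurable_EFinP.
- exact: integrable_RZ.
- move=> y; rewrite -mulrBl normrM (ger0_norm (moll_ge0 _ e0)).
  have [xy|xy] := pselect (ball (0 : E) e (x - y)); last first.
    by rewrite moll_support// !mulr0.
  apply: ler_wpM2r; first exact: moll_ge0.
  by rewrite distrC; apply: h; move: xy; rewrite -ball_normE/= sub0r normrN.
Qed.

Lemma near_mollification_error (p r kappa : R) (S : E -> R) (F z : 'I_n -> E -> R) :
  1 < p -> 0 < kappa -> measurable_fun setT (S : T -> R) ->
  (forall i, measurable_fun setT (F i : T -> R)) ->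
  (forall i, measurable_fun setT (z i : T -> R)) ->
  (forall x, 0 <= S x) -> mu.-integrable setT (EFin \o (fun x => S x `^ p)) ->
  (forall i x, `|F i x| <= S x `^ (p - 1)) -> (forall i x, `|F i x| <= S x `^ p) ->
  (forall i, mu.-integrable setT (EFin \o (fun x => `|z i x| `^ p))) ->
  (forall i x, ~ ball 0 r x -> z i x = 0) ->
  \forall e \near 0^'+, forall i : 'I_n,
    (\int[mu]_x (`|F i x| * `|conv (z i) (moll e) x - z i x|)%:E <= kappa%:E)%E.
Proof.
move=> p1 kap0 mS mF mz S0 iS F1 F2 iz zr; apply: filter_forall => i.
have [e0 e00 h] := mollification_error p1 kap0 mS (mF i) (mz i) S0 iS (F1 i) (F2 i) (iz i) (zr i).
near=> e; apply: h; last by near: e; exact: nbhs_right_lt.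
by near: e; exact: nbhs_right_gt.
Unshelve. all: by end_near. Qed.

(** Where the bump is nonzero the convolution exceeds [dl], so [w >= dl / 4]; this closed condition
    survives the closure in the definition of the support. *)
Lemma bump_conv_test w (e dl : R) : 0 < e -> 0 < dl -> continuous w ->
  compact (support_closure w) ->
  (forall x, `|conv w (moll e) x - w x| <= dl / 4) ->
  test_function [set x | 0 < w x] (fun x => bump (conv w (moll e) x - dl)).
Proof.
move=> e0 dl0 cw cK cl.
have iw := continuous_compact_integrable_rV cw cK.
have sub : support_closure (fun x => bump (conv w (moll e) x - dl)) `<=` [set x | dl / 4 <= w x].
  rewrite /support_closure closureE; apply: smallest_sub.
    rewrite (_ : mkset _ = w @^-1` [set t | dl / 4 <= t])//.
    by apply: preimage_closed => [x _|]; [exact: cw|exact: closed_ge].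
  move=> x /= hx; have : 0 < conv w (moll e) x - dl.
    by rewrite ltNge; apply/negP => /bump_eq0 h; rewrite h eqxx in hx.
  by move: (cl x); rewrite ler_norml => /andP[_]; lra.
split.
- move=> k; apply: (@Ck_comp _ _ k setT bump (conv w (moll e) + cst (- dl))).
  + exact: openT.
  + exact: Ck1_flat_exp.
  + apply: Ck_add; [exact: openT| |apply: Ck_cst; exact: openT].
    by apply: conv_Ck => //; [exact: Ck_moll|exact: compact_moll].
- apply: subclosed_compact cK _; first exact: closed_closure.
  move=> x /sub /= wx; apply: subset_closure => /=; lra.
- by move=> x /sub /= wx; lra.
Qed.

Lemma partial_bump_conv w (e dl : R) i x : 0 < e -> mu.-integrable setT (EFin \o w) ->
  partial i (fun x => bump (conv w (moll e) x - dl)) x =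
  dbump (conv w (moll e) x - dl) * conv w (partial i (moll e)) x.
Proof.
move=> e0 iw.
have d1 : is_derive x (delta_mx ord0 i : E) (fun x => conv w (moll e) x - dl)
    (conv w (partial i (moll e)) x).
  rewrite -[X in is_derive _ _ _ X]subr0; apply: is_deriveB.
  by apply: conv_is_derive => //; [exact: Ck_moll|exact: compact_moll].
by case: (is_derive_comp (is_derive_bump _) d1).
Qed.

(* The test function is [bump (w * moll e - dl)] with [dl = w x0 / 4]: on its support
   the gradient of [w * moll e] is the mollified [z], and [F.z >= 0]. *)
Lemma weak_max_principle (p m : R) w (S : E -> R) (F z : 'I_n -> E -> R) :
  1 < p -> 0 < m -> continuous w -> (forall x, 0 <= w x) -> compact (support_closure w) ->
  measurable_fun setT (S : T -> R) ->
  (forall i, measurable_fun setT (F i : T -> R)) ->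
  (forall i, measurable_fun setT (z i : T -> R)) ->
  (forall x, 0 <= S x) -> mu.-integrable setT (EFin \o (fun x => S x `^ p)) ->
  (forall i x, `|F i x| <= S x `^ (p - 1)) -> (forall i x, `|F i x| <= S x `^ p) ->
  (forall i, mu.-integrable setT (EFin \o (fun x => `|z i x| `^ p))) ->
  (forall i x, w x = 0 -> z i x = 0) ->
  (forall x, 0 <= \sum_(i < n) F i x * z i x) ->
  (forall i psi, test_function [set x | 0 < w x] psi ->
    \int[mu]_y (w y * partial i psi y) = - \int[mu]_y (z i y * psi y)) ->
  (forall psi, test_function [set x | 0 < w x] psi -> (forall x, 0 <= psi x) ->
    \int[mu]_y (\sum_(i < n) F i y * partial i psi y) <= - (m * \int[mu]_y psi y)) ->
  forall x, w x = 0.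
Proof.
move=> p1 m0 cw w0 cK mS mF mz S0 iS F1 F2 iz zw Fz H1 H2 x0.
apply/eqP; rewrite -[_ == _]negbK; apply/negP => wx0.
have {}wx0 : 0 < w x0 by rewrite lt_def wx0 w0.
(* On the [r]-cube about [x0], [w] and its mollification differ from [w x0] by at most [dl / 2] in
   all, so the argument of the bump stays above [dl]. *)
pose dl := w x0 / 4; have dl0 : 0 < dl by rewrite divr_gt0.
have dl4 : 0 < dl / 4 by rewrite divr_gt0.
have [r r0 hr] := compact_support_uniform cw cK dl4.
have [rr _ wr] := compact_support_ball cK.
have iw := continuous_compact_integrable_rV cw cK.
have [C C0 hC] := @dbump_bounded R.
(* A lower bound for [m] times the integral of the test function, independent of [e]. The choice of
   [kap] keeps the total mollification error [C * n * kap] below [B / 2]. *)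
pose B := m * (bump dl * (r *+ 2) ^+ n).
have B0 : 0 < B by rewrite mulr_gt0// mulr_gt0 ?bump_gt0// exprn_gt0// pmulrn_lgt0.
pose kap := B / 2 / (C * n%:R + 1).
have Cn0 : 0 < C * n%:R + 1 by rewrite ltr_wpDl// mulr_ge0.
have kap0 : 0 < kap by rewrite !divr_gt0.
have zr i x : ~ ball 0 rr x -> z i x = 0 by move=> /wr /zw.
have nme := near_mollification_error p1 kap0 mS mF mz S0 iS F1 F2 iz zr.
have [e [e0 er he]] : exists e : R, [/\ 0 < e, e < r & forall i : 'I_n,
    (\int[mu]_x (`|F i x| * `|conv (z i) (moll e) x - z i x|)%:E <= kap%:E)%E].
  near (0 : R)^'+ => e; exists e; split; near: e; [exact: nbhs_right_gt|exact: nbhs_right_lt|exact: nme].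
have iz1 i := integrable_of_powR p1 (mz i) (iz i) (zr i).
have cl x : `|conv w (moll e) x - w x| <= dl / 4.
  apply: conv_moll_close => // y xy; apply/ltW/hr; exact: lt_trans xy er.
have tf := bump_conv_test e0 dl0 cw cK cl.
pose psi x := bump (conv w (moll e) x - dl).
(* At such a point [w > dl / 2] on the whole closed cube of radius [e], so the weak gradient, known
   only where [w > 0], may be mollified there. *)
have {H1}Hz i x : dl < conv w (moll e) x ->
    conv w (partial i (moll e)) x = conv (z i) (moll e) x.
  move=> wx; apply: (conv_partial_weak e0 iw (iz1 i) (H1 i)) => y yx /=.
  have : `|y - x| < r by exact: le_lt_trans er.
  move/hr; rewrite ltr_norml => /andP[+ _].
  by move: (cl x); rewrite ler_norml => /andP[_]; lra.
pose H i x := `|F i x| * `|conv (z i) (moll e) x - z i x|.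
have mH i : measurable_fun setT (H i : T -> R).
  apply: (measurable_norm_mul_dist (mF i) _ (mz i)).
  apply: continuous_cara_measurable.
  exact: (conv_continuous (iz1 i) (@continuous_moll R n e) (compact_moll e0)).
have H0 i x : 0 <= H i x by rewrite mulr_ge0.
have hH i := integrable_ge0_le (mH i) (H0 i) (he i).
have iF i : mu.-integrable setT (EFin \o F i).
  exact: (integrable_dominated (mF i) iS (F2 i)).
have cpsi : continuous psi by case: tf => tf _ _ x; exact: (Ck_cont (tf 0)).
have Kpsi : compact (support_closure psi) by case: tf.
have ipsi := continuous_compact_integrable_rV cpsi Kpsi.
have cdpsi i : continuous (partial i psi).
  by case: tf => tf _ _ x; exact: (Ck_cont (Ck_partial i (tf 1))).
have Kdpsi i : compact (support_closure (partial i psi)).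
  apply: subclosed_compact Kpsi (@support_closure_partial _ _ _ i); exact: closed_closure.
have iG i : mu.-integrable setT (EFin \o (fun x => F i x * partial i psi x)).
  have [M _ hM] := continuous_compact_bounded (cdpsi i) (Kdpsi i).
  exact: (integrable_mul_bounded (iF i) (continuous_cara_measurable (cdpsi i)) hM).
have pw x : - C * (\sum_(i < n) H i x) <= \sum_(i < n) F i x * partial i psi x.
  have [wx|wx] := ltP dl (conv w (moll e) x); last first.
    rewrite [leRHS]big1 => [|i _].
      by rewrite mulNr oppr_le0 mulr_ge0// sumr_ge0.
    by rewrite partial_bump_conv// dbump_eq0 ?subr_le0// mul0r mulr0.
  have -> : \sum_(i < n) F i x * partial i psi x = dbump (conv w (moll e) x - dl) *
      (\sum_(i < n) F i x * z i x) + dbump (conv w (moll e) x - dl) *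
      \sum_(i < n) F i x * (conv (z i) (moll e) x - z i x).
    rewrite -mulrDr -big_split mulr_sumr; apply: eq_bigr => i _ /=.
    by rewrite partial_bump_conv// Hz//; ring.
  apply: ler_wpDl; first by rewrite mulr_ge0// dbump_ge0.
  apply: (@le_trans _ _ (- (dbump (conv w (moll e) x - dl) * \sum_(i < n) H i x))).
    by rewrite mulNr lerN2 ler_wpM2r// sumr_ge0.
  rewrite -mulrN ler_wpM2l ?dbump_ge0// -sumrN; apply: ler_sum => i _.
  by rewrite /H -normrM; exact: lerNnormlW.
have low : - C * (\sum_(i < n) kap) <= \int[mu]_x (\sum_(i < n) F i x * partial i psi x).
  apply: (@le_trans _ _ (\int[mu]_x (- C * (\sum_(i < n) H i x)))).
    rewrite RintegralZl//; last by apply: integrable_Rsum => i; exact: (hH i).1.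
    rewrite (Rintegral_sum _ (fun i => (hH i).1)) !mulNr lerN2 ler_wpM2l//.
    by apply: ler_sum => i _; exact: (hH i).2.
  apply: le_Rintegral => //.
    by apply: integrable_RZ; apply: integrable_Rsum => i; exact: (hH i).1.
  exact: integrable_Rsum.
have psi0 x : 0 <= psi x by exact: bump_ge0.
have up := le_trans low (H2 _ tf psi0).
have big : bump dl * (r *+ 2) ^+ n <= \int[mu]_x psi x.
  apply: (Rintegral_ge_ball (c := x0)) => //; first exact: bump_ge0.
  move=> x xr; apply: bump_le => //.
  have : `|x0 - x| < r by move: xr; rewrite -ball_normE.
  move/hr; rewrite ltr_norml => /andP[_].
  by move: (cl x); rewrite ler_norml => /andP[+ _]; rewrite /dl; lra.
have h1 : m * \int[mu]_x psi x <= C * (\sum_(i < n) kap).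
  by move: up; rewrite mulNr lerN2.
have h2 : B <= m * \int[mu]_x psi x by rewrite ler_pM2l.
have h3 : C * (\sum_(i < n) kap) <= B / 2.
  rewrite sumr_const card_ord -[X in C * X]mulr_natr /kap.
  rewrite (_ : C * _ = B / 2 * (C * n%:R / (C * n%:R + 1))); last by field; rewrite gt_eqF.
  have k1 : C * n%:R / (C * n%:R + 1) <= 1 by rewrite ler_pdivrMr// mul1r lerDl.
  have k2 : 0 <= B / 2 by rewrite divr_ge0// ltW.
  exact: (ler_piMr k2 k1).
by have := le_trans h2 (le_trans h1 h3); rewrite leNgt ltr_pdivrMr// ltr_pMr// ltr1n.
Unshelve. all: by end_near. Qed.
End weak_max_principle.

(** * The p-Laplacian of a function of class C^2 *)

Section positive_power.
Context {R : realType}.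
Implicit Types q t : R.

(** Extended by 0 to negative [t], the power is differentiable at 0 for [q > 1], so [|D phi|^(p-2)]
    can be differentiated at critical points of [phi]. *)
Definition pos_pow q t := Num.max 0 t `^ q.

Lemma pos_pow_ge0 q t : 0 <= pos_pow q t.
Proof. exact: powR_ge0. Qed.

Lemma pos_powE q t : 0 <= t -> pos_pow q t = t `^ q.
Proof. by move=> t0; rewrite /pos_pow max_r. Qed.

Lemma pos_pow_eq0 q t : 0 < q -> t <= 0 -> pos_pow q t = 0.
Proof. by move=> q0 t0; rewrite /pos_pow max_l// powR0// gt_eqF. Qed.

Lemma is_derive_pos_pow q t : 1 < q -> is_derive t (1 : R) (pos_pow q) (q * pos_pow (q - 1) t).
Proof.
move=> q1; have q0 : 0 < q by lra.
have q10 : 0 < q - 1 by lra.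
have [t0|t0|->] := ltgtP t 0.
- rewrite pos_pow_eq0 ?ltW// mulr0.
  apply: (@near_eq_is_derive _ _ _ (cst 0)).
  near=> s; rewrite pos_pow_eq0// ltW//; near: s; exact: lt_nbhsl.
- rewrite pos_powE ?ltW//.
  apply: (@near_eq_is_derive _ _ _ (fun s => s `^ q)).
    near=> s; rewrite pos_powE// ltW//; near: s; exact: lt_nbhsr.
  exact: is_derive1_powR.
- rewrite pos_pow_eq0// mulr0; apply: is_derive_uniform => e e0.
  (* For [0 < h <= e^(1/(q-1))] one has [h^q = h^(q-1) h <= e h]. *)
  exists (e `^ (q - 1)^-1); first exact: powR_gt0.
  move=> h hr; rewrite [h *: _]mulr1 addr0 (pos_pow_eq0 q0 (lexx 0)) subr0 mulr0 subr0.
  rewrite ger0_norm ?pos_pow_ge0//.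
  have [h0|h0] := leP h 0; first by rewrite pos_pow_eq0// mulr_ge0// ltW.
  rewrite (pos_powE _ (ltW h0)) (ger0_norm (ltW h0)) -(mulr_powRB1 (ltW h0) q0) mulrC.
  rewrite ler_pM2r//.
  have -> : e = (e `^ (q - 1)^-1) `^ (q - 1).
    by rewrite -powRrM mulVf ?gt_eqF// powRr1// ltW.
  apply: (ge0_ler_powR (ltW q10)); rewrite ?nnegrE ?powR_ge0//; first exact: ltW.
  by apply/ltW; rewrite -(ger0_norm (ltW h0)).
Unshelve. all: by end_near. Qed.

(** Continuity of the derivative comes from differentiability of [pos_pow (q - 1)], which asks for
    [q - 1 > 1]; for [q = (p - 2) / 2] this is the condition [6 < p] of the comparison principle. *)
Lemma Ck1_pos_pow q : 2 < q -> Ck1 1 (pos_pow q).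
Proof.
move=> q2; split; first by apply: continuous_is_derive => t; apply: is_derive_pos_pow; lra.
exists (fun t => q * pos_pow (q - 1) t); first by move=> t; apply: is_derive_pos_pow; lra.
split=> // t; apply: continuousM; first exact: cst_continuous.
by apply: continuous_is_derive => s; apply: is_derive_pos_pow; lra.
Qed.
End positive_power.

Section p_laplacian.
Context {R : realType} {n : nat}.
Local Notation E := 'rV[R]_n.
Local Notation e_ i := (delta_mx ord0 i : E).
Local Notation mu := (lebesgue_rV R n).
Implicit Types (phi psi : E -> R) (A : set E) (x : E) (q : R).

(** For [q = (p - 2) / 2] this is a component of [|v|^(p-2) v], written with the squared norm to
    avoid the square root. *)
Definition flux q (v : E) (i : 'I_n) : R := pos_pow q (dotmul v v) * v ord0 i.

Definition laplacian phi x := \sum_(i < n) partial i (partial i phi) x.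

(* With [q = (p - 2) / 2] this is the p-Laplacian of [phi] in nondivergence form. *)
Definition p_laplacian q phi x := pos_pow (q - 1) (dotmul (gradient phi x) (gradient phi x)) *
  (2 * q * infinity_laplacian phi x +
   dotmul (gradient phi x) (gradient phi x) * laplacian phi x).

Lemma enorm_pow p (v : E) : enorm v `^ (p - 2) = pos_pow ((p - 2) / 2) (dotmul v v).
Proof.
rewrite pos_powE ?dotmul_ge0// mulrC powRrM /enorm powR12_sqrt//; exact: dotmul_ge0.
Qed.

Lemma dotmul_gradientE phi x : dotmul (gradient phi x) (gradient phi x) =
  \sum_(i < n) partial i phi x * partial i phi x.
Proof. by apply: eq_bigr => i _; rewrite !mxE. Qed.

Lemma Ck_grad_sqr k A phi : open A -> Ck k.+1 A phi ->
  Ck k A (fun x => dotmul (gradient phi x) (gradient phi x)).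
Proof.
move=> oA hphi; rewrite (_ : (fun x => _) =
  (fun x => \sum_(i < n) (partial i phi * partial i phi) x)); last first.
  by apply/funext => x; rewrite dotmul_gradientE.
by apply: Ck_sum => // i; apply: Ck_mul => //; exact: Ck_partial.
Qed.

Lemma Ck_laplacian k A phi : open A -> Ck k.+2 A phi -> Ck k A (laplacian phi).
Proof. by move=> oA hphi; apply: Ck_sum => // i; do 2 apply: Ck_partial. Qed.

Lemma Ck_infinity_laplacian A phi : open A -> Ck 2 A phi -> Ck 0 A (infinity_laplacian phi).
Proof.
move=> oA hphi; apply: Ck_sum => // i; apply: Ck_sum => // j.
have h1 l : Ck 0 A (partial l phi) by apply: Ck_leS; exact: Ck_partial.
by apply: (@Ck_mul _ _ 0 A (partial j (partial i phi) * partial i phi) (partial j phi)) => //;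
  apply: Ck_mul => //; do 2 apply: Ck_partial.
Qed.

Lemma Ck_flux q A phi i : 2 < q -> open A -> Ck 2 A phi ->
  Ck 1 A (fun x => flux q (gradient phi x) i).
Proof.
move=> q2 oA hphi; rewrite (_ : (fun x => _) =
  (pos_pow q \o fun x => dotmul (gradient phi x) (gradient phi x)) * partial i phi); last first.
  by apply/funext => x; rewrite /flux mxE.
apply: Ck_mul => //; last exact: Ck_partial.
by apply: Ck_comp => //; [exact: Ck1_pos_pow|exact: Ck_grad_sqr].
Qed.

Lemma is_derive_grad_sqr A phi j x : Ck 2 A phi -> A x ->
  is_derive x (e_ j) (fun x => dotmul (gradient phi x) (gradient phi x))
    (2 * \sum_(i < n) partial i phi x * partial j (partial i phi) x).
Proof.
move=> hphi Ax.
have d i : is_derive x (e_ j) (partial i phi * partial i phi)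
    (2 * (partial i phi x * partial j (partial i phi) x)).
  have di : is_derive x (e_ j) (partial i phi) (partial j (partial i phi) x).
    exact: (Ck_is_derive j (Ck_partial i hphi) Ax).
  apply: (is_derive_eq (is_deriveM di di)).
  by rewrite /GRing.scale/= mulrDl !mul1r.
have := is_derive_sum d.
rewrite -mulr_sumr; congr is_derive; apply/funext => y.
by rewrite fct_sumE dotmul_gradientE.
Qed.

Lemma partial_flux q A phi i x : 1 < q -> Ck 2 A phi -> A x ->
  partial i (fun x => flux q (gradient phi x) i) x =
  q * pos_pow (q - 1) (dotmul (gradient phi x) (gradient phi x)) *
    (2 * \sum_(j < n) partial j phi x * partial i (partial j phi) x) * partial i phi x +
  pos_pow q (dotmul (gradient phi x) (gradient phi x)) * partial i (partial i phi) x.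
Proof.
move=> q1 hphi Ax.
pose s y := dotmul (gradient phi y) (gradient phi y).
have d1 := is_derive_comp (f := s) (is_derive_pos_pow (s x) q1) (is_derive_grad_sqr i hphi Ax).
have d2 : is_derive x (e_ i) (partial i phi) (partial i (partial i phi) x).
  exact: (Ck_is_derive i (Ck_partial i hphi) Ax).
have -> : (fun x => flux q (gradient phi x) i) = (pos_pow q \o s) * partial i phi.
  by apply/funext => y; rewrite /flux mxE.
suff : is_derive x (e_ i) ((pos_pow q \o s) * partial i phi)
  (q * pos_pow (q - 1) (s x) * (2 * \sum_(j < n) partial j phi x * partial i (partial j phi) x) *
   partial i phi x + pos_pow q (s x) * partial i (partial i phi) x) by case.
apply: (is_derive_eq (is_deriveM d1 d2)).
by rewrite /GRing.scale/= addrC [partial i phi x * _]mulrC.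
Qed.

Lemma sum_partial_flux q A phi x : 1 < q -> Ck 2 A phi -> A x ->
  \sum_(i < n) partial i (fun x => flux q (gradient phi x) i) x = p_laplacian q phi x.
Proof.
move=> q1 hphi Ax; rewrite /p_laplacian.
under eq_bigr do rewrite (partial_flux _ q1 hphi Ax).
set s := dotmul _ _.
have -> : pos_pow q s = pos_pow (q - 1) s * s.
  by rewrite !pos_powE ?dotmul_ge0// mulrC mulr_powRB1 ?dotmul_ge0//; lra.
rewrite big_split /= mulrDr; congr (_ + _); last first.
  by rewrite -mulr_sumr -mulrA.
(* The flux produces [partial i (partial j phi)] and [infinity_laplacian] has
   [partial j (partial i phi)]; exchanging the sums matches the indices. *)
rewrite /infinity_laplacian exchange_big/= mulrA mulr_sumr.
apply: eq_bigr => i _; rewrite !mulr_sumr mulr_suml; apply: eq_bigr => j _.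
by ring.
Qed.

Lemma p_laplacian_parts q A phi psi : 2 < q -> open A -> Ck 2 A phi -> test_function A psi ->
  [/\ forall i, mu.-integrable setT (EFin \o (fun x => flux q (gradient phi x) i * partial i psi x)),
      mu.-integrable setT (EFin \o (fun x => p_laplacian q phi x * psi x)) &
      \int[mu]_x (\sum_(i < n) flux q (gradient phi x) i * partial i psi x) =
      - \int[mu]_x (p_laplacian q phi x * psi x)].
Proof.
move=> q2 oA hphi [Cpsi Kpsi Apsi].
have P i := integration_by_parts i oA (Ck_flux i q2 oA hphi) (Cpsi 1) Kpsi Apsi.
pose f i x := partial i (fun x => flux q (gradient phi x) i) x * psi x.
have i1 i : mu.-integrable setT (EFin \o (fun x => flux q (gradient phi x) i * partial i psi x)).
  by case: (P i).
have i2 i : mu.-integrable setT (EFin \o f i) by case: (P i).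
have eN : (fun x => p_laplacian q phi x * psi x) = (fun x => \sum_(i < n) f i x).
  apply/funext => x; have [Ax|Ax] := pselect (A x).
    by rewrite -(sum_partial_flux _ hphi Ax) ?mulr_suml//; lra.
  have psi0 : psi x = 0.
    by apply: contrapT => h; apply: Ax; apply: Apsi; apply: subset_closure; exact/eqP.
  by rewrite psi0 mulr0 big1// => i _; rewrite /f psi0 mulr0.
split => //.
  by rewrite eN; exact: integrable_Rsum.
rewrite Rintegral_sum// eN Rintegral_sum// -sumrN; apply: eq_bigr => i _.
by case: (P i).
Qed.

(** With weights [al] and [be] the sum equals [(al + be)/2 |a - b|^2 + (al - be)/2 (|a|^2 - |b|^2)];
    in the last product both factors have the same sign. *)
Lemma flux_monotone q (a b : E) : 0 < q ->
  0 <= \sum_(i < n) (flux q a i - flux q b i) * (a ord0 i - b ord0 i).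
Proof.
move=> q0; set al := pos_pow q (dotmul a a); set be := pos_pow q (dotmul b b).
have eab : dotmul a a - dotmul b b = \sum_(i < n) (a ord0 i * a ord0 i - b ord0 i * b ord0 i).
  by rewrite sumrB.
have -> : \sum_(i < n) (flux q a i - flux q b i) * (a ord0 i - b ord0 i) =
    (al + be) / 2 * dotmul (a - b) (a - b) + (al - be) / 2 * (dotmul a a - dotmul b b).
  rewrite eab !mulr_sumr -big_split/=.
  by apply: eq_bigr => i _; rewrite /flux -/al -/be !mxE; field.
apply: addr_ge0.
  by rewrite mulr_ge0 ?dotmul_ge0// divr_ge0// addr_ge0// pos_pow_ge0.
rewrite mulrAC; apply: divr_ge0 => //.
wlog ab : a b @al @be {eab} / dotmul a a <= dotmul b b => [h|].
  have [ab|/ltW ba] := leP (dotmul a a) (dotmul b b); first exact: h.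
  by rewrite -mulrNN !opprB; exact: h.
apply: mulr_le0; rewrite subr_le0// /al /be !pos_powE ?dotmul_ge0//.
by apply: (ge0_ler_powR (ltW q0)); rewrite ?nnegrE ?dotmul_ge0.
Qed.

Lemma enorm_le_sum (v : E) : enorm v <= \sum_(i < n) `|v ord0 i|.
Proof.
have s0 : 0 <= \sum_(i < n) `|v ord0 i| by exact: sumr_ge0.
rewrite /enorm -(ler_pXn2r (n := 2))// ?nnegrE ?sqrtr_ge0// sqr_sqrtr ?dotmul_ge0//.
rewrite expr2 mulr_suml; apply: ler_sum => i _.
apply: le_trans (ler_norm _) _; rewrite normrM; apply: ler_wpM2l => //.
by rewrite (bigD1 i)//= lerDl sumr_ge0.
Qed.

Lemma flux_bound p (v : E) i (t : R) : 2 < p -> \sum_(j < n) `|v ord0 j| <= t ->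
  `|flux ((p - 2) / 2) v i| <= t `^ (p - 1).
Proof.
move=> p2 vt; have t0 : 0 <= t by apply: le_trans vt; exact: sumr_ge0.
have nt : enorm v <= t by exact: le_trans (enorm_le_sum v) vt.
have vi : `|v ord0 i| <= t.
  by apply: le_trans vt; rewrite (bigD1 i)//= lerDl sumr_ge0.
rewrite /flux -enorm_pow normrM (ger0_norm (powR_ge0 _ _)).
rewrite -(mulr_powRB1 t0 (_ : 0 < p - 1)) ?subr_gt0; last by lra.
rewrite mulrC (_ : p - 1 - 1 = p - 2); last by ring.
apply: ler_pM => //; first exact: powR_ge0.
by apply: ge0_ler_powR; rewrite ?nnegrE ?sqrtr_ge0//; lra.
Qed.
End p_laplacian.

(** * Comparison principle *)

Section integrable_powers.
Context {R : realType} d (T : measurableType d) (mu : {measure set T -> \bar R}).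
Variable p : R.
Hypothesis p0 : 0 <= p.

Lemma integrable_powRD (f g : T -> R) : measurable_fun setT f -> measurable_fun setT g ->
  (forall x, 0 <= f x) -> (forall x, 0 <= g x) ->
  mu.-integrable setT (EFin \o (fun x => f x `^ p)) ->
  mu.-integrable setT (EFin \o (fun x => g x `^ p)) ->
  mu.-integrable setT (EFin \o (fun x => (f x + g x) `^ p)).
Proof.
move=> mf mg f0 g0 if_ ig.
apply: (integrable_dominated _ (integrable_RZ (2 `^ p) (integrable_RD if_ ig))) => [|x].
  by apply: measurable_powR_fun; exact: measurable_funD.
by rewrite ger0_norm ?powR_ge0// powRD_le.
Qed.

Lemma integrable_powR_sum (I : Type) (r : seq I) (f : I -> T -> R) :
  p != 0 -> (forall i, measurable_fun setT (f i)) ->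
  (forall i x, 0 <= f i x) ->
  (forall i, mu.-integrable setT (EFin \o (fun x => f i x `^ p))) ->
  mu.-integrable setT (EFin \o (fun x => (\sum_(i <- r) f i x) `^ p)).
Proof.
move=> pn0 mf f0 if_; elim: r => [|i r IH].
  by under eq_fun do rewrite /= big_nil powR0//; exact: integrable0.
under eq_fun do rewrite /= big_cons; apply: integrable_powRD => //.
- exact: measurable_sum.
- by move=> x; exact: sumr_ge0.
Qed.

Lemma integrable_powRZ (k : R) (f : T -> R) : 0 <= k -> (forall x, 0 <= f x) ->
  mu.-integrable setT (EFin \o (fun x => f x `^ p)) ->
  mu.-integrable setT (EFin \o (fun x => (k * f x) `^ p)).
Proof. by move=> k0 f0 if_; under eq_fun do rewrite /= powRM//; exact: integrable_RZ. Qed.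

Lemma integrable_powR_le (f g : T -> R) : measurable_fun setT f -> (forall x, 0 <= f x) ->
  (forall x, f x <= g x) -> mu.-integrable setT (EFin \o (fun x => g x `^ p)) ->
  mu.-integrable setT (EFin \o (fun x => f x `^ p)).
Proof.
move=> mf f0 fg ig; apply: (integrable_dominated _ ig) => [|x].
  exact: measurable_powR_fun.
rewrite ger0_norm ?powR_ge0//; apply: ge0_ler_powR; rewrite ?nnegrE//.
exact: le_trans (fg x).
Qed.

Lemma integrable_powR_norm_le (f g : T -> R) : measurable_fun setT f ->
  (forall x, `|f x| <= g x) -> mu.-integrable setT (EFin \o (fun x => g x `^ p)) ->
  mu.-integrable setT (EFin \o (fun x => `|f x| `^ p)).
Proof. by move=> mf; apply: integrable_powR_le => //; exact: measurableT_comp. Qed.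
End integrable_powers.

Section power_dominator.
Context {R : realType} d (T : measurableType d) (mu : {measure set T -> \bar R}) (n : nat).
Variables (p q B s : R) (V : set T) (a b : 'I_n -> T -> R).
Hypotheses (p1 : 1 < p) (ma : forall i, measurable_fun setT (a i)).
Hypothesis mb : forall i, measurable_fun setT (b i).

Lemma measurable_scaled_diff (f g : T -> R) : measurable_fun setT f -> measurable_fun setT g ->
  measurable_fun setT (fun x => s * (f x - g x)).
Proof.
by move=> mf mg; apply: measurable_funM; [exact: measurable_cst|exact: measurable_funB].
Qed.

Lemma measurable_flux (f : 'I_n -> T -> R) i : (forall i, measurable_fun setT (f i)) ->
  measurable_fun setT (fun x => flux q (\row_j f j x) i).
Proof.
move=> mf; rewrite (_ : (fun x => _) =
  (fun x => Num.max 0 (\sum_(j < n) f j x * f j x) `^ q * f i x)); last first.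
  apply/funext => x; rewrite /flux /dotmul mxE; congr (pos_pow _ _ * _).
  by apply: eq_bigr => j _; rewrite !mxE.
apply: measurable_funM => //; apply: measurable_powR_fun.
apply: measurable_maxr; first exact: measurable_cst.
by apply: measurable_sum => j; exact: measurable_funM.
Qed.

Lemma measurable_flux_diff i : measurable_fun setT
  (fun x => s * (flux q (\row_j a j x) i - flux q (\row_j b j x) i)).
Proof. by apply: measurable_scaled_diff; exact: measurable_flux. Qed.

(** The dominator [S] of the comparison principle will be [2 t]: a difference of two fluxes is
    bounded by twice [t^(p-1)], and [1 <= t] turns a bound by [S^(p-1)] into one by [S^p]. *)
Lemma power_dominator : 0 <= B -> measurable V -> mu.-integrable setT (EFin \o (\1_V : T -> R)) ->
  (forall i, mu.-integrable setT (EFin \o (fun x => `|a i x| `^ p))) ->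
  exists t : T -> R, [/\ measurable_fun setT t, forall x, 0 <= t x,
    mu.-integrable setT (EFin \o (fun x => (2 * t x) `^ p)) &
    forall x, V x ->
      [/\ 1 <= t x, \sum_(i < n) `|a i x| <= t x & \sum_(i < n) B <= t x]].
Proof.
move=> B0 mV iV ia; have p0 : 0 < p := lt_trans ltr01 p1.
pose k := 1 + \sum_(i < n) B.
have k1 : 1 <= k by rewrite lerDl sumr_ge0.
have k0 : 0 <= k := le_trans ler01 k1.
pose f1 (x : T) : R := k * \1_V x.
have mf1 : measurable_fun setT f1.
  by apply: measurable_funM; [exact: measurable_cst|exact: measurable_indic].
have f10 x : 0 <= f1 x by rewrite mulr_ge0.
have if1 : mu.-integrable setT (EFin \o (fun x => f1 x `^ p)).
  rewrite (_ : (fun x => _) = (fun x => k `^ p * \1_V x)); first exact: integrable_RZ.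
  apply/funext => x; rewrite /f1 powRM// indicE.
  by case: (x \in V); rewrite ?powR1// powR0// gt_eqF.
have mna i : measurable_fun setT (fun x => `|a i x|) by exact: measurableT_comp.
have ms : measurable_fun setT (fun x => \sum_(i < n) `|a i x|) by exact: measurable_sum.
have s0 x : 0 <= \sum_(i < n) `|a i x| by exact: sumr_ge0.
exists (fun x => f1 x + \sum_(i < n) `|a i x|); split.
- exact: measurable_funD.
- by move=> x; rewrite addr_ge0.
- apply: integrable_powRZ => // [x|]; first by rewrite addr_ge0.
  apply: (integrable_powRD (ltW p0)) => //.
  apply: integrable_powR_sum => //; [exact: ltW|by rewrite gt_eqF].
- move=> x Vx; rewrite /f1 indicE mem_set// mulr1; split.
  + exact: ler_wpDr.
  + by rewrite lerDr.
  + by rewrite /k -addrA; apply: ler_wpDl => //; exact: ler_wpDr.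
Qed.

Lemma integrable_powR_restrict (A : set T) (f : T -> R) : V `<=` A ->
  measurable_fun setT (f \_ V) ->
  mu.-integrable setT (EFin \o (fun x => `|(f \_ A) x| `^ p)) ->
  mu.-integrable setT (EFin \o (fun x => `|(f \_ V) x| `^ p)).
Proof.
move=> VA mf; apply: (integrable_powR_le (ltW (lt_trans ltr01 p1))) => //.
  exact: measurableT_comp.
move=> x; rewrite !patchE; case: ifPn => Vx; last by rewrite normr0.
by rewrite mem_set//; apply: VA; move: Vx; rewrite inE.
Qed.
End power_dominator.

Section restrictions.
Context {R : realType} d (T : measurableType d).

Lemma measurable_restrict_subset (A V : set T) (f : T -> R) :
  measurable A -> measurable V -> V `<=` A -> measurable_fun A f ->
  measurable_fun setT (f \_ V).
Proof.
move=> mA mV VA mf; apply/(measurable_restrictT _ mV); exact: measurable_funS mf.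
Qed.

End restrictions.

Section comparison.
Context {R : realType} {n : nat}.
Local Notation E := 'rV[R]_n.
Local Notation T := (lebesgue_rVType R n).
Local Notation mu := (lebesgue_rV R n).
Implicit Types (phi psi u g w : E -> R) (A V : set E) (x : E).

Lemma test_function_sub A B psi : A `<=` B -> test_function A psi -> test_function B psi.
Proof. by move=> AB [? ? h]; split => //; exact: subset_trans AB. Qed.

Lemma test_function_eq0 A psi x : test_function A psi -> ~ A x -> psi x = 0.
Proof.
move=> [_ _ h] Ax; apply: contrapT => px; apply: Ax; apply: h.
by apply: subset_closure; exact/eqP.
Qed.

Lemma partial_test_function_eq0 A psi i x : test_function A psi -> ~ A x -> partial i psi x = 0.
Proof.
move=> [_ _ h] Ax; apply: contrapT => px; apply: Ax; apply: h.
by apply: (support_closure_partial (i := i)); apply: subset_closure; exact/eqP.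
Qed.

Lemma test_function_integrable A psi : test_function A psi ->
  mu.-integrable setT (EFin \o psi) /\
  forall i, mu.-integrable setT (EFin \o partial i psi).
Proof.
move=> [C K _]; split=> [|i].
  by apply: continuous_compact_integrable_rV K => x; exact: (Ck_cont (C 0)).
apply: continuous_compact_integrable_rV.
  by move=> x; exact: (Ck_cont (Ck_partial i (C 1))).
by apply: subclosed_compact K (@support_closure_partial _ _ _ i); exact: closed_closure.
Qed.

Lemma test_function_bounded A psi : test_function A psi ->
  [/\ measurable_fun setT (psi : T -> R), exists M, forall x, `|psi x| <= M &
  forall i, measurable_fun setT (partial i psi : T -> R) /\
    exists M, forall x, `|partial i psi x| <= M].
Proof.
move=> tf; have [C K _] := tf.
have c0 : continuous psi by move=> x; exact: (Ck_cont (C 0)).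
split; first exact: continuous_cara_measurable.
  by have [M _ hM] := continuous_compact_bounded c0 K; exists M.
move=> i; have ci : continuous (partial i psi).
  by move=> x; exact: (Ck_cont (Ck_partial i (C 1))).
split; first exact: continuous_cara_measurable.
have [|M _ hM] := continuous_compact_bounded ci; last by exists M.
by apply: subclosed_compact K (@support_closure_partial _ _ _ i); exact: closed_closure.
Qed.

(** On the annulus the positive part is already 0, so the two branches agree near the sphere of
    radius [r], where [u] itself need not be continuous. *)
Lemma continuous_glue u (x0 : E) (r : R) : 0 < r ->
  (forall x, `|x - x0| < r -> {for x, continuous u}) ->
  (forall x, r / 2 <= `|x - x0| -> `|x - x0| <= r -> u x <= 0) ->
  continuous (fun x => if `|x - x0| < r then Num.max (u x) 0 else 0).
Proof.
move=> r0 cu u0 x.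
have cn : {for x, continuous (fun x => `|x - x0|)}.
  apply: (@continuous_comp _ _ _ (fun x : E => x - x0) (fun x : E => `|x|)).
    by apply: continuousB; [exact: cvg_id|exact: cst_continuous].
  exact: norm_continuous.
have [xr|xr] := ltP `|x - x0| r.
  apply: (@continuous_near_eq _ _ (fun x => Num.max (u x) 0)).
    by apply: continuous_max; [exact: cu|exact: cst_continuous].
  have : \forall y \near x, `|y - x0| < r by exact: (cn _ (lt_nbhsl xr)).
  by apply: filterS => y ->.
apply: (@continuous_near_eq _ _ (cst 0)); first exact: cst_continuous.
have r2 : r / 2 < `|x - x0| by apply: lt_le_trans xr; rewrite ltr_pdivrMr// ltr_pMr// ltr1n.
have : \forall y \near x, r / 2 < `|y - x0| by exact: (cn _ (lt_nbhsr r2)).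
apply: filterS => y yr; case: ifPn => // yr'.
by rewrite max_r// u0// ltW.
Qed.

End comparison.

(* [sg = 1] compares [u] with [phi] from above, [sg = -1] from below. *)
Section comparison_principle.
Context {R : realType} {n : nat}.
Local Notation E := 'rV[R]_n.
Local Notation T := (lebesgue_rVType R n).
Local Notation mu := (lebesgue_rV R n).
Implicit Types (psi : E -> R) (x : E).
Variables (sg p m c r M : R) (x0 : E) (A : set E) (u g phi : E -> R) (Du : E -> E).
Let q := (p - 2) / 2.
Hypotheses (sg2 : sg * sg = 1) (p6 : 6 < p) (m0 : 0 < m) (r0 : 0 < r).
Hypotheses (oA : open A) (cu : forall x, A x -> {for x, continuous u}).
Hypothesis Lp : forall i : 'I_n, in_Lp A p (fun x => Du x ord0 i).
Hypothesis wg : weak_gradient A u Du.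
Hypothesis weq : forall psi, test_function A psi ->
  - (\int[mu]_(x in A) (enorm (Du x) `^ (p - 2) * dotmul (Du x) (gradient psi x))) =
  \int[mu]_(x in A) (g x * psi x).
Hypotheses (mg : measurable_fun (A : set T) (g : T -> R)) (gM : forall x, A x -> `|g x| <= M).
Hypotheses (hphi : Ck 2 A phi) (rA : forall x, `|x - x0| <= r -> A x).
Hypothesis Nphi : forall x, `|x - x0| < r -> sg * (p_laplacian q phi x - g x) <= - m.
Hypothesis annulus : forall x, r / 2 <= `|x - x0| -> `|x - x0| <= r -> sg * (u x - phi x) <= c.

(** By the hypothesis [annulus] this vanishes from radius [r / 2] on, so the cut at radius [r]
    creates no jump. *)
Let w x := if `|x - x0| < r then Num.max (sg * (u x - phi x) - c) 0 else 0.
Let V := [set x | 0 < w x].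

Let q2 : 2 < q. Proof. by rewrite /q ltr_pdivlMr// ltrBrDr -natrM -natrD. Qed.
Let p0 : 0 < p. Proof. exact: lt_trans p6. Qed.
Let p1 : 1 < p. Proof. by apply: lt_trans p6; rewrite ltr1n. Qed.

Let w_ge0 x : 0 <= w x.
Proof. by rewrite /w; case: ifP => // _; rewrite le_max lexx orbT. Qed.

Let cw : continuous w.
Proof.
apply: (@continuous_glue _ _ (fun x => sg * (u x - phi x) - c)) => // [x xr|x h1 h2].
  have Ax : A x by apply: rA; exact: ltW.
  apply: continuousB; last exact: cst_continuous.
  apply: continuousM; first exact: cst_continuous.
  exact: (continuousB (cu Ax) (Ck_cont hphi Ax)).
by rewrite subr_le0; exact: annulus.
Qed.

Let Vball x : V x -> `|x - x0| < r.
Proof. by rewrite /V/= /w; case: ifP => //; rewrite ltxx. Qed.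

Let VA : V `<=` A.
Proof. by move=> x /Vball /ltW; exact: rA. Qed.

Let Vw x : V x -> w x = sg * (u x - phi x) - c.
Proof.
move=> Vx; have := Vx; rewrite /V/= /w (Vball Vx) => h.
by move: h; rewrite lt_max ltxx orbF => /ltW; exact: max_l.
Qed.

Let VNw x : ~ V x -> w x = 0.
Proof. by move=> /negP; rewrite -leNgt => h; apply/eqP; rewrite eq_le h w_ge0. Qed.

Let Kw : compact (support_closure w).
Proof.
apply: (@compact_support_le _ _ _ x0 r) => x h; apply: VNw => /Vball.
by move/(lt_trans h); rewrite ltxx.
Qed.

Let mA : measurable (A : set T).
Proof. exact: (sub_cara_rV (open_measurable_rV oA)). Qed.

Let mV : measurable (V : set T).
Proof.
apply: sub_cara_rV; apply: open_measurable_rV.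
suff : open (w @^-1` [set t | 0 < t]) by [].
by apply: open_comp => [x _|]; [exact: cw|exact: open_gt].
Qed.

(** The gradients of [u] and [phi] are cut to [V] and extended by 0: this puts [a] in L^p of the
    whole space, makes [b] bounded, and lets [z] vanish together with [w]. *)
Let a i : T -> R := (fun x => Du x ord0 i) \_ V.
Let b i : T -> R := (fun x => partial i phi x) \_ V.

Let ma i : measurable_fun setT (a i).
Proof.
apply: (measurable_restrict_subset mA mV VA); apply/(measurable_restrictT _ mA).
by have /sub_Lfun_mfun := Lp i; rewrite inE.
Qed.

Let mb i : measurable_fun setT (b i).
Proof.
apply: (measurable_restrict_subset mA mV VA).
apply: open_continuous_measurable => // x Ax.
exact: (Ck_cont (Ck_partial i hphi) Ax).
Qed.

Let ia i : mu.-integrable setT (EFin \o (fun x => `|a i x| `^ p)).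
Proof.
have h := Lfun_integrable (ltW p1) (Lp i).
exact: (@integrable_powR_restrict R _ T mu p V p1 A (fun x => Du x ord0 i) VA (ma i) h).
Qed.

Let bB : exists2 B, 0 <= B & forall i x, `|b i x| <= B.
Proof.
have h i : exists B, forall x, `|b i x| <= B.
  have K := @compact_norm_le R n x0 r.
  have ci : {within [set x | `|x - x0| <= r], continuous (partial i phi)}.
    by apply: continuous_in_subspaceT => x; rewrite inE => /rA Ax;
       exact: (Ck_cont (Ck_partial i hphi) Ax).
  have /compact_bounded[B [Br hB]] := continuous_compact ci K.
  exists (`|B| + 1) => x; rewrite /b patchE; case: ifPn => [Vx|_]; last by rewrite normr0 addr_ge0.
  apply: (hB (`|B| + 1)); first by rewrite (le_lt_trans (ler_norm _))// ltrDl.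
  by exists x => //=; apply/ltW/Vball; move: Vx; rewrite inE.
have [B hB] := choice h; exists (\sum_(i < n) `|B i|); first exact: sumr_ge0.
move=> i x; apply: le_trans (hB i x) _; apply: le_trans (ler_norm _) _.
by rewrite (bigD1 i)//= lerDl sumr_ge0.
Qed.

Let av (x : E) : E := \row_i a i x.
Let bv (x : E) : E := \row_i b i x.

Let avE x : V x -> av x = Du x.
Proof. by move=> Vx; apply/rowP => i; rewrite !mxE /a patchE mem_set. Qed.

Let bvE x : V x -> bv x = gradient phi x.
Proof. by move=> Vx; apply/rowP => i; rewrite !mxE /b patchE mem_set. Qed.

Let aN i x : ~ V x -> a i x = 0.
Proof. by move=> Vx; rewrite /a patchE memNset. Qed.

Let bN i x : ~ V x -> b i x = 0.
Proof. by move=> Vx; rewrite /b patchE memNset. Qed.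

Let F (i : 'I_n) (x : E) := sg * (flux q (av x) i - flux q (bv x) i).
Let z (i : 'I_n) (x : E) := sg * (a i x - b i x).

Let sg1 : `|sg| = 1.
Proof.
apply/eqP; rewrite -(@eqrXn2 _ 2) //; apply/eqP.
by rewrite -normrX expr2 sg2 expr1n normr1.
Qed.

Let FN i x : ~ V x -> F i x = 0.
Proof. by move=> Vx; rewrite /F /flux !mxE aN// bN// !mulr0 subrr mulr0. Qed.

Let zN i x : ~ V x -> z i x = 0.
Proof. by move=> Vx; rewrite /z aN// bN// subrr mulr0. Qed.

Let mF i : measurable_fun setT (F i : T -> R).
Proof. exact: (@measurable_flux_diff _ _ T _ q sg a b ma mb i). Qed.

Let mz i : measurable_fun setT (z i : T -> R).
Proof. exact: (@measurable_scaled_diff _ _ T sg (a i) (b i) (ma i) (mb i)). Qed.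

Let iV : mu.-integrable setT (EFin \o (\1_V : T -> R)).
Proof.
apply: (integrable_dominated (measurable_indic mV) (integrable_indic_ball x0 r)) => x.
rewrite !indicE; have [Vx|Vx] := pselect (V x); last by rewrite memNset// normr0.
by rewrite !mem_set ?normr1// -ball_normE/= distrC; exact: Vball.
Qed.

Let dom : exists S : T -> R, [/\ measurable_fun setT S, forall x, 0 <= S x,
  mu.-integrable setT (EFin \o (fun x => S x `^ p)),
  forall i x, `|F i x| <= S x `^ (p - 1) /\ `|F i x| <= S x `^ p &
  forall i x, `|z i x| <= S x].
Proof.
have [B B0 hB] := bB.
have [t [mt t0 it ht]] := power_dominator p1 ma B0 mV iV ia.
have p2 : 2 < p by apply: lt_trans p6; rewrite ltr_nat.
exists (fun x => 2 * t x); split.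
- exact: (measurable_scaled mt 2).
- by move=> x; rewrite mulr_ge0.
- exact: it.
- move=> i x; have [Vx|Vx] := pselect (V x); last by rewrite FN// normr0 !powR_ge0.
  have [t1 ta tB] := ht x Vx.
  have h : `|F i x| <= 2 * t x `^ (p - 1).
    rewrite /F normrM sg1 mul1r; apply: le_trans (ler_normB _ _) _.
    rewrite mulrDl mul1r; apply: lerD; apply: (flux_bound _ p2).
      by under eq_bigr do rewrite mxE.
    apply: le_trans tB; apply: ler_sum => j _; rewrite mxE; exact: hB.
  (* The factor 2 is absorbed by [2^(p-1)], since [p - 1 >= 1]. *)
  have h1 : `|F i x| <= (2 * t x) `^ (p - 1).
    apply: le_trans h _; rewrite powRM//; apply: ler_wpM2r; first exact: powR_ge0.
    rewrite -[leLHS]powRr1//; apply: ler_powR; first by rewrite ler1n.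
    by rewrite lerBrDl; exact: ltW p2.
  split => //; apply: le_trans h1 _; apply: ler_powR; last by rewrite lerBlDr lerDl.
  by apply: le_trans t1 _; rewrite ler_peMl ?ler1n.
- move=> i x; have [Vx|Vx] := pselect (V x); last by rewrite zN// normr0 mulr_ge0.
  have [t1 ta tB] := ht x Vx.
  rewrite /z normrM sg1 mul1r; apply: le_trans (ler_normB _ _) _.
  rewrite mulrDl mul1r; apply: lerD.
    by apply: le_trans ta; rewrite (bigD1 i)//= lerDl sumr_ge0.
  apply: le_trans (hB i x) _; apply: le_trans tB.
  by rewrite (bigD1 i)//= lerDl sumr_ge0.
Qed.

Let Vbounded : exists2 rr, 0 < rr & forall x, ~ ball 0 rr x -> ~ V x.
Proof.
have [rr rr0 h] := compact_support_ball Kw; exists rr => // x /h wx.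
by rewrite /V/= wx ltxx.
Qed.

Let ia1 i : mu.-integrable setT (EFin \o a i).
Proof.
have [rr _ h] := Vbounded.
by apply: (integrable_of_powR p1 (ma i) (ia i) (r := rr)) => x /h; exact: aN.
Qed.

(** On [V] one has [u = sg (w + c) + phi]. Tested with a function supported in [V], the constant
    drops out, [phi] is integrated by parts classically, and the weak gradient of [w] remains. *)
Let weak_w i psi : test_function V psi ->
  \int[mu]_y (w y * partial i psi y) = - \int[mu]_y (z i y * psi y).
Proof.
move=> tf; have tA := test_function_sub VA tf.
have [mpsi [Mp hMp] bdp] := test_function_bounded tf.
have [mdp [Md hMd]] := bdp i.
have [ipsi idp] := test_function_integrable tf.
have [C K _] := tf; have [_ _ sA] := tA.
have [j1 j2 je] := integration_by_parts i oA (Ck_leS hphi) (C 1) K sA.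
have j1' : mu.-integrable setT (EFin \o (fun y => phi y * partial i psi y)) by [].
have iw := continuous_compact_integrable_rV cw Kw.
have iwp := integrable_mul_bounded iw mdp hMd.
have icp := integrable_RZ c (idp i).
have zp := Rintegral_partial_eq0 i (C 1) K.
have eU : (fun y => u y * partial i psi y) =
    (fun y => sg * (w y * partial i psi y + c * partial i psi y) + phi y * partial i psi y).
  apply/funext => y; have [Vy|Vy] := pselect (V y); last first.
    by rewrite (partial_test_function_eq0 i tf Vy) !mulr0 !addr0 mulr0.
  have -> : u y = sg * (w y + c) + phi y by rewrite (Vw Vy) subrK mulrA sg2 mul1r subrK.
  by rewrite mulrDl -mulrA mulrDl.
have eU2 : \int[mu]_y (u y * partial i psi y) =
    sg * \int[mu]_y (w y * partial i psi y) - \int[mu]_y (partial i phi y * psi y).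
  rewrite eU RintegralD//; last exact/integrable_RZ/integrable_RD.
  rewrite RintegralZl//; last exact: integrable_RD.
  by rewrite RintegralD// RintegralZl// zp mulr0 addr0 je.
have eb : \int[mu]_y (partial i phi y * psi y) = \int[mu]_y (b i y * psi y).
  apply: eq_Rintegral => y _; have [Vy|Vy] := pselect (V y); last first.
    by rewrite (test_function_eq0 tf Vy) !mulr0.
  by rewrite /b patchE mem_set.
have jb : mu.-integrable setT (EFin \o (fun y => b i y * psi y)).
  rewrite (_ : (fun y => _) = (fun y => partial i phi y * psi y))//.
  apply/funext => y; have [Vy|Vy] := pselect (V y); last first.
    by rewrite (test_function_eq0 tf Vy) !mulr0.
  by rewrite /b patchE mem_set.
have ja := integrable_mul_bounded (ia1 i) mpsi hMp.
have ea : \int[mu]_(y in A) (Du y ord0 i * psi y) = \int[mu]_y (a i y * psi y).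
  rewrite Rintegral_support; last by move=> y Ay; rewrite (test_function_eq0 tA Ay) mulr0.
  apply: eq_Rintegral => y _; have [Vy|Vy] := pselect (V y); last first.
    by rewrite (test_function_eq0 tf Vy) !mulr0.
  by rewrite /a patchE mem_set.
have := wg tA i.
rewrite Rintegral_support; last first.
  by move=> y Ay; rewrite (partial_test_function_eq0 i tA Ay) mulr0.
rewrite eU2 ea eb => h.
have -> : \int[mu]_y (w y * partial i psi y) = sg * (\int[mu]_y (b i y * psi y) - \int[mu]_y (a i y * psi y)).
  by rewrite addrC -h subrK mulrA sg2 mul1r.
have -> : (fun y => z i y * psi y) = (fun y => sg * (a i y * psi y - b i y * psi y)).
  by apply/funext => y; rewrite /z; ring.
rewrite RintegralZl//; last exact: integrable_RB.
by rewrite RintegralB// -mulrN opprB.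
Qed.

(** The difference between the weak equation of [u] and the integrated identity for [phi]: the left
    side becomes the integral of [sg (p_laplacian q phi - g) psi], to which [Nphi] applies. *)
Let weak_F psi : test_function V psi -> (forall x, 0 <= psi x) ->
  \int[mu]_y (\sum_(i < n) F i y * partial i psi y) <= - (m * \int[mu]_y psi y).
Proof.
move=> tf psi0; have tA := test_function_sub VA tf.
have [S [mS S0 iS FS zS]] := dom.
have [mpsi [Mp hMp] bdp] := test_function_bounded tf.
have [ipsi idp] := test_function_integrable tf.
have [j1 j2 je] := p_laplacian_parts q2 oA hphi tA.
have iF i : mu.-integrable setT (EFin \o F i).
  exact: (integrable_dominated (mF i) iS (fun x => (FS i x).2)).
have iFp i : mu.-integrable setT (EFin \o (fun y => F i y * partial i psi y)).
  by have [md [Md hMd]] := bdp i; exact: (integrable_mul_bounded (iF i) md hMd).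
pose P y := \sum_(i < n) flux q (gradient phi y) i * partial i psi y.
pose G y := \sum_(i < n) flux q (Du y) i * partial i psi y.
have iP : mu.-integrable setT (EFin \o P) by exact: integrable_Rsum.
have iS1 : mu.-integrable setT (EFin \o (fun y => \sum_(i < n) F i y * partial i psi y)).
  exact: integrable_Rsum.
have eF : (fun y => \sum_(i < n) F i y * partial i psi y) = (fun y => sg * (G y - P y)).
  apply/funext => y; rewrite /G /P -sumrB mulr_sumr; apply: eq_bigr => i _.
  have [Vy|Vy] := pselect (V y); last first.
    by rewrite (partial_test_function_eq0 i tf Vy) !mulr0 subrr mulr0.
  by rewrite /F (avE Vy) (bvE Vy) -mulrBl mulrA.
have iS2 : mu.-integrable setT (EFin \o (fun y => sg * (G y - P y))) by rewrite -eF.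
(* Integrable bounds are at hand for [F], cut to [V], and for the flux of [phi]; [G] is recovered
   from these two. *)
have iG : mu.-integrable setT (EFin \o G).
  have eGP : (fun y => sg * (sg * (G y - P y)) + P y) = G.
    by apply/funext => y; rewrite mulrA sg2 mul1r subrK.
  rewrite -eGP; exact: (integrable_RD (integrable_RZ sg iS2) iP).
pose gA : T -> R := (g : T -> R) \_ (A : set T).
have mgA : measurable_fun setT gA by apply/(measurable_restrictT _ mA).
have gAM y : `|gA y| <= `|M|.
  rewrite /gA patchE; case: ifPn => [|_]; last by rewrite normr0.
  by rewrite inE => /gM h; apply: le_trans h _; exact: ler_norm.
have eg : (fun y => g y * psi y) = (fun y => psi y * gA y).
  apply/funext => y; have [Ay|Ay] := pselect (A y); last first.
    by rewrite (test_function_eq0 tA Ay) mulr0 mul0r.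
  by rewrite /gA patchE mem_set// mulrC.
have ig : mu.-integrable setT (EFin \o (fun y => g y * psi y)).
  by rewrite eg; exact: (integrable_mul_bounded ipsi mgA gAM).
have eG : \int[mu]_y G y = - \int[mu]_y (g y * psi y).
  have e1 : \int[mu]_(y in A) (g y * psi y) = \int[mu]_y (g y * psi y).
    by apply: Rintegral_support => y Ay; rewrite (test_function_eq0 tA Ay) mulr0.
  rewrite -e1 -(weq tA) opprK Rintegral_support => [|y Ay]; last first.
    rewrite /dotmul big1 ?mulr0// => i _.
    by rewrite mxE (partial_test_function_eq0 i tA Ay) mulr0.
  apply: eq_Rintegral => y _; rewrite /G /dotmul mulr_sumr; apply: eq_bigr => i _.
  by rewrite enorm_pow mxE mulrA.
rewrite eF RintegralZl//; last exact: integrable_RB.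
rewrite RintegralB// eG je opprK addrC -RintegralB// -RintegralZl//; last exact: integrable_RB.
rewrite -mulNr -RintegralZl//.
apply: le_Rintegral => //.
- exact/integrable_RZ/integrable_RB.
- exact: integrable_RZ.
- move=> y _; have [Vy|Vy] := pselect (V y); last first.
    by rewrite (test_function_eq0 tf Vy) !mulr0 subrr mulr0.
  by rewrite -mulrBl mulrA; apply: ler_wpM2r => //; exact/Nphi/Vball.
Qed.

Lemma comparison_principle x : `|x - x0| < r -> sg * (u x - phi x) <= c.
Proof.
move=> xr; have [S [mS S0 iS FS zS]] := dom.
have iz i : mu.-integrable setT (EFin \o (fun x => `|z i x| `^ p)).
  exact: (integrable_powR_norm_le (ltW p0) (mz i) (zS i) iS).
have zw i y : w y = 0 -> z i y = 0 by move=> wy; apply: zN; rewrite /V/= wy ltxx.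
have Fz y : 0 <= \sum_(i < n) F i y * z i y.
  have q0 : 0 < q := lt_trans (ltr0Sn _ 1) q2.
  rewrite (_ : \sum_(i < n) _ = \sum_(i < n)
    (flux q (av y) i - flux q (bv y) i) * (av y ord0 i - bv y ord0 i)).
    exact: flux_monotone.
  apply: eq_bigr => i _; rewrite /F /z mulrACA sg2 mul1r; congr (_ * (_ - _)).
    by rewrite mxE.
  by rewrite mxE.
have := weak_max_principle p1 m0 cw w_ge0 Kw mS mF mz S0 iS (fun i x => (FS i x).1)
  (fun i x => (FS i x).2) iz zw Fz weak_w weak_F x.
rewrite /w xr => h; rewrite -subr_le0 -h le_max lexx//.
Qed.
End comparison_principle.

(** * Limits of the p-Laplacian *)

Section p_laplacian_limits.
Context {R : realType} {n : nat}.
Local Notation E := 'rV[R]_n.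
Implicit Types (A : set E) (phi : E -> R) (x : E).

(** With [a = - ln b] and [t = q - 1] the power is [exp(- a t)], and [exp(a t) >= (a t)^2 / 2] beats
    the linear factor. *)
Lemma powR_geometric (b C eps : R) : 0 < b -> b < 1 -> 0 <= C -> 0 < eps ->
  exists q0, forall q, q0 <= q -> b `^ (q - 1) * (C * (2 * q + 1)) <= eps.
Proof.
move=> b0 b1 C0 eps0; pose a := - ln b.
have a0 : 0 < a by rewrite oppr_gt0 ln_lt0// b0.
have K0 : 0 <= 10 * C / (a ^+ 2 * eps).
  by rewrite divr_ge0 ?mulr_ge0// ?sqr_ge0// ltW.
(* The 2 ensures [t >= 1], hence [2 q + 1 <= 5 t]; the quotient ensures [10 C <= a^2 eps t]. *)
exists (2 + 10 * C / (a ^+ 2 * eps)) => q hq.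
have t1 : 1 <= q - 1 by lra.
have t0 : 0 < q - 1 by lra.
have ht : 10 * C / (a ^+ 2 * eps) <= q - 1 by lra.
set t := q - 1 in t1 t0 ht *.
have -> : b `^ t = (expR (a * t))^-1.
  by rewrite /powR gt_eqF// -expRN; congr expR; rewrite /a; ring.
have e0 := expR_gt0 (a * t).
rewrite mulrC ler_pdivrMr//.
have h2 : (a * t) ^+ 2 <= 2 * expR (a * t).
  by apply: (@pow_le_expR R (a * t) 2); rewrite mulr_ge0// ltW.
have h3 : 2 * q + 1 <= 5 * t by rewrite /t; lra.
have h4 : 10 * C <= t * (a ^+ 2 * eps).
  by move: ht; rewrite ler_pdivrMr// mulr_gt0// exprn_gt0.
apply: (@le_trans _ _ (C * (5 * t))); first exact: ler_wpM2l.
have h5 : 2 * (C * (5 * t)) <= eps * (a * t) ^+ 2.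
  rewrite (_ : 2 * _ = t * (10 * C)); last by ring.
  rewrite (_ : eps * _ = t * (t * (a ^+ 2 * eps))); last by ring.
  by rewrite ler_pM2l.
have h6 : eps * (a * t) ^+ 2 <= eps * (2 * expR (a * t)) by rewrite ler_pM2l.
have := le_trans h5 h6.
by rewrite [leRHS]mulrCA ler_pM2l.
Qed.

(** The neighbourhood serves all large [q], because the annulus is fixed before [p]. On it [sg]
    times the bracket in [p_laplacian] is at most [- 2 q d + C], which is below [- K] for large [q],
    and the prefactor is at least [b^(q-1)]. Taking [K = 1] gives mere strictness; [b = 1] with a
    large [K] beats the bound on [g]. *)
Lemma near_p_laplacian_le (sg b K : R) A phi x0 : `|sg| = 1 -> open A -> A x0 -> Ck 2 A phi ->
  0 <= b -> b < dotmul (gradient phi x0) (gradient phi x0) -> 0 <= K ->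
  sg * infinity_laplacian phi x0 < 0 ->
  exists q0, \forall x \near x0, forall q, q0 <= q ->
    sg * p_laplacian q phi x <= - (K * b `^ (q - 1)).
Proof.
move=> sg1 oA Ax0 hphi b0 bs K0 neg.
pose s x := dotmul (gradient phi x) (gradient phi x).
have cs : {for x0, continuous s} := Ck_cont (Ck_grad_sqr oA hphi) Ax0.
have cl : {for x0, continuous (laplacian phi)} := Ck_cont (Ck_laplacian oA hphi) Ax0.
have cL : {for x0, continuous (infinity_laplacian phi)}.
  exact: (Ck_cont (Ck_infinity_laplacian oA hphi) Ax0).
pose d := - (sg * infinity_laplacian phi x0) / 2.
have d0 : 0 < d by rewrite divr_gt0// oppr_gt0.
pose C := `|s x0 * laplacian phi x0| + 1.
have C0 : 0 < C by rewrite ltr_wpDl.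
have csl : {for x0, continuous (fun x => `|s x * laplacian phi x|)}.
  apply: (@continuous_comp _ _ _ (fun x => s x * laplacian phi x) (fun t : R => `|t|)).
    exact: (continuousM cs cl).
  exact: norm_continuous.
have csL : {for x0, continuous (fun x => sg * infinity_laplacian phi x)}.
  exact: (continuousM (@cst_continuous _ _ sg x0) cL).
exists (1 + (K + C) / (2 * d)).
have n1 : \forall x \near x0, b < s x by exact: (cs _ (lt_nbhsr bs)).
have n2 : \forall x \near x0, `|s x * laplacian phi x| < C.
  by apply: (csl [set t | t < C]); apply: lt_nbhsl; rewrite /C ltrDl.
have n3 : \forall x \near x0, sg * infinity_laplacian phi x < - d.
  by apply: (csL [set t | t < - d]); apply: lt_nbhsl; rewrite /d; lra.
near=> x => q hq.
have h1 : b < s x by near: x.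
have h2 : `|s x * laplacian phi x| < C by near: x.
have h3 : sg * infinity_laplacian phi x < - d by near: x.
have q1 : (K + C) / (2 * d) <= q - 1 by lra.
have KC0 : 0 <= (K + C) / (2 * d).
  by apply: divr_ge0; [rewrite addr_ge0// ltW|rewrite mulr_ge0// ltW].
have q0 : 0 <= q - 1 := le_trans KC0 q1.
rewrite /p_laplacian -/(s x) mulrCA.
have hp : b `^ (q - 1) <= pos_pow (q - 1) (s x).
  rewrite pos_powE ?dotmul_ge0//; apply: (ge0_ler_powR q0); rewrite ?nnegrE ?dotmul_ge0//.
  exact: ltW.
have hn : sg * (2 * q * infinity_laplacian phi x + s x * laplacian phi x) <= - K.
  rewrite mulrDr.
  have t1 : sg * (s x * laplacian phi x) <= C.
    by apply: le_trans (ler_norm _) _; rewrite normrM sg1 mul1r ltW.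
  have t2 : K + C <= (q - 1) * (2 * d) by move: q1; rewrite ler_pdivrMr// mulr_gt0.
  have t3 : sg * (2 * q * infinity_laplacian phi x) <= 2 * q * (- d).
    rewrite mulrCA; apply: ler_wpM2l; last exact: ltW.
    by rewrite mulr_ge0//; lra.
  lra.
rewrite -mulNr mulrC.
apply: (@le_trans _ _ (- K * pos_pow (q - 1) (s x))).
  by apply: ler_wpM2r => //; exact: pos_pow_ge0.
by rewrite !mulNr lerN2 ler_wpM2l.
Unshelve. all: by end_near. Qed.

(** The squared gradient stays below some [b < 1] near [x0], so the prefactor decays geometrically
    in [q] while the bracket grows at most linearly. *)
Lemma near_p_laplacian_small (eps : R) A phi x0 : open A -> A x0 -> Ck 2 A phi ->
  dotmul (gradient phi x0) (gradient phi x0) < 1 -> 0 < eps ->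
  exists q0, \forall x \near x0, forall q, q0 <= q -> p_laplacian q phi x <= eps.
Proof.
move=> oA Ax0 hphi s1 eps0.
pose s x := dotmul (gradient phi x) (gradient phi x).
have cs : {for x0, continuous s} := Ck_cont (Ck_grad_sqr oA hphi) Ax0.
have cl : {for x0, continuous (laplacian phi)} := Ck_cont (Ck_laplacian oA hphi) Ax0.
have cL : {for x0, continuous (infinity_laplacian phi)}.
  exact: (Ck_cont (Ck_infinity_laplacian oA hphi) Ax0).
pose b := (s x0 + 1) / 2.
have s0 : 0 <= s x0 by exact: dotmul_ge0.
have b0 : 0 < b by rewrite divr_gt0// ltr_wpDl.
have sb : s x0 < b by rewrite /b; move: s1; rewrite -/(s x0); lra.
have b1 : b < 1 by rewrite /b; move: s1; rewrite -/(s x0); lra.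
pose C := `|infinity_laplacian phi x0| + `|s x0 * laplacian phi x0| + 1.
have C0 : 0 <= C by rewrite !addr_ge0.
have csl : {for x0, continuous (fun x => `|s x * laplacian phi x|)}.
  apply: (@continuous_comp _ _ _ (fun x => s x * laplacian phi x) (fun t : R => `|t|)).
    exact: (continuousM cs cl).
  exact: norm_continuous.
have cnL : {for x0, continuous (fun x => `|infinity_laplacian phi x|)}.
  by apply: (@continuous_comp _ _ _ (infinity_laplacian phi) (fun t : R => `|t|));
    [exact: cL|exact: norm_continuous].
have [q0 hq0] := powR_geometric b0 b1 C0 eps0.
exists (Num.max 1 q0).
have n1 : \forall x \near x0, s x < b by exact: (cs _ (lt_nbhsl sb)).
have n2 : \forall x \near x0, `|s x * laplacian phi x| < C.
  by apply: (csl [set t | t < C]); apply: lt_nbhsl; rewrite /C -addrA ltr_wpDl// ltrDl.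
have n3 : \forall x \near x0, `|infinity_laplacian phi x| < C.
  by apply: (cnL [set t | t < C]); apply: lt_nbhsl; rewrite /C -addrA ltrDl ltr_wpDl.
near=> x => q; rewrite ge_max => /andP[q1 hq].
have h1 : s x < b by near: x.
have h2 : `|s x * laplacian phi x| < C by near: x.
have h3 : `|infinity_laplacian phi x| < C by near: x.
apply: le_trans (hq0 q hq); rewrite /p_laplacian -/(s x).
have hp : pos_pow (q - 1) (s x) <= b `^ (q - 1).
  rewrite pos_powE ?dotmul_ge0//; apply: ge0_ler_powR; rewrite ?nnegrE ?dotmul_ge0 ?subr_ge0//;
    exact: ltW.
apply: (@le_trans _ _ (pos_pow (q - 1) (s x) * (C * (2 * q + 1)))).
  apply: ler_wpM2l; first exact: pos_pow_ge0.
  rewrite mulrDr mulr1; apply: lerD; last by apply: le_trans (ler_norm _) _; exact: ltW.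
  rewrite mulrC; apply: ler_wpM2r; first by rewrite mulr_ge0//; lra.
  by apply: le_trans (ler_norm _) _; exact: ltW.
apply: ler_wpM2r hp; rewrite mulr_ge0//; lra.
Unshelve. all: by end_near. Qed.

Lemma lsc_envelope_gt0 (A : set E) (g : E -> R) x0 : A x0 -> (0 < lsc_envelope A g x0)%E ->
  exists2 gam, 0 < gam & \forall x \near x0, A x -> gam <= g x.
Proof.
move=> Ax0; rewrite /lsc_envelope /limf_einf oppe_gt0 => /ereal_inf_lt[_ [V VF <-] hV].
have xV : V x0 by exact: (nbhs_singleton VF).
have ub x : V x -> ((- g x)%:E <= ereal_sup ((\- (EFin \o g))%E @` V))%E.
  by move=> Vx; apply: ereal_sup_ubound; exists x.
(* The lower limit is encoded through suprema of [- g]. The value [-oo] is excluded because [x0]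
   itself belongs to [V], and [+oo] because the supremum is negative. *)
move: hV ub; case: ereal_sup => [c| |] //; last first.
  by move=> _ /(_ _ xV).
rewrite lte_fin => c0 ub; exists (- c); first by rewrite oppr_gt0.
have VF' : \forall x \near x0, A x -> V x by exact: VF.
apply: filterS VF' => x Vx Ax; have := ub x (Vx Ax).
by rewrite lee_fin lerNl.
Qed.

End p_laplacian_limits.

(** * Uniform limits of weak solutions *)

Section uniform_limits.
Context {R : realType} {n : nat}.
Local Notation E := 'rV[R]_n.
Local Notation T := (lebesgue_rVType R n).

Lemma uniform_close (A : set E) (v : nat -> E -> R) (w : E -> R) (e : R) :
  {uniform A, v @ \oo --> w} -> 0 < e ->
  \forall k \near \oo, forall x, A x -> `|w x - v k x| < e.
Proof.
move=> vw e0; apply: (vw [set h : E -> R | forall y, A y -> `|w y - h y| < e]).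
apply/uniform_nbhs; exists [set xy | ball xy.1 e xy.2]; split; first exact: (entourage_ball _ (PosNum e0)).
by move=> h /= hh y /hh; rewrite -ball_normE.
Qed.

Variables (Omega : set E) (f g : E -> R) (M : R) (u : R -> E -> R) (p_ : R^nat) (uoo : E -> R).
Hypotheses (oO : open Omega) (gM : forall x, Omega x -> `|g x| <= M).
Hypothesis mg : measurable_fun (Omega : set T) (g : T -> R).
Hypothesis u_sol : forall k, weak_solution Omega (p_ k) f g (u (p_ k)).
Hypothesis p_cvg : p_ @ \oo --> +oo.
Hypothesis u_cvg : {uniform closure Omega, (fun k => u (p_ k)) @ \oo --> uoo}.

Lemma uniform_limit_continuous_at x : Omega x -> {for x, continuous uoo}.
Proof.
have cw : {within closure Omega, continuous uoo}.
  apply: (uniform_limit_continuous_subspace _ _ u_cvg).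
  change (\forall k \near \oo, {within closure Omega, continuous (u (p_ k))}).
  by apply: nearW => k; case: (u_sol k).
have := continuous_subspaceW (@subset_closure _ Omega) cw.
by rewrite continuous_open_subspace// => h Ox; apply: h; rewrite inE.
Qed.

Lemma solution_continuous_at k x : Omega x -> {for x, continuous (u (p_ k))}.
Proof.
have [cw _ _] := u_sol k; have := continuous_subspaceW (@subset_closure _ Omega) cw.
by rewrite continuous_open_subspace// => h Ox; apply: h; rewrite inE.
Qed.

Lemma uniform_limit_boundary_value : boundary_value Omega f uoo.
Proof.
move=> z zb; apply/cvgrPdist_lt => e e0; have e2 : 0 < e / 2 by rewrite divr_gt0.
have [k hk] := filter_ex (uniform_close u_cvg e2).
have [_ /(_ z zb)/cvgrPdist_lt/(_ _ e2) hz _] := u_sol k.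
have hO : \forall x \near within Omega (nbhs z), Omega x by exact: withinT.
apply: filterS2 hz hO => x fx Ox.
have := hk x (subset_closure Ox); rewrite distrC => ux.
rewrite (_ : f z - uoo x = (f z - u (p_ k) x) + (u (p_ k) x - uoo x)); last by ring.
apply: le_lt_trans (ler_normD _ _) _; rewrite [e]splitr; exact: ltrD.
Qed.

(* Compared on an annulus around [x0], where uniform convergence keeps [u_p - phi]
   strictly below its value at [x0], a strict differential inequality is contradictory. *)
Lemma strict_touching_contradiction (sg q0 : R) (m : R -> R) phi x0 :
  sg = 1 \/ sg = -1 -> Omega x0 -> Ck 2 Omega phi ->
  (\forall y \near within Omega (nbhs x0), y != x0 ->
    sg * (uoo y - phi y) < sg * (uoo x0 - phi x0)) ->
  (forall q, q0 <= q -> 0 < m q) ->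
  (\forall x \near x0, forall q, q0 <= q -> sg * (p_laplacian q phi x - g x) <= - m q) ->
  False.
Proof.
move=> sgE Ox0 hphi smax m_gt0 hN.
have nO : \forall x \near x0, Omega x by exact: open_nbhs_nbhs.
have sg2 : sg * sg = 1 by case: sgE => ->; rewrite ?mulrNN mulr1.
have [r1 /= r10 hr1] : exists2 r : R, 0 < r & forall x, `|x0 - x| < r ->
    [/\ Omega x, x != x0 -> sg * (uoo x - phi x) < sg * (uoo x0 - phi x0) &
      forall q, q0 <= q -> sg * (p_laplacian q phi x - g x) <= - m q].
  have : \forall x \near x0, [/\ Omega x, x != x0 -> sg * (uoo x - phi x) < sg * (uoo x0 - phi x0) &
      forall q, q0 <= q -> sg * (p_laplacian q phi x - g x) <= - m q].
    near=> x; have Ox : Omega x by near: x.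
    split => //; last by near: x.
    by move: Ox; near: x; exact: smax.
  by move=> /nbhs_ballP[r r0 hr]; exists r => // x xr; apply: hr; rewrite -ball_normE.
(* Halving puts the closed cube of radius [r] inside the open neighbourhood on which everything
   holds. *)
pose r := r1 / 2; have r0 : 0 < r by rewrite divr_gt0.
have rr1 : r < r1 by rewrite ltr_pdivrMr// ltr_pMr// ltr1n.
pose h x := sg * (uoo x - phi x).
have ch x : Omega x -> {for x, continuous h}.
  move=> Ox; apply: (@continuousM _ _ (cst sg) (fun x => uoo x - phi x)).
    exact: cst_continuous.
  exact: (continuousB (uniform_limit_continuous_at Ox) (Ck_cont hphi Ox)).
pose K := [set x | r / 2 <= `|x - x0|] `&` [set x | `|x - x0| <= r].
have cK : compact K.
  apply: (@subclosed_compact _ K _ _ (@compact_norm_le R n x0 r)); last by move=> x [].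
  apply: closedI; last exact: closed_norm_le.
  suff : closed ((fun x : E => `|x - x0|) @^-1` [set t | r / 2 <= t]) by [].
  apply: preimage_closed => [x _|]; last exact: closed_ge.
  apply: (@continuous_comp _ _ _ (fun x : E => x - x0) (fun x : E => `|x|)).
    by apply: continuousB; [exact: cvg_id|exact: cst_continuous].
  exact: norm_continuous.
have inball x : `|x - x0| <= r -> `|x0 - x| < r1 by rewrite distrC => /le_lt_trans; apply.
(* A third of the gap between the centre and the annulus: replacing [uoo] by [u (p_ k)] costs [eta]
   on each side, so the values at most [h x0 - 2 * eta] on the annulus still lie below the value at
   the centre. *)
have [eta eta0 heta] : exists2 eta, 0 < eta & forall x, K x -> h x <= h x0 - 3 * eta.
  (* In dimension 0 the annulus is empty. *)
  have [K0|/set0P K0] := eqVneq K set0; first by exists 1 => // x; rewrite K0.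
  have cKh : {within K, continuous h}.
    apply: continuous_in_subspaceT => x; rewrite inE => -[_ /inball xr].
    by apply: ch; case: (hr1 x xr).
  have [xm /set_mem Kxm hxm] := @EVT_max_rV _ _ h K K0 cK cKh.
  have hm : h xm < h x0.
    have [xm1 xm2] := Kxm; have [_ lt _] := hr1 xm (inball xm xm2); apply: lt.
    apply/eqP => e; move: xm1 => /=; rewrite e subrr normr0 leNgt divr_gt0//.
  exists ((h x0 - h xm) / 3); first by rewrite divr_gt0// subr_gt0.
  by move=> x /mem_set/hxm; lra.
(* The bound 6 is that of [comparison_principle]; [2 * q0 + 2] makes [(p - 2) / 2] exceed [q0]. *)
have nq : \forall k \near \oo, Num.max 6 (2 * q0 + 2) < p_ k by move/cvgryPgt : p_cvg; exact.
have [k [hk]] := filter_ex (filterI (uniform_close u_cvg eta0) nq).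
rewrite gt_max => /andP[p6 pq].
have qq : q0 <= (p_ k - 2) / 2 by rewrite ler_pdivlMr//; lra.
have [_ _ [Du [_ LDu wDu] weq]] := u_sol k.
have ann x : r / 2 <= `|x - x0| -> `|x - x0| <= r -> sg * (u (p_ k) x - phi x) <= h x0 - 2 * eta.
  move=> xr1 xr2; have hx := heta x (conj xr1 xr2).
  have [Ox _ _] := hr1 x (inball x xr2).
  have := hk x (subset_closure Ox); rewrite ltr_norml => /andP[].
  by move: hx; rewrite /h; case: sgE => ->; lra.
have Nphi x : `|x - x0| < r ->
    sg * (p_laplacian ((p_ k - 2) / 2) phi x - g x) <= - m ((p_ k - 2) / 2).
  by move=> /ltW/inball/hr1[_ _]; exact.
have rO x : `|x - x0| <= r -> Omega x by move=> /inball/hr1[].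
have x0r : `|x0 - x0| < r by rewrite subrr normr0.
have := comparison_principle sg2 p6 (m_gt0 _ qq) r0 oO (@solution_continuous_at k) LDu wDu weq
  mg gM hphi rO Nphi ann x0r.
have := hk x0 (subset_closure Ox0); rewrite ltr_norml => /andP[].
by rewrite /h; case: sgE => ->; lra.
Unshelve. all: by end_near. Qed.
End uniform_limits.

(** * The viscosity inequalities at a touching point *)

Section gradient_bounds.
Context {R : realType} {n : nat}.
Implicit Types (phi : 'rV[R]_n -> R) (x v : 'rV[R]_n).

(** Used in contrapositive: a negative infinity Laplacian forces a nonzero gradient, hence a
    positive [b] for [near_p_laplacian_le]. *)
Lemma infinity_laplacian_eq0 phi x : dotmul (gradient phi x) (gradient phi x) = 0 ->
  infinity_laplacian phi x = 0.
Proof.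
rewrite dotmul_gradientE => /eqP; rewrite psumr_eq0 => [/allP h|i _]; last first.
  by rewrite -expr2 sqr_ge0.
rewrite /infinity_laplacian big1// => i _; rewrite big1// => j _.
have := h j; rewrite mem_index_enum => /(_ isT); rewrite mulf_eq0 orbb => /eqP ->.
by rewrite mulr0.
Qed.

Lemma enorm_lt1 v : enorm v < 1 -> dotmul v v < 1.
Proof.
move=> h; rewrite -(sqr_sqrtr (dotmul_ge0 v)) -/(enorm v).
by rewrite exprn_ilt1// sqrtr_ge0.
Qed.

Lemma enorm_gt1 v : 1 < enorm v -> 1 < dotmul v v.
Proof.
move=> h; rewrite -(sqr_sqrtr (dotmul_ge0 v)) -/(enorm v).
by rewrite exprn_egt1.
Qed.
End gradient_bounds.

Theorem theorem3p6 (R : realType) (n : nat) (n_gt0 : (0 < n)%N)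
  (Omega : set 'rV[R]_n) (f g : 'rV[R]_n -> R)
  (domOmega : domain Omega) (bndOmega : bounded_set Omega)
  (lipf : lipschitz_on_set (boundary Omega) f)
  (g_ge0 : forall x, Omega x -> 0 <= g x)
  (g_bnd : exists M : R, forall x, Omega x -> g x <= M)
  (g_meas : measurable_fun (Omega : set (lebesgue_rVType R n))
                           (g : lebesgue_rVType R n -> R))
  (D : set 'rV[R]_n) (D_def : D = [set x | Omega x /\ 0 < g x])
  (g_env : forall x, D° x -> (0 < lsc_envelope Omega g x)%E)
  (u : R -> 'rV[R]_n -> R)
  (u_sol : forall p : R, Num.max 2 n%:R < p -> weak_solution Omega p f g (u p))
  (p_ : R^nat) (p_gt : forall k, Num.max 2 n%:R < p_ k)
  (p_cvg : p_ @ \oo --> +oo)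
  (uoo : 'rV[R]_n -> R)
  (u_cvg : {uniform closure Omega, (fun k => u (p_ k)) @ \oo --> uoo}) :
  viscosity_solution Omega D uoo /\ boundary_value Omega f uoo.
Proof.
have [oO _ _] := domOmega.
have [M gM] : exists M : R, forall x, Omega x -> `|g x| <= M.
  have [M hM] := g_bnd; exists M => x Ox.
  by rewrite ger0_norm; [exact: hM|exact: g_ge0].
have sol k : weak_solution Omega (p_ k) f g (u (p_ k)) by exact: (u_sol _ (p_gt k)).
have cuoo := uniform_limit_continuous_at oO sol u_cvg.
split; last exact: uniform_limit_boundary_value sol u_cvg.
split.
- by apply: continuous_in_subspaceT => x; rewrite inE; exact: cuoo.
- split.
    move=> x Ox a ua; have h : \forall y \near x, uoo y < a by exact: (cuoo x Ox _ (lt_nbhsl ua)).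
    by apply: filterS h => y h _.
  move=> x phi Ox hphi smax; rewrite leNgt; apply/negP.
  have smax' : \forall y \near within Omega (nbhs x), y != x ->
      1 * (uoo y - phi y) < 1 * (uoo x - phi x).
    by apply: filterS smax => y; rewrite !mul1r.
  have touch q0 m := @strict_touching_contradiction _ _ Omega f g M u p_ uoo oO gM g_meas sol
    p_cvg u_cvg 1 q0 m phi x (or_introl erefl) Ox hphi smax'.
  have nO : \forall y \near x, Omega y by exact: open_nbhs_nbhs.
  rewrite gt_min => /orP[neg|small].
    have s0 : 0 < dotmul (gradient phi x) (gradient phi x).
      rewrite lt_def dotmul_ge0 andbT; apply/eqP => /infinity_laplacian_eq0 e.
      by rewrite e ltxx in neg.
    pose b := dotmul (gradient phi x) (gradient phi x) / 2.
    have b0 : 0 < b by rewrite divr_gt0.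
    have bs : b < dotmul (gradient phi x) (gradient phi x).
      by rewrite ltr_pdivrMr// ltr_pMr// ltr1n.
    have neg1 : 1 * infinity_laplacian phi x < 0 by rewrite mul1r.
    have [q0 hq0] := near_p_laplacian_le (normr1 R) oO Ox hphi (ltW b0) bs ler01 neg1.
    (* Here [g >= 0] alone suffices. The margin may tend to 0 as [q] grows, which is why [m] is a
       function of [q]. *)
    apply: (touch q0 (fun q => b `^ (q - 1))) => [q _|]; first exact: powR_gt0.
    apply: filterS2 hq0 nO => y hy Oy q /hy.
    by have := g_ge0 y Oy; rewrite !mul1r; lra.
  (* Outside the interior of [D] the gradient inequality holds trivially, the norm being
     nonnegative. *)
  have [Dx|Dx] := pselect (D° x); last first.
    by move: small; rewrite indicE memNset// subr0 ltNge sqrtr_ge0.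
  have s1 : dotmul (gradient phi x) (gradient phi x) < 1.
    by apply: enorm_lt1; move: small; rewrite indicE mem_set// subr_lt0.
  have [gam gam0 hgam] := lsc_envelope_gt0 Ox (g_env x Dx).
  have gam2 : 0 < gam / 2 by rewrite divr_gt0.
  have [q0 hq0] := near_p_laplacian_small oO Ox hphi s1 gam2.
  (* Half of the lower bound [gam] of [g] absorbs the p-Laplacian; the other half is the margin. *)
  apply: (touch q0 (fun=> gam / 2)) => //.
  near=> y => q hq; rewrite mul1r.
  have Oy : Omega y by near: y.
  have h1 : Omega y -> gam <= g y by near: y.
  have h2 : forall q, q0 <= q -> p_laplacian q phi y <= gam / 2 by near: y.
  by have := h1 Oy; have := h2 q hq; lra.
- split.
    move=> x Ox a ua; have h : \forall y \near x, a < uoo y by exact: (cuoo x Ox _ (lt_nbhsr ua)).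
    by apply: filterS h => y h _.
  move=> x phi Ox hphi smin; rewrite leNgt; apply/negP.
  have smin' : \forall y \near within Omega (nbhs x), y != x ->
      -1 * (uoo y - phi y) < -1 * (uoo x - phi x).
    by apply: filterS smin => y h /h; rewrite !mulN1r ltrN2.
  have touch q0 m := @strict_touching_contradiction _ _ Omega f g M u p_ uoo oO gM g_meas sol
    p_cvg u_cvg (-1) q0 m phi x (or_intror erefl) Ox hphi smin'.
  have nO : \forall y \near x, Omega y by exact: open_nbhs_nbhs.
  have sgn : `|-1 : R| = 1 by rewrite normrN normr1.
  rewrite lt_min => /andP[pos big].
  have neg1 : -1 * infinity_laplacian phi x < 0 by rewrite mulN1r oppr_lt0.
  have [Dx|Dx] := pselect (closure D x).
    have s1 : 1 < dotmul (gradient phi x) (gradient phi x).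
      by apply: enorm_gt1; move: big; rewrite indicE mem_set// subr_gt0.
    (* With [b = 1] the powers of [b] are 1, so the p-Laplacian of [phi] is at least [|M| + 1],
       which exceeds [g] by 1. *)
    have K0 : 0 <= `|M| + 1 by rewrite addr_ge0.
    have [q0 hq0] := near_p_laplacian_le sgn oO Ox hphi ler01 s1 K0 neg1.
    apply: (touch q0 (fun=> 1)) => //.
    apply: filterS2 hq0 nO => y hy Oy q /hy; rewrite powR1 mulr1.
    by have := gM y Oy; have := ler_norm (g y); have := ler_norm M; lra.
  have s0 : 0 < dotmul (gradient phi x) (gradient phi x).
    by move: big; rewrite indicE memNset// subr0 sqrtr_gt0.
  pose b := dotmul (gradient phi x) (gradient phi x) / 2.
  have b0 : 0 < b by rewrite divr_gt0.
  have bs : b < dotmul (gradient phi x) (gradient phi x).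
    by rewrite ltr_pdivrMr// ltr_pMr// ltr1n.
  have [q0 hq0] := near_p_laplacian_le sgn oO Ox hphi (ltW b0) bs ler01 neg1.
  (* The complement of the closure is open, so [g] vanishes on a neighbourhood of [x] in [Omega] and
     any positive p-Laplacian contradicts the equation. *)
  have nD : \forall y \near x, ~ closure D y.
    by apply: open_nbhs_nbhs; split => //; apply: closed_openC; exact: closed_closure.
  apply: (touch q0 (fun q => b `^ (q - 1))) => [q _|]; first exact: powR_gt0.
  near=> y => q hq.
  have Oy : Omega y by near: y.
  have g0 : g y <= 0.
    rewrite leNgt; apply/negP => gy.
    have : ~ closure D y by near: y.
    by apply; apply: subset_closure; rewrite D_def.
  have h : forall q, q0 <= q -> -1 * p_laplacian q phi y <= - (1 * b `^ (q - 1)) by near: y.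
  by have := h q hq; rewrite !mulN1r mul1r; lra.
Unshelve. all: by end_near. Qed.
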